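(* Let $\Omega$ be a domain in $\mathbb{C}^n$ and let $E$ be a closed set in $\mathbb{C}^n$ such that (1) there exists $r>0$ such that $E_r:=\{z\in\mathbb{C}^n : d(z,E)\le r\}\subset\Omega$; (2) there exist an affine-linear subspace $H\subset\mathbb{R}^{2n}=\mathbb{C}^n$ of real codimension $\ge 3$ and a number $R>0$ such that $E\subset H_R:=\{z\in\mathbb{C}^n : d(z,H)<R\}$; (3) $\Omega\setminus E$ is connected. Then every $L^2$ holomorphic function on $\Omega\setminus E$ can be extended to an $L^2$ holomorphic function on $\Omega$; that is, for every holomorphic $f:\Omega\setminus E\to\mathbb{C}$ with $\int_{\Omega\setminus E}|f|^2<\infty$ there exists a holomorphic $F:\Omega\to\mathbb{C}$ with $\int_\Omega|F|^2<\infty$ and $F=f$ on $\Omega\setminus E$.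
   Context: A domain is a connected open set; it need not be bounded, and $E$ need not be compact. $d(z,A)$ denotes the Euclidean distance from $z$ to the set $A$. Affine-linear subspaces are real affine subspaces of $\mathbb{R}^{2n}$ under the standard identification $\mathbb{C}^n=\mathbb{R}^{2n}$. Integrals are with respect to Lebesgue measure. *)

(* Defs.v *)
From HB Require Import structures.
From mathcomp Require Import all_boot all_order all_algebra.
From mathcomp Require Import all_classical all_reals all_analysis.
From mathcomp Require Import complex lra.

Set Implicit Arguments.
Unset Strict Implicit.
Unset Printing Implicit Defensive.

Import Order.TTheory GRing.Theory Num.Theory.
Import numFieldNormedType.Exports.

Local Open Scope classical_set_scope.
Local Open Scope ring_scope.

(* R[i] itself carries no topology; viewed as an abstract numFieldType it gets
   the normed topology, and 'rV[Cplx R]_n the product topology. *)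
Definition Cplx (R : realType) : numClosedFieldType := R[i].

(* The identification C^n = R^(2n),
   z |-> (Re z_1, .., Re z_n, Im z_1, .., Im z_n). *)
Definition realify (R : realType) n (z : 'rV[Cplx R]_n) : 'rV[R]_(n + n) :=
  row_mx (map_mx (@complex.Re R) z) (map_mx (@complex.Im R) z).

Definition real_affine_subspace (R : realType) n
    (a : 'rV[R]_(n + n)) (V : {vspace 'rV[R]_(n + n)}) : set 'rV[Cplx R]_n :=
  [set z | realify z - a \in V].

Definition domain (T : topologicalType) (A : set T) := open A /\ connected A.

Definition eucl_norm (R : realType) n (z : 'rV[Cplx R]_n) : R :=
  Num.sqrt (\sum_j Normc.normc (z 0 j) ^+ 2).

(* Extended-real valued, so that the distance to the empty set is +oo. *)
Definition eucl_dist (R : realType) n (z : 'rV[Cplx R]_n)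
    (A : set 'rV[Cplx R]_n) : \bar R :=
  ereal_inf [set (eucl_norm (z - a))%:E | a in A].

(* Differentiability is over the scalar field Cplx R, i.e. complex
   differentiability; only meant for open D. *)
Definition holomorphic_on (R : realType) n (D : set 'rV[Cplx R]_n)
    (f : 'rV[Cplx R]_n -> Cplx R) :=
  forall z, D z -> differentiable f z.

Section lebesgue_tuple.
Context {R : realType}.
Notation T := (measurableTypeR R).
Implicit Types N : nat.

Definition tuple_cons N (p : T * N.-tuple T) : N.+1.-tuple T :=
  [tuple of p.1 :: p.2].

Let measurable_tuple_cons N : measurable_fun setT (@tuple_cons N).
Proof. exact: measurable_cons. Qed.

Section step.
Variables (N : nat) (mu : {sigma_finite_measure set (N.-tuple T) -> \bar R}).

Definition lebesgue_tupleS : set (N.+1.-tuple T) -> \bar R :=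
  pushforward (lebesgue_measure \x mu)%E (@tuple_cons N).

Let pushed : {measure set (N.+1.-tuple T) -> \bar R} :=
  measure_function_pushforward__canonical__measure_function_Measure
    (lebesgue_measure \x mu)%E (@measurable_tuple_cons N).

HB.instance Definition _ := isMeasure.Build _ _ _ lebesgue_tupleS
  (measure0 pushed) (measure_ge0 pushed) (@measure_semi_sigma_additive _ _ _ pushed).

Let sigma_finite_lebesgue_tupleS : sigma_finite setT lebesgue_tupleS.
Proof.
have /sigma_finiteP[F [FT ndF Foo]] := sigma_finiteT (@lebesgue_measure R).
have /sigma_finiteP[G [GT ndG Goo]] := sigma_finiteT mu.
pose g (t : N.+1.-tuple T) : T * N.-tuple T := (thead t, [tuple of behead t]).
have gK : g \o @tuple_cons N = id.
  by apply/funext => -[x t]; rewrite /g /tuple_cons /= theadE; congr pair; exact/val_inj.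
have mg : measurable_fun setT g.
  by apply: measurable_fun_pair => /=; [exact: measurable_tnth|exact: measurable_behead].
exists (fun k => g @^-1` (F k `*` G k)).
  rewrite -preimage_bigcup -[LHS](preimage_setT g); congr (_ @^-1` _).
  rewrite -setXTT FT GT; apply/seteqP; split=> [[x t] /= [[i _ xi] [j _ tj]]|].
    exists (maxn i j) => //; split.
      by move: xi; exact/subsetPset/ndF/leq_maxl.
    by move: tj; exact/subsetPset/ndG/leq_maxr.
  by move=> [x t] [k _ /= [xk tk]]; split; exists k.
move=> k; have [mF Fk] := Foo k; have [mG Gk] := Goo k; split.
  by rewrite -[X in measurable X]setTI; apply: mg => //; exact: measurableX.
rewrite /lebesgue_tupleS /pushforward -comp_preimage gK.
by rewrite product_measure1E// lte_mul_pinfty// ge0_fin_numE.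
Qed.

HB.instance Definition _ := Measure_isSigmaFinite.Build _ _ _ lebesgue_tupleS
  sigma_finite_lebesgue_tupleS.

End step.

Fixpoint lebesgue_tuple N : {sigma_finite_measure set (N.-tuple T) -> \bar R} :=
  match N with
  | 0 => dirac [tuple]
  | N'.+1 => lebesgue_tupleS (lebesgue_tuple N')
  end.

Lemma lebesgue_tuple_box N (A : 'I_N -> set T) :
  (forall i, measurable (A i)) ->
  lebesgue_tuple N [set t | forall i, A i (tnth t i)] =
  (\prod_(i < N) lebesgue_measure (A i))%E.
Proof.
elim: N A => [|N IH] A mA.
  rewrite big_ord0 /= diracE mem_set//=; by case.
rewrite big_ord_recl /= /lebesgue_tupleS /pushforward.
rewrite -IH//.
have mbox : measurable [set t : N.-tuple T | forall i, A (lift ord0 i) (tnth t i)].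
  rewrite (_ : [set _ | _] = \bigcap_(i in [set: 'I_N])
      ((@tnth _ T ^~ i) @^-1` A (lift ord0 i))); last first.
    by apply/seteqP; split=> [t h i _|t h i]; [exact: h|exact: h].
  apply: fin_bigcap_measurable => // i _.
  by rewrite -[X in measurable X]setTI; exact: measurable_tnth.
rewrite -product_measure1E//; congr product_measure1.
apply/seteqP; split=> [[x t] /= h|[x t] [/= hx ht] i].
  split=> [|i]; first exact: (h ord0).
  by have := h (lift ord0 i); rewrite tnthS.
have [j ->|->//] := unliftP ord0 i.
by rewrite tnthS.
Qed.

End lebesgue_tuple.

Section lebesgue_Cn.
Context {R : realType} {n : nat}.
Notation T := (measurableTypeR R).
Notation Cn := 'rV[Cplx R]_n.

Definition borelCn := g_sigma_algebraType (@open Cn).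

HB.instance Definition _ := Measurable.on borelCn.

Definition complexify (t : (n + n).-tuple T) : borelCn :=
  \row_j Complex (tnth t (lshift n j)) (tnth t (rshift n j)).

Lemma realify_complexify t i : realify (complexify t) 0 i = tnth t i.
Proof.
rewrite /realify; have [j ->|j ->] := split_ordP i.
  by rewrite row_mxEl !mxE.
by rewrite row_mxEr !mxE.
Qed.

Let measurable_open_tuple N (A : set (N.-tuple T)) :
  (forall t, A t -> exists2 e : R, 0 < e &
    forall s, (forall i, `|tnth s i - tnth t i| < e) -> A s) ->
  measurable A.
Proof.
move=> oA.
pose Q := (N.-tuple rat * nat)%type.
pose box (p : Q) : set (N.-tuple T) :=
  [set s | forall i, `|tnth s i - ratr (tnth p.1 i)| < p.2.+1%:R^-1].
have mbox p : measurable (box p).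
  rewrite (_ : box p = \bigcap_(i in [set: 'I_N]) ((@tnth _ T ^~ i) @^-1`
      ball (ratr (tnth p.1 i) : R) p.2.+1%:R^-1)); last first.
    apply/seteqP; split=> [s h i _|s h i] /=.
      by rewrite /ball /= distrC; exact: h.
    by rewrite distrC; exact: (h i I).
  apply: fin_bigcap_measurable => // i _.
  rewrite -[X in measurable X]setTI; apply: measurable_tnth => //.
  by rewrite ball_itv; exact: measurable_itv.
pose D (p : Q) := box p `<=` A.
rewrite (_ : A = \bigcup_p (if `[< D p >] then box p else set0)); last first.
  apply/seteqP; split=> [t /oA[e e0 he]|t [p _]]; last first.
    by case: ifPn => // /asboolP; exact.
  have [k ke] : exists k : nat, k.+1%:R^-1 < e / 2.
    have /ltr_add_invr[k] : 0 < e / 2 :> R by rewrite divr_gt0.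
    by rewrite add0r; exists k.
  have rP (x : R) : exists q : rat, `|x - ratr q| < k.+1%:R^-1.
    have /rat_in_itvoo[q] : x - k.+1%:R^-1 < x + k.+1%:R^-1.
      by rewrite ltrD2l gtrN// invr_gt0.
    by rewrite in_itv/= => xq; exists q; rewrite distrC ltr_distl.
  pose q : N.-tuple rat := [tuple projT1 (cid (rP (tnth t i))) | i < N].
  exists (q, k) => //; rewrite asboolT.
    by move=> i /=; rewrite tnth_mktuple; case: cid.
  move=> s /= hs; apply: he => i; rewrite [e]splitr.
  rewrite (le_lt_trans (ler_distD (ratr (tnth q i)) _ _))// ltrD//.
    exact: lt_trans (hs i) ke.
  by rewrite distrC (lt_trans _ ke)// tnth_mktuple; case: cid.
apply: countable_bigcupT_measurable => [|p]; first exact: countableP.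
by case: ifP.
Qed.

Lemma measurable_complexify : measurable_fun setT complexify.
Proof.
apply: (@measurability _ _ _ borelCn setT complexify (@open Cn)) => //.
move=> _ [U oU <-]; rewrite setTI; apply: measurable_open_tuple => t /= Ut.
have /nbhs_ballP[e /= e0 eU] := open_nbhs_nbhs (conj oU Ut).
case: e => a b in e0 eU *; have [a0 b0] : 0 < a /\ b = 0.
  by move: e0; rewrite ltcE/= => /andP[/eqP -> ->].
exists (a / 2); first by rewrite divr_gt0.
move=> s hs; apply: eU; split=> // i j; rewrite /ball /= /complexify !mxE.
rewrite normc_def /= ltcE /= b0 eqxx /=.
have h k : (tnth t k - tnth s k) ^+ 2 < (a / 2) ^+ 2.
  have := hs k; rewrite ltr_distlC => /andP[? ?]; nra.
rewrite -[ltRHS](gtr0_norm a0) -sqrtr_sqr ltr_sqrt ?exprn_gt0//.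
have := h (lshift n j); have := h (rshift n j); nra.
Qed.

Definition lebesgue_Cn : set borelCn -> \bar R :=
  pushforward (lebesgue_tuple (n + n)) complexify.

Let pushed : {measure set borelCn -> \bar R} :=
  measure_function_pushforward__canonical__measure_function_Measure
    (lebesgue_tuple (n + n)) measurable_complexify.

HB.instance Definition _ := isMeasure.Build _ _ _ lebesgue_Cn
  (measure0 pushed) (measure_ge0 pushed)
  (@measure_semi_sigma_additive _ _ _ pushed).

Lemma lebesgue_Cn_box (A : 'I_(n + n) -> set T) :
  (forall i, measurable (A i)) ->
  lebesgue_Cn [set z | forall i, A i (realify z 0 i)] =
  (\prod_(i < n + n) lebesgue_measure (A i))%E.
Proof.
move=> mA; rewrite -lebesgue_tuple_box// /lebesgue_Cn /pushforward.
congr (lebesgue_tuple (n + n) _).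
by apply/seteqP; split=> t /= h i; have := h i; rewrite realify_complexify.
Qed.

End lebesgue_Cn.
Arguments borelCn : clear implicits.
Arguments lebesgue_Cn : clear implicits.

(* Measurability of f is not required separately: it is automatic for the
   holomorphic functions on open sets that this is applied to. *)
Definition square_integrable_on (R : realType) n (D : set 'rV[Cplx R]_n)
    (f : 'rV[Cplx R]_n -> Cplx R) :=
  (\int[lebesgue_Cn R n]_(z in D) (Normc.normc (f z) ^+ 2)%:E < +oo)%E.

(* Main.v *)
(* Choose w in C^n and three real linear functionals bounded on E, two of which
   restrict to the real and imaginary part of t on z + t w while the third one, m,
   is constant along these complex lines: codimension 3 leaves room for all three.
   Each slice z + t w then meets the c-neighbourhood of E only for bounded t.  Cover
   the t-plane by unit squares, select those whose centre t has z + t w within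
   c of E, and let F(z) be the Cauchy integral of f(z + t w)/t over the boundary of
   the union of the selected squares.  These boundary edges stay in Omega \ E even
   for z in E, so F is holomorphic near E, and by Goursat and Cauchy the correction
   F - f (suitably defined away from E) does not depend on the local choice of
   squares.  It is holomorphic off E and vanishes where m is large; following a
   half-line along which m grows, the identity theorem carries this zero up to E and
   then over the connected set Omega \ E.  On E, |F|^2 is bounded by integrals of
   |f|^2 over finitely many edges, so Tonelli and translation invariance give
   square integrability. *)

Require Import Defs.
From HB Require Import structures.
From mathcomp Require Import all_boot all_order all_algebra.
From mathcomp Require Import measurable_realfun.
From mathcomp Require Import all_classical all_reals all_analysis.
From mathcomp Require Import complex ring lra zify.

Set Implicit Arguments.
Unset Strict Implicit.
Unset Printing Implicit Defensive.

Import Order.TTheory GRing.Theory Num.Theory.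
Import numFieldNormedType.Exports.

Local Open Scope classical_set_scope.
Local Open Scope ring_scope.

(** The obstacle is that [E] may be unbounded, so that no fixed contour encircles the slices of [E]
    for all [z]. With a fixed grid the contour varies with [z], but only by squares whose slices lie
    in [Omega \ E]. Three scales make this work: the neighbourhood of radius [2 c] lies in [Omega],
    squares are selected at distance less than [c], and [w] is so short that a square moves a point
    by at most [c / 10] from its centre. An edge between a selected and an unselected square
    therefore stays inside [Omega] and off [E]. The bounds on the first two functionals are uniform
    on [E], so one finite set of edges serves all [z] in [E], each at distance at least 1/2 from the
    pole [t = 0]; this is the source of the square bound. In real codimension 2 the theorem fails,
    as [1 / z] on an annulus around a closed disc shows: all slices may meet the set. The third
    functional supplies slices that miss the neighbourhood of [E] altogether, where no square is
    selected and the correction is trivially zero. *)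

(* The norm of a normed module over Cplx R takes values in Cplx R. *)
Definition rnorm (R : realType) (V : normedModType (Cplx R)) (v : V) : R :=
  complex.Re `|v|.

(** * The real-valued norm and epsilon-delta forms of continuity and differentiability *)

Section RealNorm.
Context {R : realType}.
Local Notation C := (Cplx R).
Implicit Types V W : normedModType C.

Lemma real_Cplx_ge0 (x : C) : 0 <= x -> x = Complex (complex.Re x) 0.
Proof. by rewrite lecE/= => /andP[/eqP <- _]; case: x. Qed.

Lemma rnormE V (v : V) : `|v| = Complex (rnorm v) 0.
Proof. by rewrite [LHS]real_Cplx_ge0. Qed.

Lemma rnorm_ge0 V (v : V) : 0 <= rnorm v.
Proof. by have : 0 <= `|v| by []; rewrite rnormE lecE/= => /andP[]. Qed.

Lemma lt_rnorm V (v : V) (e : R) : (`|v| < Complex e 0 :> C) = (rnorm v < e).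
Proof. by rewrite rnormE ltcE/= eqxx. Qed.

Lemma rnorm0 V : rnorm (0 : V) = 0.
Proof. by rewrite /rnorm normr0. Qed.

Lemma rnormN V (v : V) : rnorm (- v) = rnorm v.
Proof. by rewrite /rnorm normrN. Qed.

Lemma rnorm0_eq0 V (v : V) : rnorm v = 0 -> v = 0.
Proof. by move=> h; apply/eqP; rewrite -normr_eq0 rnormE h. Qed.

Lemma rnormD V (u v : V) : rnorm (u + v) <= rnorm u + rnorm v.
Proof. by have := ler_normD u v; rewrite !rnormE lecE/= => /andP[]. Qed.

Lemma rnormB V (u v : V) : rnorm (u - v) = rnorm (v - u).
Proof. by rewrite -opprB rnormN. Qed.

Lemma rnormZ V (a : C) (v : V) : rnorm (a *: v) = rnorm (a : C) * rnorm v.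
Proof. by rewrite [LHS]/rnorm normrZ !rnormE /= mulr0 subr0. Qed.

Lemma rnormM (a b : C) : rnorm (a * b : C) = rnorm (a : C) * rnorm (b : C).
Proof. exact: (@rnormZ C). Qed.

Lemma rnormV (a : C) : rnorm (a^-1 : C) = (rnorm (a : C))^-1.
Proof.
have [->|a0] := eqVneq a 0; first by rewrite invr0 rnorm0 invr0.
have ra0 : rnorm a != 0 by apply: contra a0 => /eqP/rnorm0_eq0 ->.
apply: (mulfI ra0); rewrite -rnormM !divff//.
by rewrite /rnorm normr1.
Qed.

Lemma rnorm_normc (a : C) : rnorm (a : C) = Normc.normc a.
Proof. by []. Qed.

Lemma nbhs_rnorm V (x : V) (A : set V) :
  nbhs x A <-> exists2 e : R, 0 < e & forall y, rnorm (y - x) < e -> A y.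
Proof.
split=> [/nbhs_normP[e /= e0 eA]|[e e0 eA]].
  have [r0 eE] : 0 < complex.Re e /\ e = Complex (complex.Re e) 0.
    split; first by move: e0; rewrite ltcE/= => /andP[].
    by rewrite {1}[e]real_Cplx_ge0// ltW.
  exists (complex.Re e) => // y yx; apply: eA => /=.
  by rewrite eE distrC lt_rnorm.
apply/nbhs_normP; exists (Complex e 0); first by rewrite /= ltcE/= eqxx.
by move=> y /=; rewrite distrC lt_rnorm; exact: eA.
Qed.

Lemma nbhs_rnorm0 V (x : V) (A : set V) :
  nbhs x A <-> exists2 e : R, 0 < e & forall v, rnorm v < e -> A (x + v).
Proof.
split=> [/nbhs_rnorm[e e0 eA]|[e e0 eA]].
  by exists e => // v ve; apply: eA; rewrite addrC addKr.
by apply/nbhs_rnorm; exists e => // y /eA; rewrite addrC subrK.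
Qed.

Lemma open_rnorm V (A : set V) x : open A -> A x ->
  exists2 e : R, 0 < e & forall v, rnorm v < e -> A (x + v).
Proof. by move=> oA Ax; apply/nbhs_rnorm0; exact: open_nbhs_nbhs. Qed.

Lemma rnorm_cvg V W (f : V -> W) x : {for x, continuous f} <->
  forall e : R, 0 < e ->
    exists2 d : R, 0 < d & forall v, rnorm v < d -> rnorm (f (x + v) - f x) < e.
Proof.
split=> [cf e e0|cf A /nbhs_rnorm[e e0 eA]].
  have /cf/nbhs_rnorm0[d d0 dA] : nbhs (f x) [set y | rnorm (y - f x) < e].
    by apply/nbhs_rnorm; exists e.
  by exists d.
have [d d0 df] := cf _ e0.
by apply/nbhs_rnorm0; exists d => // v /df; exact: eA.
Qed.

Lemma differentiable_rnorm V W (f : V -> W) x : differentiable f x ->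
  forall e : R, 0 < e -> exists2 d : R, 0 < d &
    forall v, rnorm v < d -> rnorm (f (x + v) - f x - 'd f x v) <= e * rnorm v.
Proof.
move=> /diff_locally/eqaddoP df e e0.
have e0' : 0 < Complex e 0 :> C by rewrite ltcE/= eqxx.
have /nbhs_rnorm[d d0 dA] := df _ e0'.
exists d => // v vd; have := dA v; rewrite subr0 => /(_ vd).
rewrite /= !rnormE; rewrite lecE/= => /andP[_].
rewrite mul0r subr0; congr (rnorm _ <= _).
by rewrite /= !fctE/= opprD addrA [v + x]addrC.
Qed.

(** The bound by [K] supplies the continuity of the candidate derivative [L], which linearity alone
    does not give on a normed module of arbitrary dimension. *)
Lemma rnorm_differentiable V W (f L : V -> W) x (K : R) : linear L ->
  (forall v, rnorm (L v) <= K * rnorm v) ->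
  (forall e : R, 0 < e -> exists2 d : R, 0 < d &
    forall v, rnorm v < d -> rnorm (f (x + v) - f x - L v) <= e * rnorm v) ->
  differentiable f x.
Proof.
move=> lL bL hL.
pose L' : {linear V -> W} := HB.pack L (GRing.isLinear.Build _ _ _ _ L lL).
have cL : continuous L'.
  move=> z; apply/rnorm_cvg => e e0; exists (e / (`|K| + 1)).
    by rewrite divr_gt0// ltr_wpDl.
  move=> v; rewrite ltr_pdivlMr ?ltr_wpDl// => ve.
  rewrite linearD addrC addKr (le_lt_trans (bL _))//.
  apply: le_lt_trans ve; rewrite mulrC ler_wpM2l ?rnorm_ge0//.
  by rewrite (le_trans (ler_norm _))// lerDl.
have fL : f \o shift x = cst (f x) + L' +o_ 0 id.
  apply/eqaddoP => e e0.
  have [r0 eE] : 0 < complex.Re e /\ e = Complex (complex.Re e) 0.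
    split; first by move: e0; rewrite ltcE/= => /andP[].
    by rewrite {1}[e]real_Cplx_ge0// ltW.
  have [d d0 dA] := hL _ r0; apply/nbhs_rnorm; exists d => // v.
  rewrite subr0 => /dA vd; rewrite eE !rnormE lecE/= !(mul0r,mulr0).
  rewrite addr0 eqxx subr0 /=; apply: le_trans vd.
  by rewrite !fctE/= opprD addrA [v + x]addrC.
apply/diff_locallyP; rewrite (diff_unique cL fL); split=> //.
Qed.

Lemma diff_bound V W (f : V -> W) x : differentiable f x ->
  exists K : R, 0 < K /\ forall v, rnorm ('d f x v) <= K * rnorm v.
Proof.
move=> df; have /linear_lipschitz[k k0 kf] := diff_continuous df.
exists (complex.Re k); split; first by move: k0; rewrite ltcE/= => /andP[].
move=> v; have := kf v; rewrite [k]real_Cplx_ge0 ?(ltW k0)// !rnormE lecE/=.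
by rewrite !(mul0r,mulr0) subr0 => /andP[_].
Qed.

End RealNorm.

(** * Real and imaginary parts *)

Section ComplexParts.
Context {R : realType}.
Local Notation C := (Cplx R).
Implicit Types z w : C.

Definition imag_unit : C := Complex 0 1.

Lemma ReD z w : complex.Re (z + w : C) = complex.Re z + complex.Re w.
Proof. by case: z w => [? ?] [? ?]. Qed.

Lemma ImD z w : complex.Im (z + w : C) = complex.Im z + complex.Im w.
Proof. by case: z w => [? ?] [? ?]. Qed.

Lemma ReN z : complex.Re (- z : C) = - complex.Re z.
Proof. by case: z. Qed.

Lemma ImN z : complex.Im (- z : C) = - complex.Im z.
Proof. by case: z. Qed.

Lemma Re_mul z w : complex.Re (z * w : C) =
  complex.Re z * complex.Re w - complex.Im z * complex.Im w.
Proof. by case: z w => [? ?] [? ?]. Qed.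

Lemma Im_mul z w : complex.Im (z * w : C) =
  complex.Re z * complex.Im w + complex.Im z * complex.Re w.
Proof. by case: z w => [? ?] [? ?] /=; rewrite addrC. Qed.

Lemma complexP z w : complex.Re z = complex.Re w ->
  complex.Im z = complex.Im w -> z = w.
Proof. by case: z w => [? ?] [? ?] /= -> ->. Qed.

Lemma rnorm_sqr z : rnorm (z : C) ^+ 2 = complex.Re z ^+ 2 + complex.Im z ^+ 2.
Proof. by case: z => a b; rewrite rnorm_normc sqr_sqrtr// addr_ge0// sqr_ge0. Qed.

Lemma Re_le_rnorm z : `|complex.Re z| <= rnorm (z : C).
Proof.
rewrite -(@ler_pXn2r _ 2) ?nnegrE ?rnorm_ge0// rnorm_sqr real_normK ?num_real//.
by rewrite lerDl sqr_ge0.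
Qed.

Lemma Im_le_rnorm z : `|complex.Im z| <= rnorm (z : C).
Proof.
rewrite -(@ler_pXn2r _ 2) ?nnegrE ?rnorm_ge0// rnorm_sqr real_normK ?num_real//.
by rewrite lerDr sqr_ge0.
Qed.

Lemma rnorm_le_parts z : rnorm (z : C) <= `|complex.Re z| + `|complex.Im z|.
Proof.
rewrite -(@ler_pXn2r _ 2) ?nnegrE ?rnorm_ge0 ?addr_ge0// rnorm_sqr.
rewrite sqrrD !real_normK ?num_real//.
have : 0 <= `|complex.Re z| * `|complex.Im z| by rewrite mulr_ge0.
lra.
Qed.

Lemma rnorm_Complex_real (x : R) : rnorm (Complex x 0 : C) = `|x|.
Proof. by rewrite rnorm_normc /= expr0n addr0 sqrtr_sqr. Qed.

Lemma continuous_Re z : {for z, continuous (fun x : C => complex.Re x)}.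
Proof.
move=> A /nbhs_ballP[e /= e0 eA];
suff : nbhs (z : C) [set x : C | A (complex.Re x)] by [].
apply/nbhs_rnorm; exists e => // y ye.
apply: eA; rewrite /ball/= distrC -ReN -ReD.
exact: le_lt_trans (Re_le_rnorm _) ye.
Qed.

Lemma continuous_Im z : {for z, continuous (fun x : C => complex.Im x)}.
Proof.
move=> A /nbhs_ballP[e /= e0 eA];
suff : nbhs (z : C) [set x : C | A (complex.Im x)] by [].
apply/nbhs_rnorm; exists e => // y ye.
apply: eA; rewrite /ball/= distrC -ImN -ImD.
exact: le_lt_trans (Im_le_rnorm _) ye.
Qed.

Lemma continuous_horizontal (y x : R) :
  {for x, continuous (fun x : R => Complex x y : C)}.
Proof.
move=> A hA; have /nbhs_rnorm[e e0 eA] : nbhs (Complex x y : C) A := hA.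
apply/nbhs_ballP; exists e => //= t te.
apply: eA; have -> : (Complex t y : C) - Complex x y = Complex (t - x) 0.
  by apply: complexP; rewrite ?ReD ?ImD ?ReN ?ImN //= subrr.
by rewrite rnorm_Complex_real distrC.
Qed.

Lemma continuous_vertical (x y : R) :
  {for y, continuous (fun y : R => Complex x y : C)}.
Proof.
move=> A hA; have /nbhs_rnorm[e e0 eA] : nbhs (Complex x y : C) A := hA.
apply/nbhs_ballP; exists e => //= t te.
apply: eA; apply: le_lt_trans (rnorm_le_parts _) _.
by rewrite ReD ImD ReN ImN /= subrr normr0 add0r distrC.
Qed.

End ComplexParts.

(** * Integration over rectangles and Cauchy's theorem *)

Section ComplexIntegral.
Context {R : realType}.
Local Notation C := (Cplx R).
Local Notation mu := (@lebesgue_measure R).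
Implicit Types (a b c : R) (u v : R -> C).

Definition cint a b u : C :=
  Complex (\int[mu]_(x in `[a, b]) complex.Re (u x))%R
          (\int[mu]_(x in `[a, b]) complex.Im (u x))%R.

Definition cintegrable a b u :=
  mu.-integrable `[a, b] (EFin \o (fun x => complex.Re (u x))) /\
  mu.-integrable `[a, b] (EFin \o (fun x => complex.Im (u x))).

Lemma continuous_real_integrable a b (g : R -> R) :
  (forall x, a <= x <= b -> {for x, continuous g}) ->
  mu.-integrable `[a, b] (EFin \o g).
Proof.
move=> cg; apply: continuous_compact_integrable; first exact: segment_compact.
apply: continuous_in_subspaceT => x; rewrite inE/= in_itv/=; exact: cg.
Qed.

Lemma continuous_cintegrable a b u :
  (forall x, a <= x <= b -> {for x, continuous u}) -> cintegrable a b u.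
Proof.
move=> cu; split; apply: continuous_real_integrable => x /cu ux.
  by apply: (@continuous_comp _ _ _ u) ux _; exact: continuous_Re.
by apply: (@continuous_comp _ _ _ u) ux _; exact: continuous_Im.
Qed.

Lemma eq_cint a b u v : (forall x, a <= x <= b -> u x = v x) ->
  cint a b u = cint a b v.
Proof.
by move=> uv; congr Complex; apply: eq_Rintegral => x;
  rewrite inE/= in_itv/= => /uv ->.
Qed.

Lemma cintD a b u v : cintegrable a b u -> cintegrable a b v ->
  cint a b (fun x => u x + v x) = cint a b u + cint a b v.
Proof.
move=> [iu1 iu2] [iv1 iv2]; apply: complexP; rewrite ?ReD ?ImD /cint /=.
  by rewrite -RintegralD//; apply: eq_Rintegral => x _; rewrite ReD.
by rewrite -RintegralD//; apply: eq_Rintegral => x _; rewrite ImD.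
Qed.

Lemma cintegrableD a b u v : cintegrable a b u -> cintegrable a b v ->
  cintegrable a b (fun x => u x + v x).
Proof.
move=> [iu1 iu2] [iv1 iv2]; split.
  apply: eq_integrable (integrableD _ iu1 iv1) => // x _.
  by rewrite /= ReD EFinD.
apply: eq_integrable (integrableD _ iu2 iv2) => // x _.
by rewrite /= ImD EFinD.
Qed.

Lemma cintegrableZ a b (k : C) u : cintegrable a b u ->
  cintegrable a b (fun x => k * u x).
Proof.
move=> [iu1 iu2]; split.
  apply: eq_integrable (integrableB _ (integrableZl _ (complex.Re k) iu1)
    (integrableZl _ (complex.Im k) iu2)) => // x _.
  by rewrite /= Re_mul EFinB !EFinM.
apply: eq_integrable (integrableD _ (integrableZl _ (complex.Re k) iu2)
    (integrableZl _ (complex.Im k) iu1)) => // x _.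
by rewrite /= Im_mul EFinD !EFinM.
Qed.

Lemma cintZ a b (k : C) u : cintegrable a b u ->
  cint a b (fun x => k * u x) = k * cint a b u.
Proof.
move=> [iu1 iu2].
have iZ (r : R) (g : R -> R) : mu.-integrable `[a, b] (EFin \o g) ->
    mu.-integrable `[a, b] (EFin \o (fun x => r * g x)).
  move=> ig; apply: eq_integrable (integrableZl _ r ig) => //.
apply: complexP; rewrite ?Re_mul ?Im_mul /cint /=; rewrite -!RintegralZl//.
  by rewrite -RintegralB//; [|exact: iZ|exact: iZ];
    apply: eq_Rintegral => x _; rewrite Re_mul.
by rewrite -RintegralD//; [|exact: iZ|exact: iZ];
    apply: eq_Rintegral => x _; rewrite Im_mul.
Qed.

Lemma cintegrableB a b u v : cintegrable a b u -> cintegrable a b v ->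
  cintegrable a b (fun x => u x - v x).
Proof.
move=> iu iv; have := cintegrableD iu (cintegrableZ (-1) iv).
by congr cintegrable; apply/funext => x; rewrite mulN1r.
Qed.

Lemma cintB a b u v : cintegrable a b u -> cintegrable a b v ->
  cint a b (fun x => u x - v x) = cint a b u - cint a b v.
Proof.
move=> iu iv; rewrite -mulN1r -cintZ// -cintD//; last exact: cintegrableZ.
by apply: eq_cint => x _; rewrite mulN1r.
Qed.

Lemma cint_cst a b (k : C) : a <= b ->
  cint a b (fun=> k) = Complex (b - a) 0 * k.
Proof.
move=> ab; apply: complexP; rewrite ?Re_mul ?Im_mul /cint /= Rintegral_cst//=;
  rewrite lebesgue_measure_itv/= lte_fin; case: ltP => [_|ba] /=;
  rewrite ?(mul0r,subr0,addr0) 1?mulrC//;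
  by rewrite (_ : b - a = 0) ?mul0r//; apply/eqP; rewrite subr_eq0 eq_le ba.
Qed.

(** The factor 2 is the price of bounding the real and imaginary parts separately. *)
Lemma cint_bound a b (M : R) u : a <= b -> cintegrable a b u ->
  (forall x, a <= x <= b -> rnorm (u x) <= M) ->
  rnorm (cint a b u) <= 2 * M * (b - a).
Proof.
move=> ab [iu1 iu2] uM.
have key (g : R -> R) : mu.-integrable `[a, b] (EFin \o g) ->
    (forall x, a <= x <= b -> `|g x| <= M) ->
    `|(\int[mu]_(x in `[a, b]) g x)%R| <= M * (b - a).
  move=> ig gM; apply: le_trans (le_normr_Rintegral _ ig) _ => //.
  have -> : M * (b - a) = (\int[mu]_(x in `[a, b]) M)%R.
    rewrite Rintegral_cst//= lebesgue_measure_itv/= lte_fin.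
    case: ltP => [//|ba] /=; rewrite (_ : b - a = 0)//.
    by apply/eqP; rewrite subr_eq0 eq_le ba.
  apply: le_Rintegral => //.
  - exact: integrable_norm.
  - by apply: continuous_real_integrable => x _; exact: cst_continuous.
apply: (le_trans (rnorm_le_parts _)).
rewrite -mulrA mulrDl mul1r lerD//; apply: key => // x /uM xM.
  exact: le_trans (Re_le_rnorm _) xM.
exact: le_trans (Im_le_rnorm _) xM.
Qed.

Lemma cint_split a b c u : a <= c -> c <= b -> cintegrable a b u ->
  cint a b u = cint a c u + cint c b u.
Proof.
move=> ac cb [iu1 iu2].
have key (g : R -> R) : mu.-integrable `[a, b] (EFin \o g) ->
    (\int[mu]_(x in `[a, b]) g x =
     \int[mu]_(x in `[a, c]) g x + \int[mu]_(x in `[c, b]) g x)%R.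
  move=> ig; rewrite -(@Rintegral_itv_obnd_cbnd _ c); last first.
    apply: integrableS ig => //= x/=; rewrite !in_itv/= => /andP[/ltW cx ->].
    by rewrite (le_trans ac cx).
  by rewrite -(@Rintegral_itvB _ _ _ _ c ig) ?bnd_simp// addrC subrK.
by apply: complexP; rewrite ?ReD ?ImD; exact: key.
Qed.

Lemma cintegrableS a b a' b' u : a <= a' -> b' <= b ->
  cintegrable a b u -> cintegrable a' b' u.
Proof.
move=> aa bb [iu1 iu2].
have sub : `[a', b']%classic `<=` `[a, b]%classic.
  move=> x /=; rewrite !in_itv/= => /andP[? ?].
  by rewrite (le_trans aa)// (le_trans _ bb).
by split; [apply: integrableS iu1|apply: integrableS iu2].
Qed.

End ComplexIntegral.

(** * Goursat's theorem for rectangles *)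

Section Goursat.
Context {R : realType}.
Local Notation C := (Cplx R).
Local Notation "'ι" := (@imag_unit R).
Implicit Types (h g : C -> C) (x y : R) (a t : C).

Definition crect x1 x2 y1 y2 : set C :=
  [set t | x1 <= complex.Re t <= x2 /\ y1 <= complex.Im t <= y2].

(** The counterclockwise contour integral of [h dt], with opposite sides combined: [dt] is [dx] on
    horizontal sides and [ι dy] on vertical ones. *)
Definition rectint h x1 x2 y1 y2 : C :=
  cint x1 x2 (fun x => h (Complex x y1) - h (Complex x y2)) +
  'ι * cint y1 y2 (fun y => h (Complex x2 y) - h (Complex x1 y)).

Lemma rectint_splitx h x1 c x2 y1 y2 : x1 <= c -> c <= x2 ->
  (forall y, y = y1 \/ y = y2 -> cintegrable x1 x2 (fun x => h (Complex x y))) ->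
  (forall x, [\/ x = x1, x = c | x = x2] ->
    cintegrable y1 y2 (fun y => h (Complex x y))) ->
  rectint h x1 x2 y1 y2 = rectint h x1 c y1 y2 + rectint h c x2 y1 y2.
Proof.
move=> xc cx hx hy; rewrite /rectint.
rewrite (cint_split xc cx); last by apply: cintegrableB; apply: hx; auto.
rewrite !(@cintB _ y1 y2); try (apply: hy; by [apply: Or31|apply: Or32|apply: Or33]).
ring.
Qed.

Lemma rectint_splity h x1 x2 y1 c y2 : y1 <= c -> c <= y2 ->
  (forall x, x = x1 \/ x = x2 -> cintegrable y1 y2 (fun y => h (Complex x y))) ->
  (forall y, [\/ y = y1, y = c | y = y2] ->
    cintegrable x1 x2 (fun x => h (Complex x y))) ->
  rectint h x1 x2 y1 y2 = rectint h x1 x2 y1 c + rectint h x1 x2 c y2.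
Proof.
move=> xc cx hx hy; rewrite /rectint.
rewrite (cint_split xc cx); last by apply: cintegrableB; apply: hx; auto.
rewrite !(@cintB _ x1 x2); try (apply: hy; by [apply: Or31|apply: Or32|apply: Or33]).
ring.
Qed.

Lemma horizontal_cintegrable h x1 x2 y :
  (forall x, x1 <= x <= x2 -> {for (Complex x y : C), continuous h}) ->
  cintegrable x1 x2 (fun x => h (Complex x y)).
Proof.
move=> ch; apply: continuous_cintegrable => x xx.
apply: (@continuous_comp _ _ _ (fun x => Complex x y : C) h); last exact: ch.
exact: continuous_horizontal.
Qed.

Lemma vertical_cintegrable h x y1 y2 :
  (forall y, y1 <= y <= y2 -> {for (Complex x y : C), continuous h}) ->
  cintegrable y1 y2 (fun y => h (Complex x y)).
Proof.
move=> ch; apply: continuous_cintegrable => y yy.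
apply: (@continuous_comp _ _ _ (fun y => Complex x y : C) h); last exact: ch.
exact: continuous_vertical.
Qed.

Definition rect_boundary x1 x2 y1 y2 : set C :=
  [set t | x1 <= complex.Re t <= x2 /\ (complex.Im t = y1 \/ complex.Im t = y2)
        \/ y1 <= complex.Im t <= y2 /\ (complex.Re t = x1 \/ complex.Re t = x2)].

Definition boundary_continuous h x1 x2 y1 y2 :=
  forall t, rect_boundary x1 x2 y1 y2 t -> {for t, continuous h}.

Lemma rectint_bound h x1 x2 y1 y2 (M : R) : x1 <= x2 -> y1 <= y2 ->
  boundary_continuous h x1 x2 y1 y2 ->
  (forall t, rect_boundary x1 x2 y1 y2 t -> rnorm (h t) <= M) ->
  rnorm (rectint h x1 x2 y1 y2) <= 4 * M * ((x2 - x1) + (y2 - y1)).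
Proof.
move=> x12 y12 ch hM; apply: le_trans (rnormD _ _) _.
rewrite rnormM (_ : rnorm 'ι = 1) ?mul1r; last first.
  by rewrite rnorm_normc /= expr0n expr1n add0r sqrtr1.
rewrite mulrDr (_ : 4 * M = 2 * (M + M)); last by ring.
apply: lerD; apply: cint_bound => //.
- by apply: cintegrableB; apply: horizontal_cintegrable => x xx;
    apply: ch; left=> /=; auto.
- by move=> x xx; rewrite (le_trans (rnormD _ _))// rnormN lerD// hM//=; left=> /=; auto.
- by apply: cintegrableB; apply: vertical_cintegrable => y yy;
    apply: ch; right=> /=; auto.
- by move=> y yy; rewrite (le_trans (rnormD _ _))// rnormN lerD// hM//=; right=> /=; auto.
Qed.

Lemma rectint_linear h g (k : C) x1 x2 y1 y2 :
  boundary_continuous h x1 x2 y1 y2 -> boundary_continuous g x1 x2 y1 y2 ->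
  rectint (fun t => h t + k * g t) x1 x2 y1 y2 =
  rectint h x1 x2 y1 y2 + k * rectint g x1 x2 y1 y2.
Proof.
move=> ch cg; rewrite /rectint.
have H f : boundary_continuous f x1 x2 y1 y2 -> forall y, y = y1 \/ y = y2 ->
    cintegrable x1 x2 (fun x => f (Complex x y)).
  by move=> cf y yE; apply: horizontal_cintegrable => x xx; apply: cf; left.
have V f : boundary_continuous f x1 x2 y1 y2 -> forall x, x = x1 \/ x = x2 ->
    cintegrable y1 y2 (fun y => f (Complex x y)).
  by move=> cf x xE; apply: vertical_cintegrable => y yy; apply: cf; right.
have HD f : boundary_continuous f x1 x2 y1 y2 ->
    cintegrable x1 x2 (fun x => f (Complex x y1) - f (Complex x y2)).
  by move=> cf; apply: cintegrableB; apply: H; auto.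
have VD f : boundary_continuous f x1 x2 y1 y2 ->
    cintegrable y1 y2 (fun y => f (Complex x2 y) - f (Complex x1 y)).
  by move=> cf; apply: cintegrableB; apply: V; auto.
have key (a b : R) (u v : R -> C) : cintegrable a b u -> cintegrable a b v ->
    cint a b (fun x => u x + k * v x) = cint a b u + k * cint a b v.
  by move=> iu iv; rewrite cintD ?cintZ//; exact: cintegrableZ.
rewrite [RHS](_ : _ = (cint x1 x2 (fun x => h (Complex x y1) - h (Complex x y2)) +
  k * cint x1 x2 (fun x => g (Complex x y1) - g (Complex x y2))) + 'ι *
  (cint y1 y2 (fun y => h (Complex x2 y) - h (Complex x1 y)) +
  k * cint y1 y2 (fun y => g (Complex x2 y) - g (Complex x1 y)))); last by ring.
by rewrite -!key; try exact: HD; try exact: VD;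
  congr (_ + _ * _); apply: eq_cint => x _; ring.
Qed.

Lemma rectint_affine (k d : C) x1 x2 y1 y2 : x1 <= x2 -> y1 <= y2 ->
  rectint (fun t => k + t * d) x1 x2 y1 y2 = 0.
Proof.
move=> x12 y12; rewrite /rectint.
rewrite (@eq_cint _ _ _ _ (fun=> (Complex 0 (y1 - y2) : C) * d)); last first.
  move=> x _; rewrite opprD addrACA subrr add0r -mulrBl; congr (_ * _).
  by apply: complexP; rewrite ?ReD ?ImD ?ReN ?ImN //= subrr.
rewrite [X in _ + _ * X](@eq_cint _ _ _ _ (fun=> (Complex (x2 - x1) 0 : C) * d)); last first.
  move=> x _; rewrite opprD addrACA subrr add0r -mulrBl; congr (_ * _).
  by apply: complexP; rewrite ?ReD ?ImD ?ReN ?ImN //= subrr.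
rewrite !cint_cst// !mulrA -mulrDl (_ : _ + _ = 0) ?mul0r//.
by apply: complexP; rewrite ?ReD ?ImD !(Re_mul, Im_mul) /=; ring.
Qed.

(** The left ends increase and the right ends decrease, so the supremum of the left ends lies in
    every interval. *)
Lemma nested_point (u : nat -> R) (l : R) : 0 <= l ->
  (forall k, u k <= u k.+1 <= u k + l / 2 ^+ k.+1) ->
  exists c, forall k, u k <= c <= u k + l / 2 ^+ k.
Proof.
move=> l0 hu.
have ndu : {homo u : m n / (m <= n)%N >-> m <= n}.
  by apply/nondecreasing_seqP => n; have /andP[] := hu n.
have niv : {homo (fun k => u k + l / 2 ^+ k) : m n / (m <= n)%N >-> n <= m}.
  apply/nonincreasing_seqP => k; have /andP[_ h] := hu k.
  have -> : l / 2 ^+ k = l / 2 ^+ k.+1 + l / 2 ^+ k.+1.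
    by rewrite exprS; field; rewrite expf_neq0.
  by rewrite addrA lerD2r.
have cross m k : u m <= u k + l / 2 ^+ k.
  have p0 j : 0 <= l / 2 ^+ j by rewrite divr_ge0// exprn_ge0.
  case: (leqP m k) => [/ndu mk|/ltnW/niv /= km].
    by rewrite (le_trans mk)// lerDl.
  by rewrite (le_trans _ km)// lerDl.
exists (sup (range u)) => k; apply/andP; split.
  apply: ub_le_sup; last by exists k.
  by exists (u 0 + l / 2 ^+ 0) => _ [m _ <-].
by apply: ge_sup; [exists (u 0); exists 0%N|move=> _ [m _ <-]].
Qed.

Lemma continuous_cintegrable_crect h x1 x2 y1 y2 :
  (forall t, crect x1 x2 y1 y2 t -> {for t, continuous h}) ->
  (forall y, y1 <= y <= y2 -> cintegrable x1 x2 (fun x => h (Complex x y))) /\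
  (forall x, x1 <= x <= x2 -> cintegrable y1 y2 (fun y => h (Complex x y))).
Proof.
move=> ch; split=> [y yy|x xx].
  by apply: horizontal_cintegrable => x xx; apply: ch.
by apply: vertical_cintegrable => y yy; apply: ch.
Qed.

Lemma crectS x1 x2 y1 y2 x1' x2' y1' y2' :
  x1 <= x1' -> x2' <= x2 -> y1 <= y1' -> y2' <= y2 ->
  crect x1' x2' y1' y2' `<=` crect x1 x2 y1 y2.
Proof.
move=> xx1 xx2 yy1 yy2 t [/= /andP[t1 t2] /andP[t3 t4]]; split=> /=.
  by rewrite (le_trans xx1 t1) (le_trans t2 xx2).
by rewrite (le_trans yy1 t3) (le_trans t4 yy2).
Qed.

(** The integrals over the four quarters add up to the whole one, so they cannot all have modulus
    below [M]. *)
Lemma rectint_quarter h x y (X Y M : R) : 0 <= X -> 0 <= Y ->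
  (forall t, crect x (x + X + X) y (y + Y + Y) t -> {for t, continuous h}) ->
  M * 4 <= rnorm (rectint h x (x + X + X) y (y + Y + Y)) ->
  exists p : R * R, [/\ p.1 = x \/ p.1 = x + X, p.2 = y \/ p.2 = y + Y &
    M <= rnorm (rectint h p.1 (p.1 + X) p.2 (p.2 + Y))].
Proof.
move=> X0 Y0 ch.
have [hI vI] := continuous_cintegrable_crect ch.
have x01 : x <= x + X by rewrite lerDl.
have x12 : x + X <= x + X + X by rewrite lerDl.
have y01 : y <= y + Y by rewrite lerDl.
have y12 : y + Y <= y + Y + Y by rewrite lerDl.
have x02 := le_trans x01 x12; have y02 := le_trans y01 y12.
rewrite (rectint_splitx x01 x12); last 2 first.
  by move=> z [->|->]; apply: hI; apply/andP.
  by move=> z [->|->|->]; apply: vI; apply/andP.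
have sy (a b : R) : x <= a -> b <= x + X + X -> x <= b -> a <= x + X + X ->
    rectint h a b y (y + Y + Y) =
    rectint h a b y (y + Y) + rectint h a b (y + Y) (y + Y + Y).
  move=> xa bx xb ax; apply: rectint_splity => // z.
    by move=> [->|->]; apply: vI; apply/andP.
  by move=> [->|->|->]; apply: cintegrableS (hI _ _) => //; apply/andP.
rewrite !sy//; clear -Y0.
set a := rectint h x (x + X) y (y + Y); set b := rectint h x (x + X) _ _.
set c := rectint h (x + X) _ y (y + Y); set d := rectint h (x + X) _ _ _.
have [H|ha] := leP M (rnorm a); first by exists (x, y); split; auto.
have [H|hb] := leP M (rnorm b); first by exists (x, y + Y); split; auto.
have [H|hc] := leP M (rnorm c); first by exists (x + X, y); split; auto.
have [H|hd] := leP M (rnorm d); first by exists (x + X, y + Y); split; auto.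
have := rnormD (a + b) (c + d); have := rnormD a b; have := rnormD c d.
move: ha hb hc hd; move: (rnorm a) (rnorm b) (rnorm c) (rnorm d) => ra rb rc rd.
move: (rnorm (a + b)) (rnorm (c + d)) (rnorm (a + b + (c + d))) => rab rcd r.
clear; lra.
Qed.

(** Repeated quartering of a rectangle with integral of modulus [m > 0] gives nested rectangles
    around a point [c] with integrals at least [m / 4 ^+ k]. Near [c] the function is affine up to
    [e * rnorm (t - c)], and affine functions integrate to 0, so the integral is also at most a
    small multiple of the squared size, which is of order [1 / 4 ^+ k] too. *)
Lemma goursat h x1 x2 y1 y2 : x1 <= x2 -> y1 <= y2 ->
  (forall t, crect x1 x2 y1 y2 t -> differentiable h t) ->
  rectint h x1 x2 y1 y2 = 0.
Proof.
move=> x12 y12 dh; apply: rnorm0_eq0; apply/eqP; rewrite eq_le rnorm_ge0 andbT.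
rewrite leNgt; apply/negP => m0; set m := rnorm _ in m0.
have ch t : crect x1 x2 y1 y2 t -> {for t, continuous h}.
  by move=> /dh/differentiable_continuous.
set lx := x2 - x1; set ly := y2 - y1.
have lx0 : 0 <= lx by rewrite subr_ge0.
have ly0 : 0 <= ly by rewrite subr_ge0.
have p2 k : 0 < (2 : R) ^+ k by rewrite exprn_gt0.
pose P k (p : R * R) := [/\ x1 <= p.1, p.1 + lx / 2 ^+ k <= x2, y1 <= p.2,
  p.2 + ly / 2 ^+ k <= y2 & m / 4 ^+ k <=
  rnorm (rectint h p.1 (p.1 + lx / 2 ^+ k) p.2 (p.2 + ly / 2 ^+ k))].
have step k p : P k p -> exists q, [/\ P k.+1 q,
    p.1 <= q.1 <= p.1 + lx / 2 ^+ k.+1 & p.2 <= q.2 <= p.2 + ly / 2 ^+ k.+1].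
  case: p => x y [/= xx1 xx2 yy1 yy2 mk].
  have eX : x + lx / 2 ^+ k = x + lx / 2 ^+ k.+1 + lx / 2 ^+ k.+1.
    by rewrite -addrA; congr (_ + _); rewrite exprS; field; rewrite expf_neq0.
  have eY : y + ly / 2 ^+ k = y + ly / 2 ^+ k.+1 + ly / 2 ^+ k.+1.
    by rewrite -addrA; congr (_ + _); rewrite exprS; field; rewrite expf_neq0.
  have eM : m / 4 ^+ k = (m / 4 ^+ k.+1) * 4.
    by rewrite exprS; field; rewrite expf_neq0.
  rewrite {}eX {}eY {}eM in xx2 yy2 mk.
  set X := lx / 2 ^+ k.+1 in xx2 mk *; set Y := ly / 2 ^+ k.+1 in yy2 mk *.
  have X0 : 0 <= X by rewrite divr_ge0// ltW.
  have Y0 : 0 <= Y by rewrite divr_ge0// ltW.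
  have [|[x' y'] /= [hx hy hm]] := rectint_quarter X0 Y0 _ mk.
    by move=> t tr; apply: ch; apply: crectS tr.
  exists (x', y'); rewrite /P /= -/X -/Y.
  by case: hx hm => ->; case: hy => -> hm; (split; [split|..]) => //; clear -xx1 xx2 yy1 yy2 X0 Y0; lra.
have P0 : P 0%N (x1, y1).
  by split=> //=; rewrite !expr0 !divr1 /lx /ly ![_ + (_ - _)]addrC ?subrK//.
have [s [s0 sS]] : exists s : nat -> R * R, s 0%N = (x1, y1) /\
    forall k, [/\ P k (s k), (s k).1 <= (s k.+1).1 <= (s k).1 + lx / 2 ^+ k.+1 &
     (s k).2 <= (s k.+1).2 <= (s k).2 + ly / 2 ^+ k.+1].
  (* A fallback value where [P k p] fails makes the step total, so the sequence can be defined by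
     recursion and the invariant proved afterwards. *)
  have tot k p : exists q, P k p -> [/\ P k.+1 q,
      p.1 <= q.1 <= p.1 + lx / 2 ^+ k.+1 & p.2 <= q.2 <= p.2 + ly / 2 ^+ k.+1].
    by have [/step[q hq]|np] := pselect (P k p); [exists q|exists p].
  pose F k p := projT1 (cid (tot k p)).
  pose s := fix s k := if k is j.+1 then F j (s j) else (x1, y1).
  have Ps k : P k (s k).
    elim: k => // k IH; rewrite /= /F; case: cid => q /= /(_ IH); by case.
  exists s; split=> // k; have := Ps k; rewrite /= /F; case: cid => q /= hq pk.
  by have [] := hq pk.
have [cx hcx] : exists c, forall k, (s k).1 <= c <= (s k).1 + lx / 2 ^+ k.
  by apply: nested_point => // k; have [] := sS k.
have [cy hcy] : exists c, forall k, (s k).2 <= c <= (s k).2 + ly / 2 ^+ k.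
  by apply: nested_point => // k; have [] := sS k.
pose c : C := Complex cx cy.
have cin : crect x1 x2 y1 y2 c.
  have := hcx 0%N; have := hcy 0%N; rewrite s0 /= !expr0 !divr1 /lx /ly.
  by split=> /=; lra.
pose L := lx + ly.
have L0 : 0 <= L by rewrite addr_ge0.
(* With this [e] the upper bound [4 * e * (L / 2 ^+ k) ^+ 2] is smaller than [m / 4 ^+ k]. *)
pose e := m / (8 * (L ^+ 2 + 1)).
have e0 : 0 < e by rewrite divr_gt0// mulr_gt0// ltr_wpDl// sqr_ge0.
have [d d0 hd] := differentiable_rnorm (dh c cin) e0.
have [k kd] : exists k, L / 2 ^+ k < d.
  have /ltr_add_invr[k] : 0 < d / (L + 1) by rewrite divr_gt0// ltr_wpDl.
  rewrite add0r => kd; exists k.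
  have kk : (k.+1%:R : R) <= 2 ^+ k by rewrite -natrX ler_nat ltn_expl.
  rewrite ltr_pdivrMr//; move: kd; rewrite invf_plt ?posrE ?ltr_wpDl//; last first.
    by rewrite divr_gt0// ltr_wpDl.
  rewrite invf_div ltr_pdivrMr// => kd.
  rewrite (@le_lt_trans _ _ (L + 1)) ?lerDl// (lt_le_trans kd)//.
  by rewrite mulrC ler_wpM2l// ltW.
have [[xx1 xx2 yy1 yy2 mk] _ _] := sS k.
have := hcx k; have := hcy k; move: xx1 xx2 yy1 yy2 mk.
move: (s k) => [x y] /= xx1 xx2 yy1 yy2 mk /andP[cy1 cy2] /andP[cx1 cx2].
set X := lx / 2 ^+ k in xx2 mk cx2; set Y := ly / 2 ^+ k in yy2 mk cy2.
have X0 : 0 <= X by rewrite divr_ge0// ltW.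
have Y0 : 0 <= Y by rewrite divr_ge0// ltW.
pose D := 'd h c 1.
pose aff t : C := (h c - c * D) + t * D.
have bnd t : rect_boundary x (x + X) y (y + Y) t -> crect x (x + X) y (y + Y) t.
  by clear -X0 Y0; case=> -[/= tx [ty|ty]]; split=> /=; rewrite ?ty//; lra.
have sub t : crect x (x + X) y (y + Y) t -> crect x1 x2 y1 y2 t.
  by clear -xx1 xx2 yy1 yy2; move=> [/= tx ty]; split; lra.
have caff t : {for t, continuous aff}.
  apply: differentiable_continuous; rewrite /aff.
  apply: differentiableD; first exact: differentiable_cst.
  apply: differentiableM => //; exact: differentiable_cst.
have : rnorm (rectint (fun t => h t + (-1) * aff t) x (x + X) y (y + Y)) <=
    4 * (e * (X + Y)) * ((x + X - x) + (y + Y - y)).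
  apply: rectint_bound; [lra|lra|..].
    move=> t tb; apply: continuousD; first by apply: ch; exact/sub/bnd.
    by apply: continuousM; [exact: cst_continuous|exact: caff].
  move=> t /bnd[/= tx ty].
  have tc : rnorm (t - c) <= X + Y.
    apply: le_trans (rnorm_le_parts _) _; rewrite ReD ImD ReN ImN /=.
    by clear -tx ty cx1 cx2 cy1 cy2; rewrite lerD// ler_norml; lra.
  have XYd : X + Y < d by rewrite -mulrDl.
  have := hd (t - c) (le_lt_trans tc XYd).
  have -> : 'd h c (t - c) = (t - c) * D.
    by rewrite -[in LHS](mulr1 (t - c)); exact: linearZ.
  rewrite [c + _]addrC subrK => H.
  apply: (@le_trans _ _ (e * rnorm (t - c))); last by rewrite ler_pM2l.
  by move: H; rewrite /aff; congr (rnorm _ <= _); ring.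
rewrite rectint_linear; last first.
- by move=> t _; exact: caff.
- by move=> t tb; apply: ch; exact/sub/bnd.
rewrite rectint_affine; [|lra|lra]; rewrite mulr0 addr0 => /(le_trans mk).
apply/negP; rewrite -ltNge.
have -> : 4 * (e * (X + Y)) * (x + X - x + (y + Y - y)) = 4 * e * (X + Y) ^+ 2 by ring.
have -> : X + Y = L / 2 ^+ k by rewrite -mulrDl.
have -> : (4 : R) ^+ k = 2 ^+ k ^+ 2.
  by rewrite -exprM mulnC exprM; congr (_ ^+ k); ring.
rewrite expr_div_n mulrA ltr_pM2r ?invr_gt0 ?exprn_gt0//.
rewrite /e; set Q := L ^+ 2; have Q0 : 0 <= Q by rewrite sqr_ge0.
rewrite (_ : 4 * _ * Q = m * (Q / (2 * (Q + 1)))); last by field; lra.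
rewrite gtr_pMr// ltr_pdivrMr; lra.
Qed.

End Goursat.

(** * Removable singularities and the integral of 1/t *)

Section Cauchy.
Context {R : realType}.
Local Notation C := (Cplx R).
Local Notation "'ι" := (@imag_unit R).
Implicit Types (h g : C -> C) (x y : R) (a t : C).

Lemma rect_boundary_crect x1 x2 y1 y2 : x1 <= x2 -> y1 <= y2 ->
  rect_boundary x1 x2 y1 y2 `<=` crect x1 x2 y1 y2.
Proof.
by move=> x12 y12 t; case=> -[/= tx [ty|ty]]; split=> /=;
  rewrite ?ty// ?lexx ?andbT ?x12 ?y12.
Qed.

(** The strips cut off on the left, right, bottom and top avoid [a], so by [goursat] they contribute
    0. *)
Lemma rectint_shrink h a x1 x2 y1 y2 (d : R) : 0 < d ->
  x1 <= complex.Re a - d -> complex.Re a + d <= x2 ->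
  y1 <= complex.Im a - d -> complex.Im a + d <= y2 ->
  (forall t, crect x1 x2 y1 y2 t -> t != a -> differentiable h t) ->
  rectint h x1 x2 y1 y2 =
  rectint h (complex.Re a - d) (complex.Re a + d)
            (complex.Im a - d) (complex.Im a + d).
Proof.
case: a => ax ay /= d0 x1a ax2 y1a ay2 dh.
have hI b c y : x1 <= b -> c <= x2 -> y1 <= y <= y2 -> y <> ay ->
    cintegrable b c (fun x => h (Complex x y)).
  move=> xb cx yy ya; apply: horizontal_cintegrable => x /andP[bx xc].
  apply/differentiable_continuous/dh; first by split=> //=; rewrite (le_trans xb)// (le_trans xc).
  by apply/eqP => -[_ /ya].
have vI b c x : y1 <= b -> c <= y2 -> x1 <= x <= x2 -> x <> ax ->
    cintegrable b c (fun y => h (Complex x y)).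
  move=> yb cy xx xa; apply: vertical_cintegrable => y /andP[by_ yc].
  apply/differentiable_continuous/dh; first by split=> //=; rewrite (le_trans yb)// (le_trans yc).
  by apply/eqP => -[/xa].
have ne (u v : R) : u < v \/ v < u -> u <> v by move=> uv E; move: uv; rewrite E ltxx; case.
have zero b c b' c' : x1 <= b -> c <= x2 -> y1 <= b' -> c' <= y2 -> b <= c -> b' <= c' ->
    [\/ c < ax, ax < b, c' < ay | ay < b'] -> rectint h b c b' c' = 0.
  move=> xb cx yb cy bc bc' out; apply: goursat => // t tr; apply: dh.
    exact: crectS tr.
  apply/eqP => tE; case: tr; rewrite tE /= => /andP[u1 u2] /andP[u3 u4].
  by case: out; rewrite ltNge ?u1 ?u2 ?u3 ?u4.
have xd1 : ax - d < ax by rewrite gtrBl.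
have xd2 : ax < ax + d by rewrite ltrDl.
have yd1 : ay - d < ay by rewrite gtrBl.
have yd2 : ay < ay + d by rewrite ltrDl.
have xl := lt_trans xd1 xd2; have yl := lt_trans yd1 yd2.
have [x1d dx2] : x1 <= ax + d /\ ax - d <= x2.
  by split; [rewrite (le_trans x1a)// ltW|rewrite (le_trans _ ax2)// ltW].
have [y1d dy2] : y1 <= ay + d /\ ay - d <= y2.
  by split; [rewrite (le_trans y1a)// ltW|rewrite (le_trans _ ay2)// ltW].
have y12 := le_trans y1d ay2; have x12 := le_trans x1d ax2.
have [nx1 nx2] : ax - d <> ax /\ ax + d <> ax by split; apply: ne; auto.
have [ny1 ny2] : ay - d <> ay /\ ay + d <> ay by split; apply: ne; auto.
have nxb1 : x1 <> ax by apply: ne; left; rewrite (le_lt_trans x1a).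
have nxb2 : x2 <> ax by apply: ne; right; rewrite (lt_le_trans _ ax2).
have nyb1 : y1 <> ay by apply: ne; left; rewrite (le_lt_trans y1a).
have nyb2 : y2 <> ay by apply: ne; right; rewrite (lt_le_trans _ ay2).
rewrite (rectint_splitx x1a dx2); last 2 first.
  by move=> y [->|->]; apply: hI => //; rewrite ?lexx ?y12.
  by move=> x [->|->|->]; apply: vI => //; rewrite ?lexx ?x12 ?x1a ?dx2.
rewrite zero// ?add0r; last by apply: Or41.
rewrite (rectint_splitx (ltW xl) ax2); last 2 first.
  by move=> y [->|->]; apply: hI => //; rewrite ?lexx ?y12.
  by move=> x [->|->|->]; apply: vI => //; rewrite ?lexx ?x12 ?x1a ?x1d ?dx2 ?ax2.
rewrite [X in _ + X]zero// ?addr0; last by apply: Or42.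
rewrite (rectint_splity y1a dy2); last 2 first.
  by move=> x [->|->]; apply: vI => //; rewrite ?x1a ?dx2 ?x1d ?ax2.
  by move=> y [->|->|->]; apply: hI => //; rewrite ?lexx ?y12 ?y1a ?dy2.
rewrite zero// ?add0r; try exact: ltW; try (by apply: Or43).
rewrite (rectint_splity (ltW yl) ay2); last 2 first.
  by move=> x [->|->]; apply: vI => //; rewrite ?x1a ?dx2 ?x1d ?ax2.
  by move=> y [->|->|->]; apply: hI => //; rewrite ?lexx ?y12 ?y1a ?dy2 ?y1d ?ay2.
by rewrite [X in _ + X]zero// ?addr0; try exact: ltW; try (by apply: Or44).
Qed.

(** Riemann's condition for a removable singularity: [(t - a) h t] tends to 0. At [v = 0] it holds
    trivially, so the value [h a], typically a division by 0, is unconstrained. *)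
Definition negligible_pole h a := forall e : R, 0 < e ->
  exists2 d : R, 0 < d & forall v : C, rnorm v < d -> rnorm (v * h (a + v)) <= e.

Lemma goursat_pole h a x1 x2 y1 y2 :
  x1 < complex.Re a < x2 -> y1 < complex.Im a < y2 ->
  (forall t, crect x1 x2 y1 y2 t -> t != a -> differentiable h t) ->
  negligible_pole h a -> rectint h x1 x2 y1 y2 = 0.
Proof.
move=> /andP[xa ax] /andP[ya ay] dh pole; apply: rnorm0_eq0.
apply/eqP; rewrite eq_le rnorm_ge0 andbT; apply/ler_addgt0Pr => e e0.
(* On a square of half-side [r] with [rnorm (h t) <= e / 16 / r] on its boundary, [rectint_bound]
   gives [4 * (e / 16 / r) * (2 * r + 2 * r) = e]. *)
rewrite add0r; have e16 : 0 < e / 16 by rewrite divr_gt0.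
have [d d0 hd] := pole _ e16.
pose m1 := Num.min (complex.Re a - x1) (x2 - complex.Re a).
pose m2 := Num.min (complex.Im a - y1) (y2 - complex.Im a).
(* Boundary points of the square have distance at most [2 * r] from [a], which [d / 3] keeps below
   [d]. *)
pose r := Num.min (d / 3) (Num.min m1 m2).
have r0 : 0 < r by rewrite !lt_min !subr_gt0 xa ax ya ay divr_gt0.
have : r <= r by []; rewrite {2}/r !le_min => /andP[rd /andP[/andP[r1 r2] /andP[r3 r4]]].
rewrite (rectint_shrink r0 _ _ _ _ dh); [|lra..].
have xr : complex.Re a - r <= complex.Re a + r by clear -r0; lra.
have yr : complex.Im a - r <= complex.Im a + r by clear -r0; lra.
have tb t : rect_boundary (complex.Re a - r) (complex.Re a + r)
    (complex.Im a - r) (complex.Im a + r) t ->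
    r <= rnorm (t - a) /\ rnorm (t - a) < d.
  move=> bt; have [/= tx ty] := rect_boundary_crect xr yr bt.
  split; last first.
    apply: (le_lt_trans (rnorm_le_parts _)); rewrite ReD ImD ReN ImN.
    apply: (@le_lt_trans _ _ (r + r)); last by clear -rd r0; lra.
    by apply: lerD; rewrite ler_norml; clear -tx ty; lra.
  have := Re_le_rnorm (t - a); have := Im_le_rnorm (t - a).
  rewrite ReD ImD ReN ImN; case: bt => /= -[_ [->|->]].
  - by rewrite addrAC subrr add0r normrN (gtr0_norm r0).
  - by rewrite addrAC subrr add0r (gtr0_norm r0).
  - by rewrite addrAC subrr add0r normrN (gtr0_norm r0).
  - by rewrite addrAC subrr add0r (gtr0_norm r0).
have na t : rect_boundary (complex.Re a - r) (complex.Re a + r)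
    (complex.Im a - r) (complex.Im a + r) t -> t != a.
  by move=> /tb[+ _]; apply: contraTneq => ->; rewrite subrr rnorm0 -ltNge.
apply: (@le_trans _ _ (4 * (e / 16 / r) * ((complex.Re a + r - (complex.Re a - r)) +
    (complex.Im a + r - (complex.Im a - r))))).
  apply: rectint_bound => //.
    move=> t bt; apply/differentiable_continuous/dh; last exact: na bt.
    by apply: crectS (rect_boundary_crect xr yr bt); clear -r1 r2 r3 r4; lra.
  move=> t bt; have [rt td] := tb _ bt; rewrite ler_pdivlMr// mulrC.
  have := hd _ td; rewrite [a + _]addrC subrK rnormM; apply: le_trans.
  by rewrite ler_wpM2r// rnorm_ge0.
by rewrite le_eqVlt (_ : 4 * _ * _ = e) ?eqxx//; field; rewrite gt_eqF.
Qed.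

Lemma difference_quotient_negligible_pole h : {for 0, continuous h} ->
  negligible_pole (fun t => (h t - h 0) / t) 0.
Proof.
move=> /rnorm_cvg ch e e0; have [d d0 hd] := ch _ e0.
exists d => // v vd; have [->|v0] := eqVneq v 0; first by rewrite mul0r rnorm0 ltW.
rewrite add0r mulrCA divff// mulr1; have := hd v vd; rewrite add0r; exact: ltW.
Qed.

Lemma differentiable_inv t : t != 0 -> differentiable (fun t : C => t^-1 : C) t.
Proof. exact: differentiable_Rinv. Qed.

(* kappa is the integral of 1/t around the origin; only kappa != 0 is needed,
   not its value 2 pi i. *)
Definition kappa : C := rectint (fun t => t^-1) (- 2^-1) 2^-1 (- 2^-1) 2^-1.

(** This contour and the one defining [kappa] both shrink to a common small square around 0. *)
Lemma rectint_inv x1 x2 y1 y2 : x1 < 0 < x2 -> y1 < 0 < y2 ->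
  rectint (fun t : C => t^-1) x1 x2 y1 y2 = kappa.
Proof.
move=> /andP[x1_ x2_] /andP[y1_ y2_].
pose r := Num.min 2^-1 (Num.min (Num.min (- x1) x2) (Num.min (- y1) y2)).
have r0 : 0 < r by rewrite !lt_min !oppr_gt0 x1_ x2_ y1_ y2_ invr_gt0 ltr0n.
have : r <= r by []; rewrite {2}/r !le_min => /andP[rd /andP[/andP[r1 r2] /andP[r3 r4]]].
have H (a1 a2 b1 b2 : R) : a1 <= - r -> r <= a2 -> b1 <= - r -> r <= b2 ->
    rectint (fun t : C => t^-1) a1 a2 b1 b2 =
    rectint (fun t : C => t^-1) (- r) r (- r) r.
  move=> ? ? ? ?; have := @rectint_shrink (fun t : C => t^-1) (Complex 0 0) a1 a2 b1 b2 r r0.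
  rewrite /= !add0r; apply; [by []..|]; move=> t _; exact: differentiable_inv.
by rewrite /kappa !H ?lerN2// lerNr.
Qed.

(** In the imaginary part each pair of opposite sides contributes the integral of [1 / (x^2 + 1/4)]
    over a unit interval, and there the integrand is at least 1. *)
Lemma kappa_neq0 : kappa != 0.
Proof.
suff : 0 < complex.Im kappa by apply: contraTneq => ->; rewrite ltxx.
rewrite /kappa /rectint ImD Im_mul /= mul0r mul1r add0r.
have nz (x y : R) : y != 0 -> x ^+ 2 + y ^+ 2 != 0.
  by move=> y0; rewrite gt_eqF// ltr_wpDl ?sqr_ge0// exprn_even_gt0.
have lower (g : R -> R) : lebesgue_measure.-integrable `[- 2^-1 : R, 2^-1] (EFin \o g) ->
    (forall x, - 2^-1 <= x <= 2^-1 -> 1 <= g x) ->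
    1 <= (\int[lebesgue_measure]_(x in `[- 2^-1, 2^-1]) g x)%R.
  move=> cg g1.
  apply: (@le_trans _ _ (\int[lebesgue_measure]_(x in `[- 2^-1 : R, 2^-1]) 1)%R).
    by rewrite Rintegral_cst//= lebesgue_measure_itv/= lte_fin ifT/=; lra.
  apply: le_Rintegral; first by [].
  - by apply: continuous_real_integrable => x _; exact: cst_continuous.
  - exact: cg.
  - by move=> x; rewrite /= in_itv/=; exact: g1.
have cinv (x y : R) : (x != 0) || (y != 0) -> {for (Complex x y : C), continuous (fun t : C => t^-1 : C)}.
  move=> xy; apply: differentiable_continuous; apply: differentiable_inv.
  by apply: contraTneq xy => -[-> ->]; rewrite eqxx.
have h0 : (2^-1 : R) != 0 by rewrite invr_eq0.
have hN0 : (- 2^-1 : R) != 0 by rewrite oppr_eq0.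
have hi (y : R) : y != 0 -> cintegrable (- 2^-1) 2^-1 (fun x => (Complex x y : C)^-1 : C).
  by move=> y0; apply: (@horizontal_cintegrable _ (fun t : C => t^-1)) => x _;
    apply: cinv; rewrite y0 orbT.
have vi (x : R) : x != 0 -> cintegrable (- 2^-1) 2^-1 (fun y => (Complex x y : C)^-1 : C).
  by move=> x0; apply: (@vertical_cintegrable _ (fun t : C => t^-1)) => y _;
    apply: cinv; rewrite x0.
apply: ltr_pwDl.
  apply: (lt_le_trans ltr01); apply: lower => [|x xx].
    by have [_] := cintegrableB (hi _ hN0) (hi _ h0).
  rewrite sqrrN mulNr !opprK.
  have x2 : 0 < x ^+ 2 + 2^-1 ^+ 2 by rewrite ltr_wpDl ?sqr_ge0// exprn_gt0// invr_gt0.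
  rewrite -mulrDl ler_pdivlMr//; nra.
apply: le_trans ler01 _; apply: lower => [|x xx].
  by have [] := cintegrableB (vi _ h0) (vi _ hN0).
rewrite sqrrN mulNr opprK.
have x2 : 0 < 2^-1 ^+ 2 + x ^+ 2 by rewrite ltr_wpDr ?sqr_ge0// exprn_gt0// invr_gt0.
rewrite -mulrDl ler_pdivlMr//; nra.
Qed.

End Cauchy.

(** * Cauchy's formula and the second-order Taylor bound in one variable *)

Section CauchyFormula.
Context {R : realType}.
Local Notation C := (Cplx R).
Local Notation kappa := (@kappa R).
Implicit Types (h g : C -> C) (x y : R) (a t : C).

Lemma rect_boundary_neq0 x1 x2 y1 y2 t : x1 < 0 < x2 -> y1 < 0 < y2 ->
  rect_boundary x1 x2 y1 y2 t -> t != 0.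
Proof.
move=> /andP[x1_ x2_] /andP[y1_ y2_] bt; apply/eqP => t0; move: bt.
by rewrite t0; case=> -[_ [] /= E]; move: x1_ x2_ y1_ y2_; rewrite -E ltxx.
Qed.

Lemma square_boundary_rnorm (s : R) t : 0 <= s ->
  rect_boundary (- s) s (- s) s t -> s <= rnorm t.
Proof.
move=> s0; have [Ret Imt] := (Re_le_rnorm t, Im_le_rnorm t).
case=> -[_ [E|E]]; [move: Imt|move: Imt|move: Ret|move: Ret];
  by rewrite E ?normrN ger0_norm.
Qed.

Lemma square_rnorm (s : R) t : crect (- s) s (- s) s t -> rnorm t <= 2 * s.
Proof.
move=> [tx ty]; apply: (le_trans (rnorm_le_parts _)).
by rewrite mulr2n mulrDl mul1r lerD// ler_norml.
Qed.

(** The linear step common to both Cauchy formulas: [h 0 / t] integrates to [kappa * h 0]. *)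
Lemma cauchy_formula_of_vanishing h x1 x2 y1 y2 :
  x1 < 0 < x2 -> y1 < 0 < y2 -> boundary_continuous h x1 x2 y1 y2 ->
  rectint (fun t => (h t - h 0) / t) x1 x2 y1 y2 = 0 ->
  kappa * h 0 = rectint (fun t => h t / t) x1 x2 y1 y2.
Proof.
move=> x0 y0 ch.
have cinv : boundary_continuous (fun t : C => t^-1 : C) x1 x2 y1 y2.
  move=> t /(rect_boundary_neq0 x0 y0) t0.
  exact/differentiable_continuous/differentiable_inv.
rewrite (_ : (fun t => (h t - h 0) / t) = (fun t => h t / t + (- h 0) * t^-1)); last first.
  by apply/funext => t; rewrite mulrDl.
have chi : boundary_continuous (fun t => h t / t) x1 x2 y1 y2.
  by move=> t tb; apply: continuousM; [exact: ch|exact: cinv].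
rewrite (rectint_linear _ chi cinv).
by rewrite rectint_inv// mulNr mulrC => /eqP; rewrite subr_eq0 eq_sym => /eqP.
Qed.

Lemma cauchy_formula h x1 x2 y1 y2 : x1 < 0 < x2 -> y1 < 0 < y2 ->
  {for 0, continuous h} ->
  (forall t, crect x1 x2 y1 y2 t -> t != 0 -> differentiable h t) ->
  kappa * h 0 = rectint (fun t => h t / t) x1 x2 y1 y2.
Proof.
move=> x0 y0 c0 dh.
have x12 : x1 <= x2 by case/andP: x0 => ? ?; exact/ltW/(@lt_trans _ _ 0).
have y12 : y1 <= y2 by case/andP: y0 => ? ?; exact/ltW/(@lt_trans _ _ 0).
apply: (cauchy_formula_of_vanishing x0 y0).
  move=> t tb; apply/differentiable_continuous/dh.
    exact: rect_boundary_crect tb.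
  exact: rect_boundary_neq0 tb.
apply: (@goursat_pole _ _ 0 _ _ _ _ x0 y0).
  move=> t tr t0; apply: differentiableM; last exact: differentiable_inv.
  by apply: differentiableB; [exact: dh|exact: differentiable_cst].
exact: difference_quotient_negligible_pole.
Qed.

(** The difference quotient has two removable singularities, [a] and 0. A vertical cut at
    [complex.Re a / 2] separates them, and [goursat_pole] applies on either side. *)
Lemma cauchy_formula_pole h a x1 x2 y1 y2 :
  x1 < complex.Re a -> complex.Re a < 0 -> 0 < x2 -> y1 < 0 < y2 ->
  y1 < complex.Im a < y2 -> {for 0, continuous h} -> negligible_pole h a ->
  (forall t, crect x1 x2 y1 y2 t -> t != 0 -> t != a -> differentiable h t) ->
  kappa * h 0 = rectint (fun t => h t / t) x1 x2 y1 y2.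
Proof.
move=> xa a0 x2_ y0 ya c0 pole dh.
have x1_ := lt_trans xa a0.
have y12 : y1 <= y2 by case/andP: y0 => ? ?; exact/ltW/(@lt_trans _ _ 0).
have x12 : x1 <= x2 by exact/ltW/(lt_trans x1_ x2_).
pose g t := (h t - h 0) / t.
have dg t : crect x1 x2 y1 y2 t -> t != 0 -> t != a -> differentiable g t.
  move=> tr t0 ta; apply: differentiableM; last exact: differentiable_inv.
  by apply: differentiableB; [exact: dh|exact: differentiable_cst].
have na t : rect_boundary x1 x2 y1 y2 t -> t != a.
  move=> tb; apply/eqP => tE; case: tb; rewrite tE => -[_ [] E];
  by move: ya xa (lt_trans a0 x2_); rewrite E !ltxx//= ?andbF.
have x10 : x1 < 0 < x2 by rewrite x1_.
apply: (cauchy_formula_of_vanishing x10 y0).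
  move=> t tb; apply/differentiable_continuous/dh; last exact: na.
    exact: rect_boundary_crect tb.
  exact: rect_boundary_neq0 tb.
pose m := complex.Re a / 2.
have [am m0] : complex.Re a < m /\ m < 0 by rewrite /m; clear -a0; lra.
have mx2 := lt_trans m0 x2_; have x1m := lt_trans xa am.
have vI x : x1 <= x <= x2 -> x != 0 -> x != complex.Re a ->
    cintegrable y1 y2 (fun y => g (Complex x y)).
  move=> xx xn0 xna; apply: vertical_cintegrable => y yy.
  apply/differentiable_continuous/dg; first by split.
    by apply: contraNneq xn0 => -[->].
  by apply: contraNneq xna => <-.
have hI y : y = y1 \/ y = y2 -> cintegrable x1 x2 (fun x => g (Complex x y)).
  move=> yE; apply: horizontal_cintegrable => x xx.
  have tb : rect_boundary x1 x2 y1 y2 (Complex x y) by left.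
  apply/differentiable_continuous/dg; last exact: na.
    exact: rect_boundary_crect tb.
  exact: rect_boundary_neq0 tb.
rewrite (rectint_splitx (ltW x1m) (ltW mx2))//; last first.
  move=> x [->|->|->]; apply: vI;
    rewrite ?(ltW x1m) ?(ltW mx2) ?lexx ?x12//.
  - by rewrite lt_eqF.
  - by rewrite lt_eqF.
  - by rewrite lt_eqF.
  - by rewrite gt_eqF.
  - by rewrite gt_eqF.
  - by rewrite gt_eqF// (lt_trans a0).
have xam : x1 < complex.Re a < m by rewrite xa.
have m0x : m < 0 < x2 by rewrite m0.
rewrite (@goursat_pole _ g a _ _ _ _ xam ya); last 2 first.
  move=> t tr ta; apply: dg => //; first by apply: crectS tr; rewrite // ltW.
  by apply/eqP => tE; case: tr => /andP[_]; rewrite tE /= leNgt m0.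
  move=> e e0; have ra : 0 < rnorm a / 2.
    rewrite divr_gt0// lt_def rnorm_ge0 andbT.
    by apply: contraTneq a0 => /rnorm0_eq0 ->; rewrite ltxx.
  have e2 : 0 < e * (rnorm a / 2) / 2 by rewrite divr_gt0// mulr_gt0.
  have [d d0 hd] := pole _ e2.
  (* [d2] controls the term [v * h 0], [d] controls [v * h (a + v)], and [rnorm a / 2] keeps the
     denominator [a + v] away from 0. *)
  pose d2 := e * (rnorm a / 2) / (2 * (rnorm (h 0) + 1)).
  have h1 : 0 < rnorm (h 0) + 1 by rewrite ltr_wpDl// rnorm_ge0.
  exists (Num.min d (Num.min (rnorm a / 2) d2)).
    by rewrite !lt_min d0 ra /= divr_gt0// mulr_gt0.
  move=> v; rewrite !lt_min => /andP[vd /andP[va ve]].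
  have hv := hd v vd.
  have rav : rnorm a / 2 <= rnorm (a + v).
    have : rnorm a <= rnorm (a + v) + rnorm v.
      by rewrite -{1}(addrK v a) (le_trans (rnormD _ _))// rnormN.
    clear -va; lra.
  rewrite /g mulrA rnormM rnormV ler_pdivrMr; last exact: lt_le_trans rav.
  apply: (@le_trans _ _ (e * (rnorm a / 2))); last by rewrite ler_pM2l.
  rewrite mulrBr (le_trans (rnormD _ _))// rnormN [leRHS]splitr lerD//.
  rewrite rnormM; move: ve; rewrite ltr_pdivlMr ?mulr_gt0// => ve.
  rewrite ler_pdivlMr//; apply: le_trans (ltW ve).
  by rewrite -mulrA ler_wpM2l ?rnorm_ge0// mulrC ler_wpM2l// lerDl.
rewrite add0r; apply: (@goursat_pole _ g 0 _ _ _ _ m0x y0); last first.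
  exact: difference_quotient_negligible_pole.
move=> t tr t0; apply: dg => //; first by apply: crectS tr; rewrite // ltW.
by apply/eqP => tE; case: tr => /andP[]; rewrite tE /= leNgt am.
Qed.

(** Collects the factors in [taylor1]: [2 + 32 / rnorm kappa] bounds the second-order quotient, the
    leading 32 is [4 * (2 / s) * (4 * s)] from the contour, and the last division solves Cauchy's
    formula for the value at the centre. *)
Definition taylor_const : R := 32 * (2 + 32 / rnorm kappa) / rnorm kappa.

Lemma rnorm_kappa_gt0 : 0 < rnorm kappa.
Proof.
rewrite lt_def rnorm_ge0 andbT; apply: contraNneq (@kappa_neq0 R).
by move/rnorm0_eq0 => ->.
Qed.

(** The quotient [q t = (h t - h 0 - t * D) / t^2] has a removable singularity at 0, and [q 1] is
    the remainder. Cauchy's formula centred at 1 bounds it by its size on a contour of half-side [s]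
    around 0, where dividing by [t^2] yields the factor [1 / s^2]. *)
Lemma taylor1 h (s M : R) : 2 <= s -> 0 <= M ->
  (forall t, rnorm t <= 2 * s -> differentiable h t) ->
  (forall t, rnorm t <= 2 * s -> rnorm (h t) <= M) ->
  rnorm (h 1 - h 0 - 'd h 0 1) <= taylor_const * M / s ^+ 2.
Proof.
move=> s2 M0 dh hM; set D := 'd h 0 1; set k := rnorm kappa.
have k0 : 0 < k := rnorm_kappa_gt0.
have s0 : 0 < s by clear -s2; lra.
have sN0 : - s < 0 < s by rewrite oppr_lt0 s0.
have ssN : - s <= s by clear -s0; lra.
have rn0 : rnorm (0 : C) <= 2 * s by rewrite rnorm0 mulr_ge0// ltW.
have dv (v : C) : 'd h 0 v = v * D by rewrite -[in LHS](mulr1 v); exact: linearZ.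
have h0 := differentiable_rnorm (dh 0 rn0).
have Mdif t : rnorm t <= 2 * s -> rnorm (h t - h 0) <= 2 * M.
  move=> ts; rewrite (le_trans (rnormD _ _))// rnormN mulr2n mulrDl mul1r.
  by rewrite lerD// hM.
(* Cauchy's estimate: [D] is the value at 0 of the difference quotient, so [kappa * D] is a contour
   integral of [(h t - h 0) / t^2]. *)
have DM : rnorm D <= 32 * M / (s * k).
  have bneq0 t : rect_boundary (- s) s (- s) s t -> t != 0.
    exact: rect_boundary_neq0.
  have bsq t : rect_boundary (- s) s (- s) s t -> rnorm t <= 2 * s.
    by move=> /(rect_boundary_crect ssN ssN); exact: square_rnorm.
  have dq t : rnorm t <= 2 * s -> t != 0 ->
      differentiable (fun t => (h t - h 0) / t) t.
    move=> ts t0; apply: differentiableM; last exact: differentiable_inv.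
    by apply: differentiableB; [exact: dh|exact: differentiable_cst].
  have dq2 t : rnorm t <= 2 * s -> t != 0 ->
      differentiable (fun t => (h t - h 0) / t / t) t.
    by move=> ts t0; apply: differentiableM; [exact: dq|exact: differentiable_inv].
  have : rectint (fun t => ((h t - h 0) / t - D) / t) (- s) s (- s) s = 0.
    apply: (@goursat_pole _ _ 0 _ _ _ _ sN0 sN0).
      move=> t /square_rnorm ts t0; apply: differentiableM; last exact: differentiable_inv.
      by apply: differentiableB; [exact: dq|exact: differentiable_cst].
    move=> e e0; have [d d0 hd] := h0 _ e0.
    exists d => // v vd; rewrite add0r.
    have [->|v0] := eqVneq v 0; first by rewrite mul0r rnorm0 ltW.
    have rv : 0 < rnorm v.
      by rewrite lt_def rnorm_ge0 andbT; apply: contraNneq v0 => /rnorm0_eq0 ->.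
    rewrite mulrCA divff// mulr1 -(ler_pM2l rv) -rnormM mulrBr mulrCA divff// mulr1.
    by have := hd v vd; rewrite add0r dv mulrC [e * _]mulrC.
  rewrite (_ : (fun t => ((h t - h 0) / t - D) / t) =
      (fun t => (h t - h 0) / t / t + (- D) * t^-1)); last first.
    by apply/funext => t; rewrite mulrDl.
  have cq2 : boundary_continuous (fun t => (h t - h 0) / t / t) (- s) s (- s) s.
    by move=> t tb; apply/differentiable_continuous/dq2; [exact: bsq|exact: bneq0].
  have cinv : boundary_continuous (fun t : C => t^-1 : C) (- s) s (- s) s.
    by move=> t /bneq0 t0; exact/differentiable_continuous/differentiable_inv.
  rewrite (rectint_linear _ cq2 cinv).
  rewrite rectint_inv// mulNr => /eqP; rewrite subr_eq0 => /eqP E.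
  have : rnorm (D * kappa) <= 4 * (2 * M / s / s) * ((s - - s) + (s - - s)).
    rewrite -E; apply: (rectint_bound ssN ssN cq2).
    move=> t tb; have st := square_boundary_rnorm (ltW s0) tb.
    have tp := lt_le_trans s0 st.
    have ti : (rnorm t)^-1 <= s^-1 by rewrite lef_pV2 ?posrE.
    have ti0 : 0 <= (rnorm t)^-1 by rewrite invr_ge0 ltW.
    rewrite !(rnormM, rnormV) !ler_pM ?mulr_ge0 ?rnorm_ge0//.
    by apply: Mdif; exact: bsq.
  rewrite rnormM -/k -ler_pdivlMr// => /le_trans; apply.
  rewrite le_eqVlt (_ : 4 * _ * _ / k = 32 * M / (s * k)) ?eqxx//.
  by field; rewrite !gt_eqF.
pose q t := (h t - h 0 - t * D) * (t^-1 * t^-1).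
(* Recentring moves the evaluation point 1 to 0 and the singularity to -1, the configuration of
   [cauchy_formula_pole]. *)
pose H t := q (t + 1).
have shift1 t : rect_boundary (- s - 1) (s - 1) (- s) s t ->
    rect_boundary (- s) s (- s) s (t + 1).
  case: t => x y; rewrite /rect_boundary /=; rewrite addr0.
  by case=> -[xx [E|E]]; [left|left|right|right]; clear -xx E; (split; [lra|]);
    [left|right|left|right]; lra.
have shiftc t : crect (- s - 1) (s - 1) (- s) s t -> crect (- s) s (- s) s (t + 1).
  by case: t => x y [/= xx yy]; split; rewrite /= ?addr0//; clear -xx; lra.
have dqq t : rnorm t <= 2 * s -> t != 0 -> differentiable q t.
  move=> ts t0; apply: differentiableM; last first.
    by apply: differentiableM; exact: differentiable_inv.
  apply: differentiableB.
    by apply: differentiableB; [exact: dh|exact: differentiable_cst].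
  by apply: differentiableM => //; exact: differentiable_cst.
have dH t : rnorm (t + 1) <= 2 * s -> t != -1 -> differentiable H t.
  move=> ts t1; apply: (@differentiable_comp _ _ _ _ (fun t : C => t + 1 : C) q).
    by apply: differentiableD => //; exact: differentiable_cst.
  by apply: dqq => //; rewrite addr_eq0.
have r1 : rnorm (1 : C) = 1 by rewrite rnorm_normc /= expr1n expr0n addr0 sqrtr1.
have H0 : H 0 = h 1 - h 0 - D.
  by rewrite /H /q add0r invr1 !mulr1 mul1r.
have E : kappa * H 0 = rectint (fun t => H t / t) (- s - 1) (s - 1) (- s) s.
  apply: (@cauchy_formula_pole _ (-1)); rewrite /=.
  - by clear -s0; lra.
  - by rewrite ltrN10.
  - by clear -s2; lra.
  - exact: sN0.
  - by rewrite oppr0.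
  - apply/differentiable_continuous/dH; last by rewrite eq_sym oppr_eq0 oner_eq0.
    by rewrite add0r r1; clear -s2; lra.
  - move=> e e0; have [d d0 hd] := h0 _ e0; exists d => // v vd.
    rewrite /H addrAC addNr add0r /q.
    have [->|v0] := eqVneq v 0; first by rewrite mul0r rnorm0 ltW.
    have rv : 0 < rnorm v.
      by rewrite lt_def rnorm_ge0 andbT; apply: contraNneq v0 => /rnorm0_eq0 ->.
    rewrite mulrCA [v * (_ * _)]mulrA divff// mul1r rnormM rnormV ler_pdivrMr//.
    by have := hd v vd; rewrite add0r dv.
  - move=> t /shiftc/square_rnorm ts _ ta; exact: dH.
rewrite -H0; have : rnorm (kappa * H 0) <=
    4 * ((2 * M + 32 * M / k) / s ^+ 2 * (2 / s)) * ((s - 1 - (- s - 1)) + (s - - s)).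
  rewrite E; apply: rectint_bound => //; first by clear -s0; lra.
    move=> t tb; apply/differentiable_continuous; apply: differentiableM.
      apply: dH.
        have /(rect_boundary_crect ssN ssN) := shift1 t tb; exact: square_rnorm.
      by rewrite -addr_eq0; exact: (rect_boundary_neq0 sN0 sN0 (shift1 t tb)).
    apply: differentiable_inv; apply: rect_boundary_neq0 tb => //.
    by clear -s2; lra.
  move=> t tb; have tb1 := shift1 t tb.
  have st := square_boundary_rnorm (ltW s0) tb1.
  have ts := square_rnorm (rect_boundary_crect ssN ssN tb1).
  have tp := lt_le_trans s0 st.
  have st2 : s / 2 <= rnorm t.
    have := rnormD t 1; rewrite r1; clear -st s2; lra.
  have s20 : 0 < s / 2 by rewrite divr_gt0.
  have tp2 := lt_le_trans s20 st2.
  rewrite rnormM rnormV ler_pM ?rnorm_ge0 ?invr_ge0 ?rnorm_ge0//; last first.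
    by rewrite -[2 / s]invf_div lef_pV2 ?posrE.
  rewrite /H /q; set u := t + 1 in st ts tp *.
  rewrite !rnormM !rnormV -expr2 exprVn.
  have num : rnorm (h u - h 0 - u * D) <= (2 * M + 32 * M / k) / s ^+ 2 * rnorm u ^+ 2.
    apply: (@le_trans _ _ (2 * M + rnorm u * (32 * M / (s * k)))).
      apply: (le_trans (rnormD _ _)); rewrite rnormN rnormM lerD ?Mdif//.
      by rewrite ler_wpM2l// rnorm_ge0.
    set ru := rnorm u; rewrite -/ru in st tp.
    have us : 1 <= ru / s by rewrite ler_pdivlMr// mul1r.
    rewrite (_ : _ / s ^+ 2 * _ = 2 * M * (ru / s) ^+ 2 + (32 * M / k) * (ru / s) ^+ 2);
      last by field; rewrite !gt_eqF.
    rewrite (_ : ru * _ = (32 * M / k) * (ru / s)); last by field; rewrite !gt_eqF.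
    have Mk : 0 <= 32 * M / k by rewrite divr_ge0 ?(ltW k0)// mulr_ge0.
    by apply: lerD; [rewrite ler_peMr ?mulr_ge0 ?exprn_ege1|rewrite ler_wpM2l// ler_eXnr].
  by rewrite ler_pdivrMr ?exprn_gt0.
rewrite rnormM -/k -ler_pdivlMl// => /le_trans; apply.
rewrite le_eqVlt /taylor_const -/k (_ : _ * (4 * _ * _) = 32 * (2 + 32 / k) / k * M / s ^+ 2) ?eqxx//.
by field; rewrite !gt_eqF.
Qed.

End CauchyFormula.

(** * Holomorphic functions on normed modules *)

Section SeveralVariables.
Context {R : realType} {V : normedModType (Cplx R)}.
Local Notation C := (Cplx R).
Local Notation kappa := (@kappa R).
Local Notation taylor_const := (@taylor_const R).
Implicit Types (f g : V -> C) (p u v w z : V) (s t : C).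

Lemma rnorm_gt0 (W : normedModType C) (v : W) : v != 0 -> 0 < rnorm v.
Proof.
by move=> v0; rewrite lt_def rnorm_ge0 andbT; apply: contraNneq v0 => /rnorm0_eq0 ->.
Qed.

Lemma rnorm_real (x : R) : 0 <= x -> rnorm (Complex x 0 : C) = x.
Proof. by move=> x0; rewrite rnorm_Complex_real ger0_norm. Qed.

(** Restriction to a complex line, the passage from one variable to several. *)
Lemma slice_differentiable f p v t : differentiable f (p + t *: v) ->
  differentiable (fun s : C => f (p + s *: v)) t /\
  'd (fun s : C => f (p + s *: v)) t 1 = 'd f (p + t *: v) v.
Proof.
move=> df.
pose l : C -> V := fun s => s *: v.
have ll : linear l by move=> a x y; rewrite /l scalerDl scalerA.
pose L : {linear C -> V} := HB.pack l (GRing.isLinear.Build _ _ _ _ l ll).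
have cL : continuous L by move=> x; exact: scalel_continuous.
have dL : differentiable (fun s : C => p + s *: v) t.
  apply: differentiableD; first exact: differentiable_cst.
  exact: (@linear_differentiable _ _ _ L).
have ds : differentiable (fun s : C => f (p + s *: v)) t.
  exact: (@differentiable_comp _ _ _ _ (fun s : C => p + s *: v) f).
split=> //; rewrite -(deriveE _ ds) -(deriveE _ df) /derive.
have E : (fun h : C => h^-1 *: (((fun s : C => f (p + s *: v)) \o shift t) (h *: 1)
      - f (p + t *: v))) =
    (fun h : C => h^-1 *: ((f \o shift (p + t *: v)) (h *: v) - f (p + t *: v))).
  apply/funext => h /=; congr (_ *: (f _ - _)).
  by rewrite [h *: 1]mulr1 scalerDl addrCA.
by rewrite E.
Qed.

Definition bounded_holomorphic f p (rho M : R) :=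
  forall u, rnorm u < rho -> differentiable f (p + u) /\ rnorm (f (p + u)) <= M.

Lemma taylor f p (rho M : R) v : 0 < rho -> bounded_holomorphic f p rho M ->
  6 * rnorm v <= rho ->
  rnorm (f (p + v) - f p - 'd f p v) <= 9 * taylor_const * M / rho ^+ 2 * rnorm v ^+ 2.
Proof.
move=> rho0 hf v6.
have [->|v0] := eqVneq v 0.
  by rewrite addr0 subrr linear0 subr0 !rnorm0 expr0n mulr0.
have rv := rnorm_gt0 v0.
(* For [rnorm t <= 2 * s] the point [t *: v] has norm at most [2 * rho / 3], and
   [6 * rnorm v <= rho] says exactly [2 <= s]. The 9 in the bound comes from [1 / s ^+ 2]. *)
pose s := rho / (3 * rnorm v).
have s2 : 2 <= s by rewrite ler_pdivlMr ?mulr_gt0// mulrA -natrM.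
have s0 : 0 < s by apply: lt_le_trans s2.
have tr t : rnorm t <= 2 * s -> rnorm (t *: v) < rho.
  move=> ts; rewrite rnormZ -ltr_pdivlMr//; apply: (le_lt_trans ts).
  by rewrite /s (_ : 2 * _ = rho / rnorm v * (2 / 3)) ?gtr_pMr ?divr_gt0//; [lra|field; rewrite gt_eqF].
have [dp dpE] : differentiable (fun t : C => f (p + t *: v)) 0 /\
    'd (fun t : C => f (p + t *: v)) 0 1 = 'd f p v.
  have := @slice_differentiable f p v 0; rewrite scale0r addr0; apply.
  by have [] := hf 0; rewrite ?rnorm0// addr0.
have M0 : 0 <= M by have [_] := hf 0 (ltac:(by rewrite rnorm0)); apply: le_trans; exact: rnorm_ge0.
have := @taylor1 _ (fun t : C => f (p + t *: v)) s M s2 M0.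
rewrite scale1r scale0r addr0 dpE.
have -> : taylor_const * M / s ^+ 2 = 9 * taylor_const * M / rho ^+ 2 * rnorm v ^+ 2.
  by rewrite /s; field; rewrite !gt_eqF// mulr_gt0.
apply.
  by move=> t /tr /hf[h _]; have [] := slice_differentiable h.
by move=> t /tr /hf[].
Qed.

(** Rescaled to norm [rho / 6], the largest that [taylor] admits, [v] has as derivative a difference
    of values of [f] plus a Taylor remainder; homogeneity gives the general case. *)
Lemma diff_le f p (rho M : R) v : 0 < rho -> bounded_holomorphic f p rho M ->
  rnorm ('d f p v) <= 6 * (2 + taylor_const / 4) * M / rho * rnorm v.
Proof.
move=> rho0 hf; have [->|v0] := eqVneq v 0; first by rewrite linear0 rnorm0 rnorm0 mulr0.
have rv := rnorm_gt0 v0.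
pose l := rho / (6 * rnorm v).
have l0 : 0 < l by rewrite divr_gt0// mulr_gt0.
pose u := (Complex l 0 : C) *: v.
have ru : rnorm u = rho / 6.
  by rewrite rnormZ rnorm_real ?(ltW l0)// /l; field; rewrite gt_eqF.
have u6 : 6 * rnorm u <= rho by rewrite ru mulrC divfK.
have := taylor rho0 hf u6.
have -> : 'd f p u = (Complex l 0 : C) * 'd f p v by exact: linearZ.
have [_ fp] := hf 0 (ltac:(by rewrite rnorm0)); rewrite addr0 in fp.
have [|_ fu] := hf u; first by rewrite ru; clear -rho0; lra.
have := rnormB (f (p + u) - f p) ((Complex l 0 : C) * 'd f p v).
set A := f (p + u) - f p; set B := _ * _ => AB.
have hB : rnorm B <= rnorm A + rnorm (A - B).
  by have := rnormD A (B - A); rewrite addrC subrK AB.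
have hA : rnorm A <= 2 * M.
  by rewrite mulr2n mulrDl mul1r (le_trans (rnormD _ _))// rnormN lerD.
rewrite ru => hAB.
have : rnorm B <= (2 + taylor_const / 4) * M.
  apply: (le_trans hB); apply: (le_trans (lerD hA hAB)).
  by rewrite le_eqVlt (_ : _ + _ = (2 + taylor_const / 4) * M) ?eqxx//; field; rewrite gt_eqF.
rewrite /B rnormM rnorm_real ?(ltW l0)// -ler_pdivlMl// => /le_trans; apply.
by rewrite le_eqVlt (_ : _^-1 * _ = 6 * (2 + taylor_const / 4) * M / rho * rnorm v) ?eqxx// /l; field;
  rewrite !gt_eqF.
Qed.

Lemma bounded_holomorphic_locally f (D : set V) p : open D -> D p ->
  (forall z, D z -> differentiable f z) ->
  exists2 rho : R, 0 < rho & exists2 M : R, 0 < M &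
    forall u, rnorm u < rho -> bounded_holomorphic f (p + u) rho M.
Proof.
move=> oD Dp df; have [d d0 hd] := open_rnorm oD Dp.
have /rnorm_cvg cf := differentiable_continuous (df p Dp).
have [d' d'0 hd'] := cf 1 ltr01.
exists (Num.min d d' / 2); first by rewrite divr_gt0// lt_min d0.
exists (rnorm (f p) + 1); first by rewrite ltr_wpDl// rnorm_ge0.
move=> u u1 u' u2; rewrite -addrA.
have : rnorm (u + u') < Num.min d d'.
  by rewrite (le_lt_trans (rnormD _ _))// [ltRHS]splitr ltrD.
rewrite lt_min => /andP[ud ud']; split; first exact/df/hd.
have -> : f (p + (u + u')) = f p + (f (p + (u + u')) - f p).
  by rewrite [RHS]addrC subrK.
by rewrite (le_trans (rnormD _ _))// lerD2l ltW// hd'.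
Qed.

(** Difference quotients with a fixed small step are continuous in [z], and [taylor] bounds their
    distance to the derivative uniformly near [p]. *)
Lemma continuous_diff f (D : set V) p v : open D -> D p ->
  (forall z, D z -> differentiable f z) -> {for p, continuous (fun z => 'd f z v)}.
Proof.
move=> oD Dp df; apply/rnorm_cvg => e e0.
have [rho rho0 [M M0 hf]] := bounded_holomorphic_locally oD Dp df.
have K0 : 0 < taylor_const.
  have k0 := @rnorm_kappa_gt0 R.
  by rewrite /taylor_const divr_gt0// mulr_gt0// addr_gt0// divr_gt0.
pose A := 9 * taylor_const * M / rho ^+ 2 * rnorm v ^+ 2.
have A0 : 0 <= A.
  apply: mulr_ge0; last by rewrite exprn_ge0// rnorm_ge0.
  by apply/ltW; rewrite divr_gt0 ?exprn_gt0// mulr_gt0// mulr_gt0.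
(* The first bound makes the increment [T *: v] admissible in [taylor]; the second keeps the error
   [tau * A] below [e / 4]. *)
pose tau := Num.min (rho / (6 * (rnorm v + 1))) (e / (4 * (A + 1))).
have v1 : 0 < rnorm v + 1 by rewrite ltr_wpDl// rnorm_ge0.
have A1 : 0 < A + 1 by rewrite ltr_wpDl.
have tau0 : 0 < tau by rewrite lt_min !divr_gt0// mulr_gt0.
have : tau <= tau by []; rewrite {2}/tau le_min => /andP[t1 t2].
pose T : C := Complex tau 0; have rT : rnorm T = tau by rewrite rnorm_real// ltW.
have T0 : T != 0 by apply/eqP => -[E]; rewrite E ltxx in tau0.
have tv6 : 6 * rnorm (T *: v) <= rho.
  rewrite rnormZ rT; move: t1; rewrite ler_pdivlMr ?mulr_gt0// => t1.
  apply: le_trans t1; rewrite mulrCA ler_pM2l// ler_pM2l// lerDl//.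
pose Q z := (f (z + T *: v) - f z) / T.
have err u : rnorm u < rho -> rnorm ('d f (p + u) v - Q (p + u)) <= e / 4.
  move=> ur; have := taylor rho0 (hf u ur) tv6.
  rewrite (_ : 'd f (p + u) (T *: v) = T * 'd f (p + u) v); last exact: linearZ.
  rewrite rnormZ rT exprMn mulrCA -/A expr2 -mulrA => H.
  have : tau * rnorm ('d f (p + u) v - Q (p + u)) <= tau * (tau * A).
    rewrite -{1}rT -rnormM mulrBr /Q [T * (_ / T)]mulrCA divff// mulr1 rnormB.
    exact: H.
  rewrite ler_pM2l// => /le_trans; apply.
  move: t2; rewrite ler_pdivlMr ?mulr_gt0// => t2.
  rewrite ler_pdivlMr// -mulrA; apply: le_trans t2.
  by rewrite ler_pM2l// mulrC ler_pM2l// lerDl.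
have cQ : {for p, continuous Q}.
  have tvr : rnorm (T *: v) < rho.
    by move: tv6 (rnorm_ge0 (T *: v)) rho0; clear; lra.
  have [df1 _] := hf 0 (ltac:(by rewrite rnorm0)) (T *: v) tvr.
  rewrite addr0 in df1.
  have c1 := differentiable_continuous df1; have c2 := differentiable_continuous (df p Dp).
  apply: (@continuousM _ _ (fun z => f (z + T *: v) - f z) (cst (T^-1))); last exact: cst_continuous.
  apply: (@continuousB _ _ _ (fun z => f (z + T *: v)) f); last exact: c2.
  apply: (@continuous_comp _ _ _ (fun z => z + T *: v) f); last exact: c1.
  by apply: continuousD; [exact: cvg_id|exact: cst_continuous].
have e4 : 0 < e / 4 by rewrite divr_gt0.
have /rnorm_cvg/(_ _ e4)[d d0 hd] := cQ.
exists (Num.min d rho); first by rewrite lt_min d0.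
move=> u; rewrite lt_min => /andP[ud ur].
have := err u ur; have := err 0 (ltac:(by rewrite rnorm0)); rewrite addr0.
have := hd u ud; set a := 'd f (p + u) v; set b := 'd f p v.
set a' := Q (p + u); set b' := Q p => h1 h2 h3.
have -> : a - b = (a - a') + (a' - b') + (b' - b) by ring.
apply: (le_lt_trans (rnormD _ _)); apply: (le_lt_trans (lerD (rnormD _ _) (lexx _))).
move: h1 h2 h3; rewrite (rnormB b' b) => h1 h2 h3.
by clear -h1 h2 h3 e0; lra.
Qed.

End SeveralVariables.

(** * Holomorphic dependence of an integral on a parameter *)

Section ParameterIntegral.
Context {R : realType} {V : normedModType (Cplx R)}.
Local Notation C := (Cplx R).
Local Notation taylor_const := (@taylor_const R).
Implicit Types (f g : V -> C) (p u v w z : V) (s t : C).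

(** Compactness of the segment: finitely many of the local indices suffice, and by monotonicity the
    largest serves everywhere. *)
Lemma segment_uniform (a b : R) (P : nat -> R -> Prop) :
  (forall i j x, (i <= j)%N -> P i x -> P j x) ->
  (forall x, a <= x <= b -> exists j, \forall y \near x, P j y) ->
  exists j, forall x, a <= x <= b -> P j x.
Proof.
move=> mono loc.
have /compact_near_coveringP cov := @segment_compact R a b.
have [|N _ hN] := cov nat \oo (fun j x => P j x) _.
  move=> x /=; rewrite in_itv/= => /loc[j hj].
  exists ([set y | P j y], [set i | (j <= i)%N]).
    by split => //=; exists j.
  by move=> [y i] /= [Py ji]; exact: mono Py.
exists N => x xab; have := hN N (leqnn N) x; apply.
by rewrite /= in_itv/=.
Qed.

Lemma continuous_rnorm_bound (T : topologicalType) (h : T -> C) (x : T) :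
  {for x, continuous h} -> exists M : R, \forall y \near x, rnorm (h y) <= M.
Proof.
move=> ch; exists (rnorm (h x) + 1).
have hn : nbhs (h x) [set y | rnorm (y - h x) < 1].
  by apply/nbhs_rnorm; exists 1.
have : nbhs x [set y | rnorm (h y - h x) < 1] := ch _ hn.
apply: filterS => y /= hy.
have -> : h y = h x + (h y - h x) by rewrite [RHS]addrC subrK.
by rewrite (le_trans (rnormD _ _))// lerD2l ltW.
Qed.

(** Differentiation under the integral sign: the candidate is the integral of the derivative, and
    the Taylor bound, uniform along the segment, makes the error quadratic in the increment. *)
Lemma cint_differentiable f (D : set V) (a b : R) (gamma k : R -> C) w z0 :
  a <= b -> open D -> (forall z, D z -> differentiable f z) ->
  (forall x, a <= x <= b -> {for x, continuous gamma}) ->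
  (forall x, a <= x <= b -> {for x, continuous k}) ->
  (forall x, a <= x <= b -> D (z0 + gamma x *: w)) ->
  differentiable (fun z => cint a b (fun x => f (z + gamma x *: w) * k x)) z0.
Proof.
move=> ab oD df cg ck hD.
have K0 : 0 < taylor_const.
  have k0 := @rnorm_kappa_gt0 R.
  by rewrite /taylor_const divr_gt0// mulr_gt0// addr_gt0// divr_gt0.
have cpath z x : a <= x <= b -> {for x, continuous (fun x => z + gamma x *: w)}.
  move=> xab; apply: continuousD; first exact: cst_continuous.
  by apply: continuousZl; exact: cg.
(* A single index encodes the radius and the bounds on [f] and [k], so that [segment_uniform] makes
   all of them uniform at once. *)
pose P (j : nat) (x : R) := [/\ bounded_holomorphic f (z0 + gamma x *: w) j.+1%:R^-1 j.+1%:R,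
  forall u, rnorm u < j.+1%:R^-1 -> D (z0 + gamma x *: w + u) & rnorm (k x) <= j.+1%:R].
have [j hj] : exists j, forall x, a <= x <= b -> P j x.
  apply: segment_uniform => [i j x ij [h1 h2 h3]|x xab].
    have ij' : i.+1%:R <= j.+1%:R :> R by rewrite ler_nat.
    have ij'' : j.+1%:R^-1 <= i.+1%:R^-1 :> R by rewrite lef_pV2// posrE.
    split; last exact: le_trans ij'.
      move=> u uj; have [] := h1 u (lt_le_trans uj ij''); split=> //.
      exact: le_trans ij'.
    by move=> u uj; exact: h2 (lt_le_trans uj ij'').
  have Dx := hD x xab.
  have [rho rho0 [M M0 hf]] := bounded_holomorphic_locally oD Dx df.
  have [d d0 hd] := open_rnorm oD Dx.
  have [Mk hk] := continuous_rnorm_bound (ck x xab).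
  pose r := Num.min rho (d / 2).
  have r0 : 0 < r by rewrite lt_min rho0 divr_gt0.
  have [j [j1 j2 j3]] : exists j : nat, [/\ j.+1%:R^-1 <= r, M <= j.+1%:R & Mk <= j.+1%:R].
    pose B := Num.max r^-1 (Num.max M Mk).
    have [n hn] : exists n : nat, B <= n%:R.
      by exists (Num.truncn `|B|).+1; rewrite (le_trans (ler_norm _))// ltW// truncnS_gt.
    have nn : n%:R <= n.+1%:R :> R by rewrite ler_nat.
    move: (le_trans hn nn); rewrite /B !ge_max => /and3P[h1 h2 h3].
    by exists n; split=> //; rewrite invf_ple// posrE.
  exists j; have cp := cpath z0 x xab.
  have hn : nbhs (z0 + gamma x *: w) [set y | rnorm (y - (z0 + gamma x *: w)) < r].
    by apply/nbhs_rnorm; exists r.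
  have : nbhs x [set y | rnorm (z0 + gamma y *: w - (z0 + gamma x *: w)) < r].
    exact: cp _ hn.
  apply: filterS2 hk => y hky /=; rewrite lt_min => /andP[y1 y2].
  have yE : z0 + gamma y *: w =
      (z0 + gamma x *: w) + (z0 + gamma y *: w - (z0 + gamma x *: w)).
    by rewrite [RHS]addrC subrK.
  have [jr jd] : j.+1%:R^-1 <= rho /\ j.+1%:R^-1 <= d / 2.
    by move: j1; rewrite le_min => /andP[].
  split; last exact: le_trans j3.
    move=> u uj; rewrite yE; have [] := hf _ y1 u (lt_le_trans uj jr); split=> //.
    exact: le_trans j2.
  move=> u uj; rewrite yE -addrA; apply: hd; rewrite (le_lt_trans (rnormD _ _))//.
  by rewrite [ltRHS]splitr ltrD// (lt_le_trans uj).
pose rho : R := j.+1%:R^-1; pose M : R := j.+1%:R.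
have rho0 : 0 < rho by rewrite invr_gt0.
have M0 : 0 < M by [].
have intg u : rnorm u < rho ->
    cintegrable a b (fun x => f (z0 + u + gamma x *: w) * k x).
  move=> ur; apply: continuous_cintegrable => x xab; apply: continuousM; last exact: ck.
  apply: (@continuous_comp _ _ _ (fun x => z0 + u + gamma x *: w) f); first exact: cpath.
  have [h _ _] := hj x xab; have [hd _] := h u ur.
  by apply: differentiable_continuous; rewrite addrAC.
have intd v : cintegrable a b (fun x => 'd f (z0 + gamma x *: w) v * k x).
  apply: continuous_cintegrable => x xab; apply: continuousM; last exact: ck.
  apply: (@continuous_comp _ _ _ (fun x => z0 + gamma x *: w) (fun z => 'd f z v)).
    exact: cpath.
  exact: (continuous_diff oD (hD x xab) df).
pose L v := cint a b (fun x => 'd f (z0 + gamma x *: w) v * k x).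
have lL : linear L.
  move=> c u v; rewrite -[c *: L u]/(c * L u) /L -cintZ// -cintD//; last exact: cintegrableZ.
  by apply: eq_cint => x xab; rewrite linearP mulrDl mulrA.
have ba0 : 0 <= b - a by rewrite subr_ge0.
pose K1 := 6 * (2 + taylor_const / 4) * M / rho.
pose K2 := 9 * taylor_const * M / rho ^+ 2.
have K10 : 0 <= K1.
  apply: divr_ge0; last exact: ltW.
  by rewrite !mulr_ge0// addr_ge0// divr_ge0// ltW.
have K20 : 0 <= K2.
  have tc0 := ltW K0; apply: divr_ge0; last by rewrite exprn_ge0// ltW.
  by apply: mulr_ge0; [exact: mulr_ge0|exact: ltW].
apply: (@rnorm_differentiable _ _ _ _ L _ (2 * (K1 * M) * (b - a)) lL).
  move=> v; rewrite mulrAC (_ : 2 * (K1 * M) * rnorm v = 2 * (K1 * rnorm v * M)); last by ring.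
  apply: cint_bound => // x xab; have [h1 _ h3] := hj x xab.
  by rewrite rnormM ler_pM ?rnorm_ge0// (diff_le _ rho0 h1).
move=> e e0; pose B := 2 * (K2 * M) * (b - a).
have B0 : 0 <= B by apply: mulr_ge0 => //; apply: mulr_ge0 => //; apply: mulr_ge0 => //; exact: ltW.
have B1 : 0 < B + 1 by rewrite ltr_wpDl.
exists (Num.min (rho / 6) (e / (B + 1))); first by rewrite lt_min !divr_gt0.
move=> v; rewrite lt_min => /andP[v6 ve].
have v6' : 6 * rnorm v <= rho by clear -v6; lra.
have vr : rnorm v < rho by clear -v6 rho0; lra.
have := intg 0; rewrite rnorm0 addr0 => /(_ rho0) int0.
rewrite /L -cintB//; last exact: intg.
rewrite -cintB//; last by apply: cintegrableB => //; exact: intg.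
apply: (@le_trans _ _ (2 * (K2 * rnorm v ^+ 2 * M) * (b - a))).
  apply: cint_bound => //.
    by apply: cintegrableB => //; apply: cintegrableB => //; exact: intg.
  move=> x xab; have [h1 _ h3] := hj x xab.
  rewrite -!mulrBl rnormM ler_pM ?rnorm_ge0//.
  by have := taylor rho0 h1 v6'; rewrite [z0 + v + _]addrAC.
rewrite (_ : 2 * _ * _ = (B * rnorm v) * rnorm v); last by rewrite /B; ring.
rewrite ler_wpM2r ?rnorm_ge0//; move: ve; rewrite ltr_pdivlMr// => /ltW; apply: le_trans.
by rewrite mulrC ler_wpM2l ?rnorm_ge0// lerDl.
Qed.

End ParameterIntegral.

(** * The identity principle *)

Section IdentityPrinciple.
Context {R : realType} {V : normedModType (Cplx R)}.
Local Notation C := (Cplx R).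
Local Notation kappa := (@kappa R).
Implicit Types (f g : V -> C) (p u v w z : V) (s t : C).

Definition locally_zero g p := \forall q \near p, g q = 0.

(* The factor ((1 - t)^-1)^m, harmless since h vanishes near 1, has modulus at
   most 2^-m on the boundary of the square of half-side 3. *)
Lemma zero_at_0_of_zero_near_1 (h : C -> C) (M : R) :
  (forall t, rnorm t <= 6 -> differentiable h t) ->
  (forall t, rnorm t <= 6 -> rnorm (h t) <= M) ->
  (\forall t \near (1 : C), h t = 0) -> h 0 = 0.
Proof.
move=> dh hM h1.
have r0 : rnorm (0 : C) <= 6 by rewrite rnorm0.
have M0 : 0 <= M by apply: le_trans (hM 0 r0); exact: rnorm_ge0.
have k0 := @rnorm_kappa_gt0 R.
have sN (r : R) : 0 < r -> - r < 0 < r by rewrite oppr_lt0 => ->.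
have s3 := sN 3 (ltr0n _ 3).
have s33 : - (3 : R) <= 3 by rewrite ge0_cp.
have sq t : crect (- 3) 3 (- 3) 3 t -> rnorm t <= 6.
  by move=> /square_rnorm; rewrite -natrM.
have rone : rnorm (1 : C) = 1 by rewrite rnorm_normc /= expr1n expr0n addr0 sqrtr1.
have dinv (m : nat) t : t != 1 -> differentiable (fun t : C => (1 - t)^-1 ^+ m : C) t.
  move=> t1; have d1 : differentiable (fun t : C => (1 - t)^-1 : C) t.
    apply: (@differentiable_comp _ _ _ _ (fun t : C => 1 - t : C) (fun t : C => t^-1 : C)).
      by apply: differentiableB => //; exact: differentiable_cst.
    by apply: differentiable_inv; rewrite subr_eq0 eq_sym.
  elim: m => [|m IH].
    rewrite (_ : (fun _ => _) = cst (1 : C)); first exact: differentiable_cst.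
    by apply/funext => x; rewrite expr0.
  rewrite (_ : (fun _ => _) = (fun t : C => (1 - t)^-1) * (fun t : C => (1 - t)^-1 ^+ m)).
    exact: differentiableM.
  by apply/funext => x; rewrite exprS.
have bound (m : nat) : rnorm kappa * rnorm (h 0) * 2 ^+ m <= 16 * M.
  pose H (t : C) := h t * (1 - t)^-1 ^+ m.
  have dH t : rnorm t <= 6 -> differentiable H t.
    move=> t6; have [->|t1] := eqVneq t 1.
      have H0 : \forall t \near (1 : C), H t = 0.
        by apply: filterS h1 => x hx; rewrite /H hx mul0r.
      have H10 : H 1 = 0 := nbhs_singleton H0.
      apply: (@rnorm_differentiable _ _ _ _ (fun=> 0) _ 0).
      - by move=> c x y; rewrite scaler0 addr0.
      - by move=> v; rewrite rnorm0 mul0r.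
      move=> e e0; have /nbhs_rnorm0[d d0 hd] := H0.
      by exists d => // v /hd ->; rewrite H10 !subr0 rnorm0 mulr_ge0 ?rnorm_ge0// ltW.
    by apply: differentiableM; [exact: dh|exact: dinv].
  have E : kappa * H 0 = rectint (fun t => H t / t) (- 3) 3 (- 3) 3.
    apply: (cauchy_formula s3 s3).
      exact/differentiable_continuous/dH.
    by move=> t /sq t6 _; exact: dH.
  have H0 : H 0 = h 0 by rewrite /H subr0 invr1 expr1n mulr1.
  have : rnorm (kappa * H 0) <= 4 * (M * 2^-1 ^+ m * 3^-1) * ((3 - - 3) + (3 - - 3)).
    rewrite E; apply: (rectint_bound s33 s33).
      move=> t tb; apply: differentiable_continuous; apply: differentiableM.
        exact/dH/sq/(rect_boundary_crect s33 s33 tb).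
      exact/differentiable_inv/(rect_boundary_neq0 s3 s3 tb).
    move=> t tb; have t6 := sq _ (rect_boundary_crect s33 s33 tb).
    have t3 : 3 <= rnorm t by apply: square_boundary_rnorm.
    have t2 : 2 <= rnorm (1 - t).
      by have := rnormD (1 - t) (- 1); rewrite addrAC subrr add0r !rnormN rone; clear -t3; lra.
    have rX (x : C) n : rnorm (x ^+ n : C) = rnorm x ^+ n.
      by elim: n => [|n IH]; rewrite ?expr0// !exprS rnormM IH.
    rewrite /H !rnormM rX !rnormV.
    have i3 : (rnorm t)^-1 <= 3^-1 by rewrite lef_pV2 ?posrE// (lt_le_trans _ t3).
    have i2 : (rnorm (1 - t))^-1 <= 2^-1 by rewrite lef_pV2 ?posrE// (lt_le_trans _ t2).
    have i30 : 0 <= (rnorm t)^-1 by rewrite invr_ge0 rnorm_ge0.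
    have i20 : 0 <= (rnorm (1 - t))^-1 by rewrite invr_ge0 rnorm_ge0.
    rewrite !ler_pM ?mulr_ge0 ?exprn_ge0 ?rnorm_ge0 ?hM//.
    by rewrite lerXn2r ?nnegrE.
  rewrite H0 rnormM => hh.
  have p2 : 0 < (2 : R) ^+ m by rewrite exprn_gt0.
  rewrite -ler_pdivlMr//; apply: (le_trans hh); rewrite exprVn.
  by rewrite le_eqVlt (_ : 4 * _ * _ = 16 * M / 2 ^+ m) ?eqxx//; field; rewrite gt_eqF.
apply: rnorm0_eq0; apply/eqP; rewrite eq_le rnorm_ge0 andbT leNgt; apply/negP => hp.
pose A := rnorm kappa * rnorm (h 0); have A0 : 0 < A by rewrite mulr_gt0.
have [m hm] : exists m : nat, 16 * M / A < m%:R.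
  by exists (Num.truncn `|16 * M / A|).+1; rewrite (le_lt_trans (ler_norm _))// truncnS_gt.
have := bound m; rewrite -/A mulrC -ler_pdivlMr// leNgt => /negP; apply.
by rewrite (lt_le_trans hm)// -natrX ler_nat ltnW// ltn_expl.
Qed.

(** Any [z] near [p] is joined by a complex line to a nearby [q] around which [g] vanishes, so the
    slice vanishes near [t = 1] and hence at 0. The radius [rho / 100] leaves room for
    [rnorm t <= 6], since [rho / 100 + 6 * (rho / 50) < rho]. *)
Lemma locally_zero_closed g (D : set V) p : open D -> D p ->
  (forall z, D z -> differentiable g z) ->
  closure (locally_zero g) p -> locally_zero g p.
Proof.
move=> oD Dp dg cp.
have [rho rho0 [M M0 hf]] := bounded_holomorphic_locally oD Dp dg.
have := hf 0; rewrite rnorm0 addr0 => /(_ rho0) {}hf.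
have r100 : 0 < rho / 100 by rewrite divr_gt0.
have [q [qZ /= qp]] : locally_zero g `&` [set y | rnorm (y - p) < rho / 100] !=set0.
  by apply: cp; apply/nbhs_rnorm; exists (rho / 100).
apply/nbhs_rnorm; exists (rho / 100) => // z zp.
pose h (t : C) := g (z + t *: (q - z)).
have qz : rnorm (q - z) < rho / 50.
  have -> : q - z = (q - p) - (z - p) by rewrite opprB addrA subrK.
  have := rnormD (q - p) (- (z - p)); rewrite rnormN.
  by move: qp zp; clear; lra.
have inball t : rnorm t <= 6 -> exists2 u, rnorm u < rho & z + t *: (q - z) = p + u.
  move=> t6; exists ((z - p) + t *: (q - z)); last by rewrite addrA [p + _]addrC subrK.
  apply: (le_lt_trans (rnormD _ _)); rewrite rnormZ.
  have := @ler_pM _ (rnorm t) 6 (rnorm (q - z)) (rho / 50) (rnorm_ge0 _) (rnorm_ge0 _) t6 (ltW qz).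
  by move: zp rho0; clear; lra.
have : h 0 = 0.
  apply: (@zero_at_0_of_zero_near_1 h M).
  - move=> t /inball[u ur E]; have [] := @slice_differentiable _ _ g z (q - z) t _ => //.
    by rewrite E; have [] := hf u ur.
  - by move=> t /inball[u ur E]; rewrite /h E; have [] := hf u ur.
  - have cl : {for (1 : C), continuous (fun t : C => z + t *: (q - z))}.
      apply: continuousD; first exact: cst_continuous.
      exact: scalel_continuous.
    have : nbhs ((fun t : C => z + t *: (q - z)) 1) [set y | g y = 0].
      by rewrite scale1r addrC subrK.
    by move/cl.
by rewrite /h scale0r addr0.
Qed.

(** The locally zero points form an open set that is also closed relative to [D]. The connected set
    [A] may be thin; it is a half-line in one application. *)
Lemma identity_principle g (D A : set V) : open D -> A `<=` D -> connected A ->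
  (forall z, D z -> differentiable g z) ->
  (exists2 a, A a & locally_zero g a) -> forall a, A a -> locally_zero g a.
Proof.
move=> oD AD cA dg [a Aa ga].
have <- : A `&` locally_zero g = A; last by move=> b [].
apply: cA; first by exists a.
  exists (locally_zero g) => //.
  rewrite openE => p; exact: nbhs_interior.
exists (closure (locally_zero g)); first exact: closed_closure.
apply/seteqP; split=> p [Ap gp]; split=> //; first exact: subset_closure.
exact: locally_zero_closed oD (AD _ Ap) dg gp.
Qed.

End IdentityPrinciple.

(** * Extension across E by chains of unit squares *)

Section SymmetricSums.
Context {K : pzRingType}.
Implicit Types (N : nat) (u v : int -> K).

(** The sum over all integers from [- N] to [N]. *)
Definition zsum N u : K := \sum_(k < (2 * N).+1) u (k%:Z - N%:Z).

Lemma zsumS N u : zsum N.+1 u = u (- N.+1%:Z) + zsum N u + u N.+1%:Z.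
Proof.
rewrite /zsum (_ : (2 * N.+1).+1 = (2 * N).+3); last by rewrite mulnS.
rewrite big_ord_recr big_ord_recl /=; congr (u _ + _ + u _).
- by rewrite sub0r.
- by apply: eq_bigr => i _; congr u; rewrite /bump /=; lia.
- by lia.
Qed.

Lemma zsum_widen N N' u : (forall i, N%:Z <= `|i| -> u i = 0) -> (N <= N')%N ->
  zsum N' u = zsum N u.
Proof.
move=> u0 /subnK <-; elim: (N' - N)%N => [|k IH]; first by rewrite add0n.
rewrite addSn zsumS IH !u0 ?add0r ?addr0// ?normrN ger0_norm//;
  by rewrite lez_nat leqW// leq_addl.
Qed.

(** The shifted sum loses the term at [- N] and gains the one at [N + 1]. *)
Lemma zsum_shift N u : u (- N%:Z) = 0 -> u (N%:Z + 1) = 0 ->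
  zsum N (fun i => u (i + 1)) = zsum N u.
Proof.
move=> u0 u1; rewrite /zsum big_ord_recr big_ord_recl /=.
rewrite sub0r u0 add0r (_ : (2 * N)%:Z - N%:Z + 1 = N%:Z + 1) ?u1 ?addr0.
  by apply: eq_bigr => i _; congr u; rewrite /bump /=; lia.
by lia.
Qed.

Lemma eq_zsum N u v : (forall i, u i = v i) -> zsum N u = zsum N v.
Proof. by move=> uv; apply: eq_bigr. Qed.

Lemma zsumD N u v : zsum N (fun i => u i + v i) = zsum N u + zsum N v.
Proof. exact: big_split. Qed.

Lemma zsumB N u v : zsum N (fun i => u i - v i) = zsum N u - zsum N v.
Proof. by rewrite /zsum big_split/= sumrN. Qed.

Lemma zsum0 N u : (forall i, u i = 0) -> zsum N u = 0.
Proof. by move=> u0; apply: big1. Qed.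

Lemma zsumZ N (a : K) u : zsum N (fun i => a * u i) = a * zsum N u.
Proof. by rewrite /zsum mulr_sumr. Qed.

Lemma zsum_single N u : (forall i, i != 0 -> u i = 0) -> zsum N u = u 0.
Proof.
move=> u0; rewrite /zsum.
have N2 : (N < (2 * N).+1)%N by rewrite ltnS mul2n -addnn leq_addl.
rewrite (bigD1 (Ordinal N2))//= subrr big1 ?addr0// => i iN.
apply: u0; rewrite subr_eq0; apply: contra iN => /eqP[E].
by apply/eqP/val_inj.
Qed.

End SymmetricSums.

Lemma zsum_differentiable (R : realType) (V : normedModType (Cplx R))
    (N : nat) (u : int -> V -> Cplx R) (z : V) :
  (forall i, differentiable (u i) z) ->
  differentiable (fun z => zsum N (fun i => u i z)) z.
Proof.
move=> du; have := @differentiable_sum _ _ _ _ (fun k : 'I_(2 * N).+1 => u (k%:Z - N%:Z)) z.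
move=> /(_ (fun i => du _)); congr (differentiable _ z).
by apply/funext => x; rewrite fct_sumE.
Qed.

(** * Cauchy-Schwarz for finite sums and for integrals over unit segments *)

Section SquareBounds.
Context {R : realType}.
Local Notation C := (Cplx R).
Local Notation mu := (@lebesgue_measure R).

Lemma rnorm_sum_sqr n (u : 'I_n -> C) :
  rnorm (\sum_k u k : C) ^+ 2 <= n%:R * \sum_k rnorm (u k) ^+ 2.
Proof.
elim: n u => [|n IH] u; first by rewrite !big_ord0 rnorm0 expr0n mulr0.
rewrite !big_ord_recl; set S := \sum_k _; set T := \sum_k _.
have := IH (fun k => u (lift ord0 k)); rewrite -/S -/T => H.
have a0 := rnorm_ge0 (u ord0 : C); have S0 := rnorm_ge0 (S : C).
have n0 : 0 <= n%:R :> R by [].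
apply: (@le_trans _ _ ((rnorm (u ord0 : C) + rnorm (S : C)) ^+ 2)).
  by rewrite lerXn2r ?nnegrE ?addr_ge0 ?rnorm_ge0// rnormD.
move: (rnorm (u ord0 : C)) (rnorm (S : C)) a0 S0 H => a b a0 b0 H.
have T0 : 0 <= T by rewrite sumr_ge0// => i _; rewrite sqr_ge0.
rewrite -natr1; clearbody T; move: (n%:R : R) n0 H => r r0 H.
(* The induction hypothesis [b^2 <= r T] and the inequality of arithmetic and geometric means give
   [4 a^2 b^2 <= 4 (r a^2) T <= (r a^2 + T)^2]. *)
have : (2 * a * b) ^+ 2 <= (r * a ^+ 2 + T) ^+ 2.
  have -> : (2 * a * b) ^+ 2 = 4 * (a ^+ 2 * b ^+ 2) by ring.
  have h1 : a ^+ 2 * b ^+ 2 <= a ^+ 2 * (r * T) by rewrite ler_wpM2l ?sqr_ge0.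
  have h2 : 0 <= (r * a ^+ 2 - T) ^+ 2 by rewrite sqr_ge0.
  rewrite -subr_ge0 (_ : _ - _ = (r * a ^+ 2 - T) ^+ 2 +
    4 * (a ^+ 2 * (r * T) - a ^+ 2 * b ^+ 2)); last by ring.
  by rewrite addr_ge0// mulr_ge0// subr_ge0.
rewrite ler_sqr ?nnegrE ?addr_ge0 ?mulr_ge0 ?sqr_ge0// => h.
rewrite (_ : (a + b) ^+ 2 = a ^+ 2 + 2 * a * b + b ^+ 2); last by ring.
rewrite (_ : (r + 1) * _ = r * a ^+ 2 + T + a ^+ 2 + r * T); last by ring.
by clear -h H; lra.
Qed.

Lemma rnorm_zsum_sqr N (u : int -> C) :
  rnorm (zsum N u : C) ^+ 2 <=
  (2 * N).+1%:R * \sum_(k < (2 * N).+1) rnorm (u (k%:Z - N%:Z) : C) ^+ 2.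
Proof. exact: rnorm_sum_sqr. Qed.

(** On an interval of length 1 the integral [m] is the mean of [g], and [(g - m)^2 >= 0] integrates
    to the claim. *)
Lemma sqr_Rintegral (a : R) (g : R -> R) :
  (forall x, a <= x <= a + 1 -> {for x, continuous g}) ->
  (\int[mu]_(x in `[a, (a + 1)]) g x)%R ^+ 2 <= (\int[mu]_(x in `[a, (a + 1)]) g x ^+ 2)%R.
Proof.
move=> cg; have ig := continuous_real_integrable cg.
have ig2 : mu.-integrable `[a, (a + 1)] (EFin \o (fun x => g x ^+ 2)).
  apply: continuous_real_integrable => x /cg gx.
  by apply: (@continuousM _ _ g g).
set m := (\int[mu]_(x in _) g x)%R.
have igm : mu.-integrable `[a, (a + 1)] (EFin \o (fun x => 2 * m * g x - m ^+ 2)).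
  apply: continuous_real_integrable => x /cg gx; apply: continuousB; last exact: cst_continuous.
  by apply: continuousM; [exact: cst_continuous|].
have len : fine (mu `[a, (a + 1)%R]%classic) = 1.
  by rewrite lebesgue_measure_itv/= lte_fin ltrDl ltr01/= addrAC subrr add0r.
have -> : m ^+ 2 = (\int[mu]_(x in `[a, (a + 1)%R]) (2 * m * g x - m ^+ 2))%R.
  rewrite RintegralB//=.
  - by rewrite RintegralZl// -/m Rintegral_cst//= len; ring.
  - apply: continuous_real_integrable => x /cg gx.
    by apply: continuousM; [exact: cst_continuous|].
  - by apply: continuous_real_integrable => x _; exact: cst_continuous.
apply: le_Rintegral => //= x _.
by rewrite -subr_ge0 (_ : _ - _ = (g x - m) ^+ 2) ?sqr_ge0//; ring.
Qed.

Lemma cint_sqr (a : R) (u : R -> C) :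
  (forall x, a <= x <= a + 1 -> {for x, continuous u}) ->
  ((rnorm (cint a (a + 1) u : C) ^+ 2)%:E <=
   \int[mu]_(x in `[a, (a + 1)%R]) (rnorm (u x : C) ^+ 2)%:E)%E.
Proof.
move=> cu; have cRe x : a <= x <= a + 1 -> {for x, continuous (fun x => complex.Re (u x))}.
  by move=> /cu ux; apply: (@continuous_comp _ _ _ u) ux _; exact: continuous_Re.
have cIm x : a <= x <= a + 1 -> {for x, continuous (fun x => complex.Im (u x))}.
  by move=> /cu ux; apply: (@continuous_comp _ _ _ u) ux _; exact: continuous_Im.
have iRe : mu.-integrable `[a, (a + 1)] (EFin \o (fun x => complex.Re (u x) ^+ 2)).
  by apply: continuous_real_integrable => x /cRe h; apply: continuousM.
have iIm : mu.-integrable `[a, (a + 1)] (EFin \o (fun x => complex.Im (u x) ^+ 2)).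
  by apply: continuous_real_integrable => x /cIm h; apply: continuousM.
under eq_integral do rewrite rnorm_sqr EFinD.
rewrite integralD//= rnorm_sqr EFinD leeD//.
  rewrite -[leRHS]fineK; last exact: (integrable_fin_num _ iRe).
  by rewrite lee_fin; exact: sqr_Rintegral.
rewrite -[leRHS]fineK; last exact: (integrable_fin_num _ iIm).
by rewrite lee_fin; exact: sqr_Rintegral.
Qed.

End SquareBounds.

(** * Chains of grid squares and their boundaries *)

Section Grid.
Context {R : realType}.
Local Notation C := (Cplx R).
Local Notation "'ι" := (@imag_unit R).
Local Notation half := (2^-1 : R).
Implicit Types (h : C -> C) (i j : int) (S : int -> int -> bool).

(** Grid lines run through the half-integers, so the cells are unit squares centred at the Gaussian
    integers and the pole [t = 0] is the centre of a cell, away from every edge. *)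
Definition hor h i j : C :=
  cint (i%:~R - half) (i%:~R + half) (fun x => h (Complex x (j%:~R - half))).

Definition ver h i j : C :=
  cint (j%:~R - half) (j%:~R + half) (fun y => h (Complex (i%:~R - half) y)).

(** Written edge by edge, and not as a [rectint], so that the edge shared by two cells enters both
    with the same value even where that integral is junk. *)
Definition cell h i j : C :=
  hor h i j - hor h i (j + 1) + 'ι * (ver h (i + 1) j - ver h i j).

Definition grid_cell i j : set C :=
  crect (i%:~R - half) (i%:~R + half) (j%:~R - half) (j%:~R + half).

Lemma cell_rectint h i j : (forall t, grid_cell i j t -> {for t, continuous h}) ->
  cell h i j = rectint h (i%:~R - half) (i%:~R + half) (j%:~R - half) (j%:~R + half).
Proof.
move=> ch; have [hI vI] := continuous_cintegrable_crect ch.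
have e1 k : (k + 1)%:~R - half = k%:~R + half :> R by rewrite intrD; field.
have l k : k%:~R - half <= k%:~R + half :> R by lra.
rewrite /cell /rectint /hor /ver !e1 !cintB//;
  by [apply: hI; rewrite lexx ?l|apply: vI; rewrite lexx ?l].
Qed.

Definition chain N S h : C :=
  zsum N (fun i => zsum N (fun j => (S i j)%:R * cell h i j)).

Definition chain_boundary N S h : C :=
  zsum N (fun i => zsum N (fun j => ((S i j)%:R - (S i (j - 1))%:R) * hor h i j
    + 'ι * (((S (i - 1) j)%:R - (S i j)%:R) * ver h i j))).

Definition supported N S := forall i j, (N%:Z <= `|i|) || (N%:Z <= `|j|) -> S i j = false.

(** Summation by parts collects at each edge the contributions of its two cells. The identity is
    purely algebraic in the edge integrals, so it also covers junk values. *)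
Lemma chainE N S h : supported N S -> chain N S h = chain_boundary N S h.
Proof.
move=> S0; pose a i j : C := (S i j)%:R.
have shift_j i : zsum N (fun j => a i j * hor h i (j + 1)) =
    zsum N (fun j => a i (j - 1) * hor h i j).
  rewrite -(@zsum_shift _ N (fun j => a i (j - 1) * hor h i j)).
  - by apply: eq_zsum => j; rewrite addrK.
  - by rewrite /a S0 ?mul0r//; apply/orP; right; lia.
  - by rewrite /a addrK S0 ?mul0r//; apply/orP; right; lia.
have shift_i : zsum N (fun i => zsum N (fun j => a i j * ver h (i + 1) j)) =
    zsum N (fun i => zsum N (fun j => a (i - 1) j * ver h i j)).
  rewrite -(@zsum_shift _ N (fun i => zsum N (fun j => a (i - 1) j * ver h i j))).
  - by apply: eq_zsum => i; apply: eq_zsum => j; rewrite addrK.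
  - by apply: zsum0 => j; rewrite /a S0 ?mul0r//; apply/orP; left; lia.
  - by apply: zsum0 => j; rewrite /a addrK S0 ?mul0r//; apply/orP; left; lia.
transitivity (zsum N (fun i => zsum N (fun j => a i j * hor h i j)
     - zsum N (fun j => a i j * hor h i (j + 1))) +
   'ι * (zsum N (fun i => zsum N (fun j => a i j * ver h (i + 1) j)) -
         zsum N (fun i => zsum N (fun j => a i j * ver h i j)))).
  rewrite -zsumB -zsumZ -zsumD; apply: eq_zsum => i.
  rewrite -!zsumB -zsumZ -zsumD; apply: eq_zsum => j.
  by rewrite /cell -/(a i j); ring.
rewrite shift_i; under eq_zsum do rewrite shift_j.
rewrite -zsumB -zsumZ -zsumD; apply: eq_zsum => i.
rewrite -!zsumB -zsumZ -zsumD; apply: eq_zsum => j.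
by rewrite -/(a i j); ring.
Qed.

Lemma chain_widen N N' S h : supported N S -> (N <= N')%N ->
  chain N' S h = chain N S h.
Proof.
move=> S0 NN; rewrite /chain (zsum_widen _ NN).
  by apply: eq_zsum => i; rewrite (zsum_widen _ NN)// => j Nj; rewrite S0 ?mul0r// Nj orbT.
by move=> i Ni; apply: zsum0 => j; rewrite S0 ?mul0r// Ni.
Qed.

End Grid.

(** * The extension by Cauchy integrals over selected squares *)

Section Extension.
Context {R : realType} {V : normedModType (Cplx R)}.
Local Notation C := (Cplx R).
Local Notation kappa := (@kappa R).
Local Notation half := (2^-1 : R).
Variables (Omega E : set V) (f : V -> C) (w : V) (c : R) (bnd : V -> R).
Hypotheses (c_gt0 : 0 < c) (Omega_open : open Omega) (E_closed : closed E).
Hypothesis E_nbhd : forall e z, E e -> rnorm (z - e) <= 2 * c -> Omega z.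
Hypothesis f_hol : forall z, (Omega `\` E) z -> differentiable f z.
Hypothesis w_small : 10 * rnorm w <= c.
Hypothesis slice_bounded : forall e z (t : C), E e -> rnorm (z + t *: w - e) < c ->
  `|complex.Re t| <= bnd z /\ `|complex.Im t| <= bnd z.
Hypothesis bnd_locally : forall z : V, exists B : R, nbhs z [set x | bnd x <= B].

Implicit Types (i j : int) (t : C) (z : V).

Definition near_E z : bool := `[< exists2 e, E e & rnorm (z - e) < c >].

Definition grid_point (i j : int) : C := Complex i%:~R j%:~R.

Definition sel z i j : bool := near_E (z + grid_point i j *: w).

Definition slice_kernel z (t : C) : C := f (z + t *: w) * t^-1.

Definition sel_size z : nat := (Num.truncn `|bnd z|).+1.

(* Changing the selection on a square whose slice avoids E changes the chain by
   kappa f(z) for the square around t = 0 and by 0 for all others, and the second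
   term compensates this.  Squares meeting E contribute junk integrals, which cancel
   in chain_boundary. *)
Definition correction z : C :=
  kappa^-1 * chain (sel_size z) (sel z) (slice_kernel z) - (sel z 0 0)%:R * f z.

(** Where [near_E z] holds, the central cell is selected and the two copies of [f z] cancel,
    arbitrary values on [E] included; [kappa^-1] times the chain remains. *)
Definition extension z : C := f z + correction z.

Let D := Omega `\` E.

Lemma open_diff : open D.
Proof. by rewrite /D setDE; apply: openI => //; exact: closed_openC. Qed.

Lemma grid_point00 : grid_point 0 0 = 0 :> C.
Proof. by []. Qed.

(** One of [a] and [b] is within [c] of [E] and the other is not, so [p], within [c / 5] of both, is
    closer than [2 * c] to [E] but not in it. *)
Lemma near_E_neq a b p : near_E a != near_E b ->
  5 * rnorm (p - a) <= c -> 5 * rnorm (p - b) <= c -> D p.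
Proof.
wlog : a b / near_E a = true => [H|].
  by case Ea : (near_E a) => ab pa pb; [apply: (H a b)|apply: (H b a)] => //;
    move: ab; rewrite ?Ea//; case: (near_E b).
move=> Ea; rewrite Ea; case Eb : (near_E b) => // _ pa pb.
move/asboolP: Ea => [e Ee ae].
have Nb e' : E e' -> c <= rnorm (b - e').
  by move=> Ee'; rewrite leNgt; apply/negP => be; move/asboolP: Eb; apply; exists e'.
split.
  apply: (E_nbhd Ee).
  have -> : p - e = (p - a) + (a - e) by rewrite addrA subrK.
  have := rnormD (p - a) (a - e); move: c_gt0 ae pa; lra.
move=> Ep; have := Nb p Ep; rewrite rnormB; move: c_gt0 pb; lra.
Qed.

Lemma grid_cell_close i j t : grid_cell i j t ->
  10 * rnorm (t *: w - grid_point i j *: w) <= c.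
Proof.
move=> [tx ty]; rewrite -scalerBl rnormZ.
have : rnorm (t - grid_point i j) <= 1.
  apply: (le_trans (rnorm_le_parts _)); rewrite ReD ImD ReN ImN /=.
  rewrite (_ : 1 = half + half); last by field.
  by apply: lerD; rewrite ler_norml; move: tx ty; lra.
move=> t1; apply: le_trans w_small; rewrite ler_pM2l//.
by rewrite ler_piMl// rnorm_ge0.
Qed.

Lemma sel_supported z N : bnd z < N%:R -> supported N (sel z).
Proof.
move=> zN i j ij; apply/negP => /asboolP[e Ee he].
have [h1 h2] := slice_bounded Ee he.
have ab (k : int) : N%:Z <= `|k| -> `|k%:~R| <= bnd z -> False.
  move=> Nk kb; have : (N%:R : R) <= `|k%:~R|.
    by rewrite -intr_norm -[N%:R]/(N%:~R) ler_int.
  by rewrite leNgt (le_lt_trans kb).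
by case/orP: ij => [/ab|/ab]; apply.
Qed.

Lemma sel_size_supported z : supported (sel_size z) (sel z).
Proof.
by apply: sel_supported; rewrite (le_lt_trans (ler_norm _))// /sel_size truncnS_gt.
Qed.

Lemma grid_cell_neq0 i j t : (i != 0) || (j != 0) -> grid_cell i j t -> t != 0.
Proof.
move=> ij [tx ty]; apply/eqP => t0; rewrite t0 /= in tx ty.
have ab (k : int) : k != 0 -> k%:~R - half <= 0 <= k%:~R + half -> False.
  move=> k0 /andP[k1 k2]; have : (1 : R) <= `|k%:~R|.
    by rewrite -intr_norm -[1]/(1%:~R) ler_int; move: k0; lia.
  by rewrite real_leNgt ?num_real// ltr_norml; move: k1 k2; lra.
by case/orP: ij => [/ab|/ab]; apply.
Qed.

Lemma kernel_differentiable z t : D (z + t *: w) -> t != 0 ->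
  differentiable (slice_kernel z) t.
Proof.
move=> Dz t0; apply: differentiableM; last exact: differentiable_inv.
by have [] := slice_differentiable (f_hol Dz).
Qed.

(** Cauchy's formula on the cell centred at the pole, Goursat's theorem on all others. *)
Lemma cell_value z i j : (forall t, grid_cell i j t -> D (z + t *: w)) ->
  cell (slice_kernel z) i j = ((i == 0) && (j == 0))%:R * (kappa * f z).
Proof.
move=> hD; have lh (k : int) : k%:~R - half <= k%:~R + half :> R by lra.
case: (boolP ((i == 0) && (j == 0))) => [/andP[/eqP i0 /eqP j0]|].
  rewrite {}i0 {}j0 in hD *; rewrite mul1r.
  pose g (t : C) := f (z + t *: w).
  have dg t : grid_cell 0 0 t -> differentiable g t.
    by move=> /hD /f_hol dz; have [] := slice_differentiable dz.
  have h0 : - half < 0 < half by rewrite oppr_lt0 invr_gt0 ltr0n.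
  have := @cauchy_formula _ g (- half) half (- half) half h0 h0.
  have g0 : g 0 = f z by rewrite /g scale0r addr0.
  rewrite g0 => ->.
  (* The kernel has its pole inside this cell, so [cell_rectint] does not apply; continuity on the
     boundary replaces it. *)
  - have e1 : (0 : int)%:~R - half = - half :> R by rewrite sub0r.
    have e2 : (0 + 1 : int)%:~R - half = half :> R by rewrite add0r; field.
    have e3 : (0 : int)%:~R + half = half :> R by rewrite add0r.
    have bc : boundary_continuous (slice_kernel z) (- half) half (- half) half.
      move=> t tb; apply: differentiable_continuous; apply: kernel_differentiable.
        apply: hD; rewrite /grid_cell e1 e3.
        by apply: rect_boundary_crect tb; case/andP: h0 => /ltW a /ltW b; apply: le_trans b.
      exact: (rect_boundary_neq0 h0 h0 tb).
    have vI x : x = - half \/ x = half ->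
        cintegrable (- half) half (fun y => slice_kernel z (Complex x y)).
      by move=> xE; apply: vertical_cintegrable => y yy; apply: bc; right.
    have hI y : y = - half \/ y = half ->
        cintegrable (- half) half (fun x => slice_kernel z (Complex x y)).
      by move=> yE; apply: horizontal_cintegrable => x xx; apply: bc; left.
    rewrite /cell /hor /ver /rectint !e1 !e2 !e3 !cintB//.
    + by apply: vI; right.
    + by apply: vI; left.
    + by apply: hI; left.
    + by apply: hI; right.
  - apply: differentiable_continuous; apply: dg; split=> /=;
      by rewrite sub0r add0r; case/andP: h0 => /ltW -> /ltW ->.
  - move=> t tr _; apply: dg; rewrite /grid_cell; move: tr.
    by rewrite !(sub0r, add0r).
rewrite negb_and mul0r => ij.
have dk t : grid_cell i j t -> differentiable (slice_kernel z) t.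
  move=> tc; apply: kernel_differentiable; first exact: hD.
  exact: grid_cell_neq0 tc.
rewrite cell_rectint; last by move=> t /dk; exact: differentiable_continuous.
by apply: goursat => //; exact: lh.
Qed.

(** The selection jumps as [z] moves, so it is frozen at [z0]. A cell selected for only one of [z]
    and [z0] has its slice in [D]; by [cell_value] the change it causes is 0 or is compensated by
    the change in the last term. *)
Lemma correction_near z0 : exists2 N : nat, supported N (sel z0) &
  \forall z \near z0, correction z =
    kappa^-1 * chain N (sel z0) (slice_kernel z) - (sel z0 0 0)%:R * f z.
Proof.
have [B hB] := bnd_locally z0.
pose N := (Num.truncn `|B|).+1.
have BN : B < N%:R by rewrite (le_lt_trans (ler_norm _))// truncnS_gt.
have supp z : bnd z <= B -> supported N (sel z).
  by move=> zB; apply: sel_supported; exact: le_lt_trans BN.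
exists N; first exact/supp/(nbhs_singleton hB).
(* Together with the [c / 10] of [grid_cell_close] this meets the distance [c / 5] demanded by
   [near_E_neq]. *)
have hc : \forall z \near z0, rnorm (z - z0) < c / 10.
  by apply/nbhs_rnorm; exists (c / 10); rewrite ?divr_gt0.
apply: filterS2 hB hc => z zB zc.
have -> : correction z = kappa^-1 * chain N (sel z) (slice_kernel z) -
    (sel z 0 0)%:R * f z.
  rewrite /correction; congr (_ * _ - _).
  have [h|/ltnW h] := leqP (sel_size z) N.
    by rewrite (chain_widen _ (@sel_size_supported z) h).
  by rewrite (chain_widen _ (supp _ zB) h).
apply/eqP; rewrite -subr_eq0; apply/eqP.
have diffE : chain N (sel z) (slice_kernel z) - chain N (sel z0) (slice_kernel z) =
    ((sel z 0 0)%:R - (sel z0 0 0)%:R) * (kappa * f z).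
  rewrite /chain -zsumB.
  transitivity (zsum N (fun i => zsum N (fun j => ((sel z i j)%:R - (sel z0 i j)%:R) *
      (((i == 0) && (j == 0))%:R * (kappa * f z))))).
    apply: eq_zsum => i; rewrite -zsumB; apply: eq_zsum => j; rewrite -mulrBl.
    have [->|ne] := eqVneq (sel z i j) (sel z0 i j); first by rewrite subrr !mul0r.
    congr (_ * _); apply: cell_value => t tc; have := grid_cell_close tc => tw.
    have tw0 := rnorm_ge0 (t *: w - grid_point i j *: w).
    apply: near_E_neq ne _ _.
      by rewrite opprD addrACA subrr add0r; lra.
    rewrite opprD addrACA.
    have := rnormD (z - z0) (t *: w - grid_point i j *: w); lra.
  rewrite (zsum_single N); last first.
    by move=> i /negPf i0; apply: zsum0 => j; rewrite i0/= mul0r mulr0.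
  rewrite (zsum_single N); last by move=> j /negPf ->; rewrite andbF mul0r mulr0.
  by rewrite eqxx mul1r.
have -> : kappa^-1 * chain N (sel z) (slice_kernel z) - (sel z 0 0)%:R * f z -
    (kappa^-1 * chain N (sel z0) (slice_kernel z) - (sel z0 0 0)%:R * f z) =
    kappa^-1 * (chain N (sel z) (slice_kernel z) - chain N (sel z0) (slice_kernel z)) -
    ((sel z 0 0)%:R - (sel z0 0 0)%:R) * f z by ring.
by rewrite diffE mulrCA mulKf ?kappa_neq0// subrr.
Qed.

(* An edge between a selected and an unselected cell avoids E, so only integrals
   over segments in Omega \ E survive in the boundary form of the chain. *)
Lemma horizontal_edge_D z i j x : sel z i j != sel z i (j - 1) ->
  i%:~R - half <= x <= i%:~R + half -> D (z + (Complex x (j%:~R - half) : C) *: w).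
Proof.
move=> ne xx; have dist k : grid_cell i k (Complex x (j%:~R - half)) ->
    5 * rnorm (z + (Complex x (j%:~R - half) : C) *: w - (z + grid_point i k *: w)) <= c.
  move=> /grid_cell_close tw; rewrite opprD addrACA subrr add0r.
  move: tw; have := rnorm_ge0 ((Complex x (j%:~R - half) : C) *: w - grid_point i k *: w).
  by lra.
apply: near_E_neq ne (dist _ _) (dist _ _); split=> //=; rewrite ?intrD; lra.
Qed.

Lemma vertical_edge_D z i j y : sel z (i - 1) j != sel z i j ->
  j%:~R - half <= y <= j%:~R + half -> D (z + (Complex (i%:~R - half) y : C) *: w).
Proof.
move=> ne yy; have dist k : grid_cell k j (Complex (i%:~R - half) y) ->
    5 * rnorm (z + (Complex (i%:~R - half) y : C) *: w - (z + grid_point k j *: w)) <= c.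
  move=> /grid_cell_close tw; rewrite opprD addrACA subrr add0r.
  move: tw; have := rnorm_ge0 ((Complex (i%:~R - half) y : C) *: w - grid_point k j *: w).
  by lra.
apply: near_E_neq ne (dist _ _) (dist _ _); split=> //=; rewrite ?intrD; lra.
Qed.

Lemma half_int_neq0 (j : int) : j%:~R - half != 0 :> R.
Proof.
rewrite subr_eq0; apply/eqP => jE; have : (2 * j)%:~R = 1%:~R :> R.
  by rewrite intrM jE; field.
by move/eqP; rewrite eqr_int => /eqP; lia.
Qed.

(** In boundary form an edge has a nonzero coefficient only if it separates a selected from an
    unselected cell. Its slice at [z0] then lies in [D] and [cint_differentiable] applies; the other
    edges drop out whatever their integrals are. *)
Lemma chain_differentiable N z0 : supported N (sel z0) ->
  differentiable (fun z => chain N (sel z0) (slice_kernel z)) z0.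
Proof.
move=> sN; rewrite (_ : (fun _ => _) =
    (fun z => chain_boundary N (sel z0) (slice_kernel z))); last first.
  by apply/funext => z; exact: chainE.
have cz (a : C) u : (a != 0 -> differentiable u z0) ->
    differentiable (fun z => a * u z : C) z0.
  have [->|a0 /(_ isT) du] := eqVneq a 0.
    move=> _; rewrite (_ : (fun _ => _) = cst (0 : C)); first exact: differentiable_cst.
    by apply/funext => z; rewrite mul0r.
  by apply: differentiableM => //; exact: differentiable_cst.
have hle (k : int) : k%:~R - half <= k%:~R + half :> R by lra.
have bneq (b1 b2 : bool) : (b1%:R - b2%:R != 0 :> C) -> b1 != b2.
  by apply: contraNneq => ->; rewrite subrr.
apply: (@zsum_differentiable _ _ N (fun i z => zsum N (fun j =>
    ((sel z0 i j)%:R - (sel z0 i (j - 1))%:R) * hor (slice_kernel z) i j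
    + imag_unit * (((sel z0 (i - 1) j)%:R - (sel z0 i j)%:R) * ver (slice_kernel z) i j)))) => i.
apply: (@zsum_differentiable _ _ N (fun j z =>
    ((sel z0 i j)%:R - (sel z0 i (j - 1))%:R) * hor (slice_kernel z) i j
    + imag_unit * (((sel z0 (i - 1) j)%:R - (sel z0 i j)%:R) * ver (slice_kernel z) i j))) => j.
apply: differentiableD.
  apply: cz => /bneq ne.
  apply: (@cint_differentiable _ _ f D _ _ (fun x => Complex x (j%:~R - half) : C)
    (fun x => (Complex x (j%:~R - half) : C)^-1) w z0 (hle i) open_diff f_hol).
  - by move=> x _; exact: continuous_horizontal.
  - move=> x _; apply: (@continuous_comp _ _ _ (fun x => Complex x (j%:~R - half) : C) (fun t : C => t^-1)).
      exact: continuous_horizontal.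
    apply: differentiable_continuous; apply: differentiable_inv.
    by apply/eqP => -[_ /eqP]; exact/negP/half_int_neq0.
  - by move=> x xx; exact: horizontal_edge_D ne xx.
apply: (cz _ _) => _; apply: (cz _ _) => /bneq ne.
apply: (@cint_differentiable _ _ f D _ _ (fun y => Complex (i%:~R - half) y : C)
    (fun y => (Complex (i%:~R - half) y : C)^-1) w z0 (hle j) open_diff f_hol).
- by move=> x _; exact: continuous_vertical.
- move=> x _; apply: (@continuous_comp _ _ _ (fun y => Complex (i%:~R - half) y : C) (fun t : C => t^-1)).
    exact: continuous_vertical.
  apply: differentiable_continuous; apply: differentiable_inv.
  by apply/eqP => -[/eqP + _]; exact/negP/half_int_neq0.
- by move=> x xx; exact: vertical_edge_D ne xx.
Qed.

Lemma near_eq_differentiable (g h : V -> C) z : (\forall x \near z, g x = h x) ->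
  differentiable h z -> differentiable g z.
Proof.
move=> gh dh; have [K [_ hK]] := diff_bound dh.
apply: (@rnorm_differentiable _ _ _ _ ('d h z) _ K) => //.
  by move=> a x y; exact: linearP.
move=> e e0; have [d d0 hd] := differentiable_rnorm dh e0.
have /nbhs_rnorm0[d' d'0 hd'] := gh; have gz : g z = h z := nbhs_singleton gh.
exists (Num.min d d'); first by rewrite lt_min d0.
by move=> v; rewrite lt_min => /andP[vd vd']; rewrite gz hd'//; exact: hd.
Qed.

Lemma near_E_self z : E z -> near_E z.
Proof. by move=> Ez; apply/asboolP; exists z => //; rewrite subrr rnorm0. Qed.

Lemma near_E_Omega z : near_E z -> Omega z.
Proof.
move=> /asboolP[e Ee ze]; apply: (E_nbhd Ee); move: ze c_gt0; lra.
Qed.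

Lemma sel00 z : sel z 0 0 = near_E z.
Proof. by rewrite /sel grid_point00 scale0r addr0. Qed.

Lemma correction_differentiable z : ~ E z -> differentiable correction z.
Proof.
move=> Ez; have [N sN hN] := correction_near z.
apply: near_eq_differentiable hN _; apply: differentiableB.
  apply: differentiableM; first exact: differentiable_cst.
  exact: chain_differentiable.
rewrite sel00; case: (boolP (near_E z)) => [nz|_].
  apply: differentiableM; first exact: differentiable_cst.
  by apply: f_hol; split=> //; exact: near_E_Omega.
rewrite (_ : (fun _ => _) = cst (0 : C)); first exact: differentiable_cst.
by apply/funext => x; rewrite mul0r.
Qed.

Lemma extension_near z0 : E z0 -> exists2 N : nat, supported N (sel z0) &
  \forall z \near z0, extension z = kappa^-1 * chain N (sel z0) (slice_kernel z).
Proof.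
move=> Ez; have [N sN hN] := correction_near z0; exists N => //.
apply: filterS hN => z; rewrite /extension => ->.
by rewrite sel00 near_E_self// mul1r addrC subrK.
Qed.

Lemma extension_differentiable z : Omega z -> differentiable extension z.
Proof.
move=> Oz; have [Ez|Ez] := pselect (E z).
  have [N sN hN] := extension_near Ez.
  apply: near_eq_differentiable hN _.
  apply: differentiableM; first exact: differentiable_cst.
  exact: chain_differentiable.
apply: differentiableD; first exact: f_hol.
exact: correction_differentiable.
Qed.

(** * Vanishing of the correction *)

Section Vanishing.
Variables (m : V -> R) (nu : V) (K M : R).
Hypotheses (K_ge0 : 0 <= K) (m_slice : forall z t, m (z + t *: w) = m z).
Hypothesis m_lipschitz : forall z z', m z - m z' <= K * rnorm (z - z').
Hypothesis m_ray : forall z s, m (z + (Complex s 0 : C) *: nu) = m z + s.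
Hypothesis m_bounded : forall e, E e -> m e <= M.
Hypothesis D_connected : connected D.

(** Since [m] is constant along the slice and Lipschitz, a slice point within [c] of [E] would force
    [m z <= M + K * c]; hence no cell is selected. *)
Lemma correction_far z : M + K * c < m z -> correction z = 0.
Proof.
move=> far; have sel0 i j : sel z i j = false.
  apply/negP => /asboolP[e Ee he].
  have := m_lipschitz (z + grid_point i j *: w) e; rewrite m_slice.
  have : K * rnorm (z + grid_point i j *: w - e) <= K * c by rewrite ler_wpM2l// ltW.
  have := m_bounded Ee; lra.
rewrite /correction sel0 mul0r subr0 [chain _ _ _](_ : _ = 0) ?mulr0//.
by apply: zsum0 => i; apply: zsum0 => j; rewrite sel0 mul0r.
Qed.

Lemma correction_far_near z : M + K * c < m z -> locally_zero correction z.
Proof.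
have K1 : 0 < K + 1 by rewrite ltr_wpDl.
move=> far; apply/nbhs_rnorm; exists ((m z - (M + K * c)) / (K + 1)).
  by apply: divr_gt0 => //; rewrite subr_gt0.
move=> y; rewrite ltr_pdivlMr// => yz; apply: correction_far.
have := m_lipschitz z y; rewrite rnormB; have := rnorm_ge0 (y - z); lra.
Qed.

Lemma continuous_ray e (s : R) :
  {for s, continuous (fun s : R => e + (Complex s 0 : C) *: nu)}.
Proof.
apply: continuousD; first exact: cst_continuous.
by apply: continuousZl; exact: continuous_horizontal.
Qed.

(* The half-line leaving E for the last time joins E to the region where m is
   large, and there no slice meets the neighbourhood of E. *)
Lemma correction_zero_somewhere : E !=set0 ->
  exists2 z, D z & locally_zero correction z.
Proof.
move=> [e Ee]; pose ray s := e + (Complex s 0 : C) *: nu.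
have cray : continuous ray := @continuous_ray e.
have rayM s : E (ray s) -> s <= M - m e.
  by move=> /m_bounded; rewrite /ray m_ray; lra.
pose S := [set s | E (ray s)].
have S0 : S 0 by rewrite /S /= /ray scale0r addr0.
have hS : has_sup S by split; [exists 0|exists (M - m e) => s; exact: rayM].
have Ssup : S (sup S).
  have cS : closed S by apply: (preimage_closed _ E_closed) => s _; exact: cray.
  by apply: cS; apply: closure_sup; [exact: hS.1|exact: hS.2].
have ES s : sup S < s -> ~ E (ray s).
  by move=> ss Es; have := ub_le_sup hS.2 Es; rewrite leNgt ss.
pose A := ray @` `]sup S, +oo[.
have EA : A `<=` ~` E.
  by move=> _ [s /= + <-]; rewrite in_itv/= andbT; exact: ES.
have cA : connected A.
  apply: connected_continuous_connected; last exact: continuous_subspaceT.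
  exact/connected_intervalP/interval_is_interval.
have far : exists2 a, A a & locally_zero correction a.
  pose s := Num.max (sup S) (M + K * c - m e) + 1.
  exists (ray s).
    by exists s => //=; rewrite in_itv/= andbT /s ltr_pwDr// le_max lexx.
  apply: correction_far_near; rewrite /ray m_ray /s.
  have : M + K * c - m e <= Num.max (sup S) (M + K * c - m e) by rewrite le_max lexx orbT.
  lra.
have zA := @identity_principle _ _ correction (~` E) A (closed_openC E_closed) EA cA
  (fun z => @correction_differentiable z) far.
(* The exit point lies in [E], hence in the open set [Omega], so just beyond it the ray runs inside
   [Omega] and off [E]. *)
have [d d0 hd] : exists2 d : R, 0 < d & forall s, `|sup S - s| < d -> Omega (ray s).
  have Op : nbhs (ray (sup S)) Omega.
    by apply: open_nbhs_nbhs; split=> //; exact/near_E_Omega/near_E_self.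
  have /nbhs_ballP[d /= d0 hd] := cray _ _ Op.
  by exists d => // s sd; exact: hd.
pose s := sup S + d / 2.
have As : A (ray s).
  by exists s => //=; rewrite in_itv/= andbT /s ltrDl divr_gt0.
exists (ray s); last exact: zA.
split; last exact: EA.
by apply: hd; rewrite /s opprD addrA subrr sub0r normrN gtr0_norm ?divr_gt0//; lra.
Qed.

Lemma correction_eq0 z : E !=set0 -> D z -> correction z = 0.
Proof.
move=> /correction_zero_somewhere far Dz.
have := @identity_principle _ _ correction D D open_diff _ D_connected _ far z Dz.
move=> /(_ (fun _ h => h) (fun z Dz => correction_differentiable (proj2 Dz))).
exact: nbhs_singleton.
Qed.

End Vanishing.

(** * Pointwise square bound of the extension on E *)

Section SquareBound.
Local Notation mu := (@lebesgue_measure R).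
Local Open Scope ereal_scope.

(** Extended by 0 outside [D], so that its translates can be integrated over the whole space. *)
Definition energy : V -> \bar R := (fun x => (rnorm (f x) ^+ 2)%:E) \_ D.

Lemma energy_ge0 z : 0 <= energy z.
Proof. by rewrite /energy /patch; case: ifP => // _; rewrite lee_fin sqr_ge0. Qed.

Lemma continuous_rnorm_sqr (u : R -> C) (x : R) : {for x, continuous u} ->
  {for x, continuous (fun x => (rnorm (u x) ^+ 2)%R)}.
Proof.
move=> cu; rewrite (_ : (fun _ => _) =
    (fun x => complex.Re (u x) * complex.Re (u x) + complex.Im (u x) * complex.Im (u x))%R).
  apply: continuousD; apply: continuousM.
  - by apply: (@continuous_comp _ _ _ u) cu _; exact: continuous_Re.
  - by apply: (@continuous_comp _ _ _ u) cu _; exact: continuous_Re.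
  - by apply: (@continuous_comp _ _ _ u) cu _; exact: continuous_Im.
  - by apply: (@continuous_comp _ _ _ u) cu _; exact: continuous_Im.
by apply/funext => y; rewrite rnorm_sqr !expr2.
Qed.

Definition edge_energy (a : R) (gamma : R -> C) z :=
  \int[mu]_(x in `[a, (a + 1)%R]) energy (z + gamma x *: w)%R.

(** Cauchy-Schwarz on a segment of length 1; the 4 bounds [1 / |t|^2] for [|t| >= 1/2]. *)
Lemma edge_bound (a : R) (gamma : R -> C) z :
  (forall x, {for x, continuous gamma}) ->
  (forall x, half <= rnorm (gamma x))%R ->
  (forall x, (a <= x <= a + 1)%R -> D (z + gamma x *: w)%R) ->
  (rnorm (cint a (a + 1) (fun x => slice_kernel z (gamma x))) ^+ 2)%:E <=
  4%:E * edge_energy a gamma z.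
Proof.
move=> cg g2 hD.
have cf x : (a <= x <= a + 1)%R -> {for x, continuous (fun x => f (z + gamma x *: w)%R)}.
  move=> xa; apply: (@continuous_comp _ _ _ (fun x => z + gamma x *: w)%R f).
    apply: continuousD; first exact: cst_continuous.
    by apply: continuousZl; exact: cg.
  by apply: differentiable_continuous; apply: f_hol; exact: hD.
have ck x : (a <= x <= a + 1)%R -> {for x, continuous (fun x => slice_kernel z (gamma x))}.
  move=> xa; apply: continuousM; first exact: cf.
  apply: (@continuous_comp _ _ _ gamma (fun t : C => t^-1)%R); first exact: cg.
  apply: differentiable_continuous; apply: differentiable_inv.
  by apply/eqP => g0; have := g2 x; rewrite g0 rnorm0 leNgt invr_gt0 ltr0n.
apply: (le_trans (cint_sqr ck)).
have iE : \int[mu]_(x in `[a, (a + 1)%R]) (4%:E * (rnorm (f (z + gamma x *: w)%R) ^+ 2)%:E)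
    = 4%:E * edge_energy a gamma z.
  rewrite integralZl//=; last by apply: continuous_real_integrable => x /cf; exact: continuous_rnorm_sqr.
  congr (_ * _); apply: eq_integral => x; rewrite inE/= in_itv/= => /hD Dx.
  by rewrite /energy patchE mem_set.
rewrite -iE; apply: le_integral => //=.
- by apply: continuous_real_integrable => x /ck; exact: continuous_rnorm_sqr.
- apply: integrableZl => //.
  by apply: continuous_real_integrable => x /cf; exact: continuous_rnorm_sqr.
move=> x _; rewrite -EFinM lee_fin /slice_kernel rnormM exprMn mulrC ler_wpM2r ?sqr_ge0//.
rewrite rnormV (_ : 4 = half^-1 ^+ 2)%R; last by field.
have h0 : (0 < half)%R by rewrite invr_gt0.
rewrite lerXn2r ?nnegrE ?invr_ge0 ?rnorm_ge0 ?(ltW h0)// lef_pV2 ?posrE//.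
exact: lt_le_trans (g2 x).
Qed.

Definition hor_energy i j := edge_energy (i%:~R - half)%R (fun x => Complex x (j%:~R - half)%R).

Definition ver_energy i j := edge_energy (j%:~R - half)%R (fun y => Complex (i%:~R - half)%R y).

Lemma edge_energy_ge0 a gamma z : 0 <= edge_energy a gamma z.
Proof. by apply: integral_ge0 => x _; exact: energy_ge0. Qed.

Lemma half_le_int (k : int) : (half <= `|k%:~R - half|)%R.
Proof.
rewrite leNgt; apply/negP; rewrite ltr_norml => /andP[h1 h2].
have : (0 < k%:~R :> R)%R by lra.
have : (k%:~R < 1%:~R :> R)%R by lra.
rewrite ltr_int ltr0z; lia.
Qed.

Lemma boolB_sqr (b1 b2 : bool) (z : C) :
  (rnorm ((b1%:R - b2%:R) * z : C) ^+ 2 = if b1 == b2 then 0 else rnorm z ^+ 2)%R.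
Proof.
case: b1 b2 => -[] /=; rewrite ?subrr ?mul0r ?rnorm0 ?expr0n// ?subr0 ?mul1r//.
by rewrite sub0r mulN1r rnormN.
Qed.

(** One factor [2 N + 1] for each of the two nested sums in Cauchy-Schwarz, and [8 = 2 * 4] from
    separating horizontal from vertical edges and from [edge_bound]. *)
Definition square_const (N : nat) : R := (rnorm (kappa^-1 : C) ^+ 2 * ((2 * N).+1%:R ^+ 2 * 8))%R.

(** The right side sums over all edges of the grid, not just those in the contour at [z]; the
    selection, which varies with [z], thus disappears before integration. *)
Lemma extension_sqr_bound z (N : nat) : E z -> (bnd z < N%:R)%R ->
  (rnorm (extension z) ^+ 2)%:E <= (square_const N)%:E *
    \sum_(k < (2 * N).+1) \sum_(l < (2 * N).+1)
      (hor_energy (k%:Z - N%:Z) (l%:Z - N%:Z) z + ver_energy (k%:Z - N%:Z) (l%:Z - N%:Z) z).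
Proof.
move=> Ez zN; have sN := sel_supported zN.
have -> : extension z = (kappa^-1 * chain_boundary N (sel z) (slice_kernel z))%R.
  rewrite /extension /correction sel00 near_E_self// mul1r addrC subrK; congr (_ * _)%R.
  rewrite -(chainE _ sN); have [h|/ltnW h] := leqP (sel_size z) N.
    by rewrite (chain_widen _ (@sel_size_supported z) h).
  by rewrite (chain_widen _ sN h).
pose X i j := (((sel z i j)%:R - (sel z i (j - 1))%:R) * hor (slice_kernel z) i j
    + imag_unit * (((sel z (i - 1) j)%:R - (sel z i j)%:R) * ver (slice_kernel z) i j))%R.
have X_le i j : (rnorm (X i j : C) ^+ 2)%:E <= 8%:E * (hor_energy i j z + ver_energy i j z).
  apply: (@le_trans _ _ (2%:E * ((rnorm (((sel z i j)%:R - (sel z i (j - 1))%:R)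
      * hor (slice_kernel z) i j : C) ^+ 2)%:E +
      (rnorm (((sel z (i - 1) j)%:R - (sel z i j)%:R) * ver (slice_kernel z) i j : C) ^+ 2)%:E))).
    rewrite -EFinD -EFinM lee_fin.
    set a := (_ * hor _ _ _)%R; set b := (_ * ver _ _ _)%R.
    have := rnormD a (imag_unit * b)%R.
    rewrite rnormM (_ : rnorm imag_unit = 1%R) ?mul1r; last first.
      by rewrite rnorm_normc /= expr0n expr1n add0r sqrtr1.
    rewrite /X -/a -/b; move: (rnorm_ge0 (a + imag_unit * b)%R) (rnorm_ge0 a) (rnorm_ge0 b).
    move: (rnorm _) (rnorm a) (rnorm b) => x y t x0 y0 t0 xyt.
    have : (x ^+ 2 <= (y + t) ^+ 2)%R by rewrite lerXn2r ?nnegrE ?addr_ge0.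
    have : (0 <= (y - t) ^+ 2)%R by rewrite sqr_ge0.
    nra.
  rewrite (_ : 8%:E = 2%:E * 4%:E); last by rewrite -EFinM; congr _%:E; ring.
  rewrite -muleA lee_wpmul2l//; rewrite ge0_muleDr ?edge_energy_ge0//.
  have e1 (k : int) : (k%:~R - half + 1 = k%:~R + half)%R by field.
  apply: leeD; rewrite boolB_sqr.
    case: eqP => [_|/eqP ne]; first by rewrite mule_ge0// edge_energy_ge0.
    rewrite /hor -e1; apply: edge_bound.
    - by move=> x; exact: continuous_horizontal.
    - by move=> x; apply: le_trans (Im_le_rnorm _); exact: half_le_int.
    - by rewrite e1 => x xx; exact: horizontal_edge_D ne xx.
  case: eqP => [_|/eqP ne]; first by rewrite mule_ge0// edge_energy_ge0.
  rewrite /ver -e1; apply: edge_bound.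
  - by move=> x; exact: continuous_vertical.
  - by move=> x; apply: le_trans (Re_le_rnorm _); exact: half_le_int.
  - by rewrite e1 => x xx; exact: vertical_edge_D ne xx.
rewrite rnormM exprMn /square_const [in leLHS]EFinM [in leRHS]EFinM -muleA lee_wpmul2l ?lee_fin ?sqr_ge0//.
apply: (@le_trans _ _ (((2 * N).+1%:R ^+ 2 * \sum_(k < (2 * N).+1) \sum_(l < (2 * N).+1)
    rnorm (X (k%:Z - N%:Z)%R (l%:Z - N%:Z)%R : C) ^+ 2)%R)%:E).
  rewrite lee_fin /chain_boundary expr2 -mulrA; apply: (le_trans (rnorm_zsum_sqr _ _)).
  rewrite ler_wpM2l// mulr_sumr ler_sum// => k _; exact: rnorm_zsum_sqr.
rewrite [in leLHS]EFinM [in leRHS]EFinM -muleA lee_wpmul2l ?lee_fin ?sqr_ge0// -sumEFin ge0_sume_distrr; last first.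
  by move=> k _; apply: sume_ge0 => l _; rewrite adde_ge0 ?edge_energy_ge0.
apply: lee_sum => k _; rewrite -sumEFin ge0_sume_distrr; last first.
  by move=> l _; rewrite adde_ge0 ?edge_energy_ge0.
by apply: lee_sum => l _; exact: X_le.
Qed.

End SquareBound.

End Extension.

(** * Translation invariance of Lebesgue measure *)

Section TupleTranslation.
Context {R : realType}.
Local Notation T := (measurableTypeR R).
Local Notation lambda := (@lebesgue_measure R).
Local Open Scope ereal_scope.

(** Lebesgue measure is determined by its values on half-open intervals, whose lengths are unchanged
    by translation. *)
Lemma lebesgue_measure_shift (v : R) (A : set R) : measurable A ->
  pushforward lambda (fun x : T => (x + v)%R : T) A = lambda A.
Proof.
have mshift : measurable_fun setT (fun x : T => (x + v)%R : T).
  by apply: measurable_funD => //; exact: measurable_cst.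
pose nu : {measure set T -> \bar R} :=
  measure_function_pushforward__canonical__measure_function_Measure lambda mshift.
move=> mA; apply/esym/(@lebesgue_measure_unique _ nu) => //= _ [[a b]] _ <-.
rewrite /pushforward (_ : _ @^-1` _ = `](a - v)%R, (b - v)%R]%classic); last first.
  by apply/seteqP; split=> x /=; rewrite !in_itv/= ltrBlDr lerBrDr.
by rewrite !lebesgue_measure_itv/= !lte_fin ltrD2r -!EFinB; congr (if _ then _%:E else _); ring.
Qed.

Lemma ge0_integral_shift (v : R) (g : R -> \bar R) : measurable_fun [set: R] g ->
  (forall x, 0 <= g x) -> \int[lambda]_x g (x + v)%R = \int[lambda]_x g x.
Proof.
move=> mg g0; have mshift : measurable_fun setT (fun x : T => (x + v)%R : T).
  by apply: measurable_funD => //; exact: measurable_cst.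
have := @ge0_integral_pushforward _ _ T T R _ mshift lambda setT g measurableT mg (fun x _ => g0 x).
rewrite preimage_setT => <-; apply: eq_measure_integral => //= A mA _.
exact: lebesgue_measure_shift.
Qed.

Lemma measurable_tuple_cons N : measurable_fun setT (@tuple_cons R N).
Proof. exact: measurable_cons. Qed.

Lemma integral_tupleS N (h : N.+1.-tuple T -> \bar R) : measurable_fun setT h ->
  (forall t, 0 <= h t) -> \int[lebesgue_tuple N.+1]_t h t =
  \int[lambda]_x \int[lebesgue_tuple N]_t h (tuple_cons (x, t)).
Proof.
move=> mh h0; have mcons := @measurable_tuple_cons N.
rewrite (@ge0_integral_pushforward _ _ _ _ R _ mcons (lambda \x lebesgue_tuple N) setT h)//.
rewrite preimage_setT (fubini_tonelli1 (h \o @tuple_cons R N))//.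
  exact: measurableT_comp.
by move=> x; exact: h0.
Qed.

Definition tuple_shift N (v : 'I_N -> R) (t : N.-tuple T) : N.-tuple T :=
  [tuple (tnth t i + v i)%R | i < N].

Lemma measurable_tuple_shift N d (S : measurableType d) (v : S -> 'I_N -> R)
    (u : S -> N.-tuple T) : (forall i, measurable_fun setT (v ^~ i : S -> T)) ->
  measurable_fun setT u -> measurable_fun setT (fun s => tuple_shift (v s) (u s)).
Proof.
move=> mv mu; apply/measurable_fun_tnthP => i.
rewrite (_ : _ \o _ = (fun s => (tnth (u s) i + v s i)%R)).
  apply: measurable_funD; last exact: mv.
  by apply: (@measurableT_comp _ _ _ _ _ _ (fun t => tnth t i)) => //; exact: measurable_tnth.
by apply/funext => s /=; rewrite tnth_mktuple.
Qed.

(** One coordinate at a time: Tonelli splits off the first, and induction translates the others. *)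
Lemma integral_tuple_shift N (v : 'I_N -> R) (h : N.-tuple T -> \bar R) :
  measurable_fun setT h -> (forall t, 0 <= h t) ->
  \int[lebesgue_tuple N]_t h (tuple_shift v t) = \int[lebesgue_tuple N]_t h t.
Proof.
elim: N v h => [|N IH] v h mh h0.
  by apply: eq_integral => t _; congr h; rewrite [LHS]tuple0 [RHS]tuple0.
have mshift M (u : 'I_M -> R) : measurable_fun setT (tuple_shift u).
  by apply: (@measurable_tuple_shift _ _ _ (fun=> u) id) => // i; exact: measurable_cst.
have mhs : measurable_fun setT (fun t => h (tuple_shift v t)).
  by apply: measurableT_comp => //; exact: mshift.
rewrite (integral_tupleS mhs (fun t => h0 _)) (integral_tupleS mh h0).
pose g x := \int[lebesgue_tuple N]_t h (tuple_cons (x, t)).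
rewrite -[RHS]/(\int[lambda]_x g x).
have mhc : measurable_fun setT (h \o @tuple_cons R N).
  exact: measurableT_comp mh (@measurable_tuple_cons N).
rewrite -(@ge0_integral_shift (v ord0) g); last 2 first.
- exact: (measurable_fun_fubini_tonelli_F (h \o @tuple_cons R N) mhc (fun p => h0 _)).
- by move=> x; exact: integral_ge0.
apply: eq_integral => x _; rewrite /g.
rewrite -(IH (v \o lift ord0) (fun t => h (tuple_cons ((x + v ord0)%R, t))))//.
  apply: eq_integral => t _; congr h; apply: eq_from_tnth => i.
  rewrite tnth_mktuple; have [j ->|->] := unliftP ord0 i.
    by rewrite !tnthS tnth_mktuple.
  by [].
apply: (@measurableT_comp _ _ _ _ _ _ (h \o @tuple_cons R N) _ (fun t => ((x + v ord0)%R : T, t))) => //.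
exact: measurable_pair1.
Qed.

(** Tonelli exchanges the integrals; every translate has the same integral as [h], and the segment
    has length 1. *)
Lemma integral_tuple_segment N (h : N.-tuple T -> \bar R) (a : R) (v : R -> 'I_N -> R) :
  measurable_fun setT h -> (forall t, 0 <= h t) ->
  (forall i, measurable_fun setT (v ^~ i : T -> T)) ->
  measurable_fun setT
    (fun t => \int[lambda]_(x in `[a, (a + 1)%R]) h (tuple_shift (v x) t)) /\
  \int[lebesgue_tuple N]_t \int[lambda]_(x in `[a, (a + 1)%R]) h (tuple_shift (v x) t) =
  \int[lebesgue_tuple N]_t h t.
Proof.
move=> mh h0 mv.
pose F (p : T * N.-tuple T) := (\1_(`[a, (a + 1)%R]%classic : set R) p.1)%:E * h (tuple_shift (v p.1) p.2).
have mF : measurable_fun setT F.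
  apply: emeasurable_funM.
    apply/measurable_EFinP; apply: measurableT_comp; last exact: measurable_fst.
    exact: measurable_indic.
  apply: measurableT_comp => //; apply: (@measurable_tuple_shift _ _ _ (fun p => v p.1) snd).
    by move=> i; apply: (@measurableT_comp _ _ _ _ _ _ (v ^~ i)) => //; exact: mv.
  exact: measurable_snd.
have F0 p : 0 <= F p by rewrite mule_ge0// lee_fin.
have FE t : \int[lambda]_(x in `[a, (a + 1)%R]) h (tuple_shift (v x) t) =
    \int[lambda]_x F (x, t).
  rewrite integral_mkcond; apply: eq_integral => x _; rewrite /F /= patchE indicE.
  by case: ifP => _; rewrite ?mul1e ?mul0e.
rewrite (_ : (fun t => _) = (fun t => \int[lambda]_x F (x, t))); last first.
  by apply/funext => t; exact: FE.
split; first exact: (measurable_fun_fubini_tonelli_G F mF F0).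
rewrite -(fubini_tonelli F mF F0) /F/=.
transitivity (\int[lambda]_x ((\int[lebesgue_tuple N]_t h t) *
    (\1_(`[a, (a + 1)%R]%classic : set R) x)%:E)).
  apply: eq_integral => x _.
  have mx : measurable_fun setT (fun t => h (tuple_shift (v x) t)).
    apply: measurableT_comp => //; apply: (@measurable_tuple_shift _ _ _ (fun=> v x) id) => //.
  by rewrite ge0_integralZl ?integral_tuple_shift// ?lee_fin// muleC.
have m1 : measurable_fun [set: T] (EFin \o (\1_(`[a, (a + 1)%R]%classic : set T) : T -> R)).
  by apply/measurable_EFinP; exact: measurable_indic.
have i0 : 0 <= \int[lebesgue_tuple N]_t h t by exact: integral_ge0.
have p0 : forall x : T, setT x -> 0 <= (EFin \o (\1_(`[a, (a + 1)%R]%classic : set T) : T -> R)) x.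
  by move=> x _ /=; rewrite lee_fin.
rewrite (ge0_integralZl lambda measurableT m1 p0 i0).
rewrite integral_indic// setIT /= lebesgue_measure_itv/= lte_fin ltrDl ltr01.
by rewrite -EFinB addrAC subrr add0r mule1.
Qed.

End TupleTranslation.

(** * Complex lines transverse to a subspace of codimension 3 *)

Section LinearAlgebra.
Context {R : realType} {n : nat}.
Local Notation C := (Cplx R).
Local Notation Cn := 'rV[C]_n.
Local Notation Rn := 'rV[R]_(n + n).
Implicit Types (u v : Rn) (z w : Cn) (t : C).

Definition functional u z : R := \sum_i u 0 i * realify z 0 i.

(** The coefficients of the complex-linear form whose real part is [functional u]. *)
Definition dual_coord u : Cn :=
  \row_j (Complex (u 0 (lshift n j)) (- u 0 (rshift n j)) : C).

(** Corresponds to multiplication of [dual_coord u] by the imaginary unit. *)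
Definition dual_rot u : Rn := row_mx (rsubmx u) (- lsubmx u).

Lemma realifyl z j : realify z 0 (lshift n j) = complex.Re (z 0 j).
Proof. by rewrite /realify row_mxEl mxE. Qed.

Lemma realifyr z j : realify z 0 (rshift n j) = complex.Im (z 0 j).
Proof. by rewrite /realify row_mxEr mxE. Qed.

Lemma Re_sum (F : 'I_n -> C) : complex.Re (\sum_j F j : C) = \sum_j complex.Re (F j).
Proof. by elim/big_rec2: _ => // j x y _ <-; rewrite ReD. Qed.

Lemma functionalE u z : functional u z = complex.Re (\sum_j dual_coord u 0 j * z 0 j : C).
Proof.
rewrite Re_sum /functional big_split_ord /= -big_split; apply: eq_bigr => j _.
by rewrite /= realifyl realifyr Re_mul mxE /=; ring.
Qed.

Lemma functionalD u z w : functional u (z + w) = functional u z + functional u w.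
Proof.
rewrite !functionalE -ReD -big_split; congr (complex.Re _).
by apply: eq_bigr => j _; rewrite [(z + w) 0 j]mxE mulrDr.
Qed.

Lemma functionalN u z : functional u (- z) = - functional u z.
Proof.
rewrite !functionalE -ReN -sumrN; congr (complex.Re _).
by apply: eq_bigr => j _; rewrite [(- z) 0 j]mxE mulrN.
Qed.

Lemma functionalB u z w : functional u (z - w) = functional u z - functional u w.
Proof. by rewrite functionalD functionalN. Qed.

Lemma functionalDl u v z : functional (u + v) z = functional u z + functional v z.
Proof. by rewrite /functional -big_split; apply: eq_bigr => i _; rewrite mxE mulrDl. Qed.

Lemma functionalZl (k : R) u z : functional (k *: u) z = k * functional u z.
Proof. by rewrite /functional mulr_sumr; apply: eq_bigr => i _; rewrite mxE mulrA. Qed.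

Lemma functional_scale u z t :
  functional u (t *: z) = complex.Re (t * \sum_j dual_coord u 0 j * z 0 j : C).
Proof.
rewrite functionalE mulr_sumr; congr (complex.Re _).
by apply: eq_bigr => j _; rewrite [(t *: z) 0 j]mxE mulrCA.
Qed.

Lemma functional_real_scale u z (s : R) :
  functional u ((Complex s 0 : C) *: z) = s * functional u z.
Proof. by rewrite functional_scale functionalE Re_mul /= mul0r subr0. Qed.

Lemma dual_rot_comb u (k : C) :
  dual_coord (complex.Re k *: u + complex.Im k *: dual_rot u) = k *: dual_coord u.
Proof.
apply/rowP => j.
have el : dual_rot u 0 (lshift n j) = u 0 (rshift n j) by rewrite /dual_rot row_mxEl mxE.
have er : dual_rot u 0 (rshift n j) = - u 0 (lshift n j).
  by rewrite /dual_rot row_mxEr !mxE.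
have comb i : (complex.Re k *: u + complex.Im k *: dual_rot u) 0 i =
    complex.Re k * u 0 i + complex.Im k * dual_rot u 0 i by rewrite mxE [X in X + _]mxE [X in _ + X]mxE.
rewrite [LHS]mxE [RHS]mxE [dual_coord u 0 j]mxE !comb el er.
by apply: complexP; rewrite ?Re_mul ?Im_mul /=; ring.
Qed.

Lemma dual_coord_inj u v : dual_coord u = dual_coord v -> u = v.
Proof.
move=> uv; apply/rowP => i; have [j ->|j ->] := split_ordP i.
  by have /rowP/(_ j) := uv; rewrite !mxE => -[].
by have /rowP/(_ j) := uv; rewrite !mxE => -[_ /oppr_inj].
Qed.

Definition annihilates u (V : {vspace Rn}) :=
  forall v, v \in V -> \sum_i u 0 i * v 0 i = 0.

(** The kernel of the transposed basis matrix consists of the vectors orthogonal to [V]; its rank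
    follows from rank-nullity. *)
Lemma annihilator (V : {vspace Rn}) : exists A : 'M[R]_(n + n),
  (n + n - \dim V <= \rank A)%N /\ forall i, annihilates (row i A) V.
Proof.
pose B : 'M[R]_(\dim V, n + n) := \matrix_(i < \dim V) (vbasis V)`_i.
exists (kermx B^T); split.
  by rewrite mxrank_ker mxrank_tr leq_sub2l// rank_leq_row.
move=> i v vV; have kB : row i (kermx B^T) *m B^T = 0.
  by rewrite -row_mul mulmx_ker row0.
rewrite (coord_vbasis vV).
transitivity (\sum_k coord (vbasis V) k v * (row i (kermx B^T) *m B^T) 0 k).
  under eq_bigr do rewrite summxE mulr_sumr.
  rewrite exchange_big; apply: eq_bigr => k _; rewrite !mxE mulr_sumr.
  apply: eq_bigr => j _; rewrite !mxE mulrCA; congr (_ * (_ * _)).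
by rewrite big1// => k _; rewrite kB mxE mulr0.
Qed.

Lemma row_notin_of_rank (A : 'M[R]_(n + n)) (u v : Rn) : (3 <= \rank A)%N ->
  exists i, ~~ (row i A <= col_mx u v)%MS.
Proof.
move=> rA; apply/row_subPn; apply/negP => /mxrankS; rewrite leqNgt => /negP; apply.
by apply: leq_trans rA; rewrite ltnS (leq_trans (rank_leq_row _)).
Qed.

Lemma comb_col_mx (u v : Rn) (x y : R) : ((x *: u + y *: v)%R <= col_mx u v)%MS.
Proof.
apply: addmx_sub; apply: scalemx_sub.
  by apply: submx_trans (addsmxSl u v) _; rewrite addsmxE.
by apply: submx_trans (addsmxSr u v) _; rewrite addsmxE.
Qed.

Lemma annihilatesB u v (V : {vspace Rn}) (k : R) : annihilates u V ->
  annihilates v V -> annihilates (u - k *: v) V.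
Proof.
move=> hu hv x xV.
transitivity (\sum_i u 0 i * x 0 i - k * \sum_i v 0 i * x 0 i).
  by rewrite mulr_sumr -sumrB; apply: eq_bigr => i _; rewrite !mxE mulrBl mulrA.
by rewrite hu// hv// mulr0 subr0.
Qed.

(* Real codimension at least 3 enters twice: two annihilating functionals must be
   independent over the complex numbers, and a third one survives on the quotient
   by the complex line of w. *)
Lemma transverse_line (V : {vspace Rn}) : (3 <= n + n - \dim V)%N ->
  exists (u1 u2 u3 : Rn) (w nu : Cn),
  [/\ annihilates u1 V, annihilates u2 V & annihilates u3 V] /\
  [/\ forall t, functional u1 (t *: w) = complex.Re t,
      forall t, functional u2 (t *: w) = complex.Im t,
      forall t, functional u3 (t *: w) = 0 & functional u3 nu = 1].
Proof.
move=> V3; have [A [rA hA]] := annihilator V.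
have {V3}r3 := leq_trans V3 rA.
have [i1 n1] := row_notin_of_rank 0 0 r3.
set u1 := row i1 A in n1.
(* The real span of [u1] and [dual_rot u1] is the complex line of [u1], so [u2] becomes independent
   of [u1] over the complex numbers. *)
have [i2 n2] := row_notin_of_rank u1 (dual_rot u1) r3.
set u2 := row i2 A in n2.
have [i3 n3] := row_notin_of_rank u1 u2 r3.
set u3 := row i3 A in n3.
have u10 : u1 != 0.
  by apply: contraNneq n1 => ->; rewrite sub0mx.
have [j j0] : exists j, dual_coord u1 0 j != 0.
  apply/existsP; apply: contraNT u10; rewrite negb_exists => /forallP h.
  have E : dual_coord u1 = dual_coord 0.
    apply/rowP => j; have := h j; rewrite negbK => /eqP ->; rewrite mxE !mxE oppr0 //.
  by rewrite (dual_coord_inj E).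
(* Complex independence in coordinates: some 2 by 2 minor of the dual coordinates does not
   vanish. *)
have [k k0] : exists k, dual_coord u1 0 j * dual_coord u2 0 k
    - dual_coord u1 0 k * dual_coord u2 0 j != 0.
  apply/existsP; apply: contraNT n2; rewrite negb_exists => /forallP h.
  pose q := dual_coord u2 0 j / dual_coord u1 0 j.
  have -> : u2 = complex.Re q *: u1 + complex.Im q *: dual_rot u1.
    apply: dual_coord_inj; rewrite dual_rot_comb; apply/rowP => k.
    have := h k; rewrite negbK subr_eq0 => /eqP E; rewrite [RHS]mxE /q mulrAC [_ * dual_coord u1 0 k]mulrC -E mulrAC.
    by rewrite divff// mul1r.
  exact: comb_col_mx.
set d := _ - _ in k0.
pose iu := @imag_unit R.
(* Cramer's rule for the system that gives the two complex forms the values 1 and [- iu] at [w],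
   since [complex.Re (t * - iu) = complex.Im t]. *)
pose al : C := (dual_coord u2 0 k + iu * dual_coord u1 0 k) / d.
pose be : C := (- dual_coord u2 0 j - iu * dual_coord u1 0 j) / d.
pose w : Cn := al *: delta_mx 0 j + be *: delta_mx 0 k.
have sumw (c : Cn) : \sum_l c 0 l * w 0 l = c 0 j * al + c 0 k * be.
  under eq_bigr do rewrite !mxE eqxx /= mulrDr.
  rewrite big_split /=; congr (_ + _).
    rewrite (bigD1 j)//= eqxx mulr1 big1 ?addr0// => l /negPf ->; rewrite mulr0 mulr0//.
  rewrite (bigD1 k)//= eqxx mulr1 big1 ?addr0// => l /negPf ->; rewrite mulr0 mulr0//.
have s1 : \sum_l dual_coord u1 0 l * w 0 l = 1.
  rewrite sumw /al /be !mulrA -mulrDl -[RHS](divff k0); congr (_ / d).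
  by rewrite /d; ring.
have s2 : \sum_l dual_coord u2 0 l * w 0 l = - iu.
  rewrite sumw /al /be !mulrA -mulrDl -[RHS](mulfK k0); congr (_ / d).
  by rewrite /d; ring.
have f1 t : functional u1 (t *: w) = complex.Re t by rewrite functional_scale s1 mulr1.
have f2 t : functional u2 (t *: w) = complex.Im t.
  by rewrite functional_scale s2 Re_mul ReN ImN /=; ring.
pose x3 := functional u3 w; pose y3 := functional u3 (iu *: w).
have f3 t : functional u3 (t *: w) = complex.Re t * x3 + complex.Im t * y3.
  have xE : x3 = complex.Re (\sum_l dual_coord u3 0 l * w 0 l : C) by exact: functionalE.
  have yE : y3 = complex.Re (iu * \sum_l dual_coord u3 0 l * w 0 l : C) by exact: functional_scale.
  by rewrite functional_scale xE yE !Re_mul /=; ring.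
(* The subtraction makes the functional vanish at [w] and [iu *: w], hence on their whole complex
   line; it stays nonzero by the choice of [u3]. *)
pose v3 := u3 - x3 *: u1 - y3 *: u2.
have v30 : v3 != 0.
  apply: contraNneq n3 => v0.
  have -> : u3 = x3 *: u1 + y3 *: u2.
    by apply/eqP; rewrite -subr_eq0 opprD addrA; apply/eqP.
  exact: comb_col_mx.
have [i i0] : exists i, v3 0 i != 0.
  apply/existsP; apply: contraNT v30; rewrite negb_exists => /forallP h.
  by apply/eqP/rowP => i; have := h i; rewrite negbK => /eqP ->; rewrite mxE.
pose b : Rn := (v3 0 i)^-1 *: delta_mx 0 i.
pose nu : Cn := \row_l Complex (b 0 (lshift n l)) (b 0 (rshift n l)).
have bnu : realify nu = b.
  apply/rowP => l; have [l' ->|l' ->] := split_ordP l.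
    by rewrite realifyl mxE.
  by rewrite realifyr mxE.
exists u1, u2, v3, w, nu; split.
  by split; [exact: hA|exact: hA|do 2 (apply: annihilatesB; last exact: hA); exact: hA].
split=> //.
  move=> t; rewrite /v3 -!scaleNr !functionalDl !functionalZl f1 f2 f3; ring.
have bE l : b 0 l = (v3 0 i)^-1 * (l == i)%:R.
  by rewrite [LHS]mxE [delta_mx 0 i 0 l]mxE eqxx.
rewrite /functional bnu (bigD1 i)//= bE eqxx mulr1 mulfV// big1 ?addr0// => l /negPf li.
by rewrite bE li !mulr0.
Qed.

Lemma mx_lt_rnorm (z : Cn) (e : R) : 0 < e ->
  (forall j, rnorm (z 0 j : C) < e) -> rnorm z < e.
Proof.
move=> e0 ze; have : ball (0 : Cn) (Complex e 0 : C) z.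
  split=> [|i j]; first by rewrite ltcE/= eqxx.
  rewrite /ball/= mxE sub0r normrN (ord1 i) lt_rnorm; exact: ze.
by rewrite mx_norm_ball /ball_ /= sub0r normrN lt_rnorm.
Qed.

Lemma rnorm_coord (z : Cn) j : rnorm (z 0 j : C) <= rnorm z.
Proof.
apply/ler_addgt0Pr => e e0; have r0 : 0 < rnorm z + e by rewrite ltr_wpDl ?rnorm_ge0.
have : ball (0 : Cn) (Complex (rnorm z + e) 0 : C) z.
  by rewrite mx_norm_ball /ball_ /= sub0r normrN lt_rnorm ltrDl.
move=> [_ /(_ 0 j)]; rewrite /ball/= mxE sub0r normrN lt_rnorm; exact: ltW.
Qed.

Lemma realify_coord_le (z : Cn) i : `|realify z 0 i| <= rnorm z.
Proof.
have [j ->|j ->] := split_ordP i.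
  by rewrite realifyl (le_trans (Re_le_rnorm _))// rnorm_coord.
by rewrite realifyr (le_trans (Im_le_rnorm _))// rnorm_coord.
Qed.

Lemma rnorm_le_eucl_norm (z : Cn) : rnorm z <= eucl_norm z.
Proof.
apply/ler_addgt0Pr => e e0; apply: ltW; apply: mx_lt_rnorm => [|j].
  by rewrite ltr_wpDl// sqrtr_ge0.
rewrite ltr_pwDr// -[leLHS](ger0_norm (rnorm_ge0 _)) -sqrtr_sqr ler_sqrt.
  rewrite (bigD1 j)//= lerDl sumr_ge0// => k _; exact: sqr_ge0.
by rewrite sumr_ge0// => k _; exact: sqr_ge0.
Qed.

(** The module norm is the maximum norm; [n.+1] is a crude replacement for the square root of [n]
    that stays positive for [n = 0]. *)
Lemma eucl_norm_le_rnorm (z : Cn) : eucl_norm z <= n.+1%:R * rnorm z.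
Proof.
have z0 := rnorm_ge0 z.
rewrite -[leRHS]ger0_norm ?mulr_ge0// -sqrtr_sqr ler_sqrt ?sqr_ge0//.
apply: (@le_trans _ _ (\sum_(j < n) rnorm z ^+ 2)).
  apply: ler_sum => j _; rewrite lerXn2r ?nnegrE//; first exact: (@rnorm_ge0 R C).
  exact: rnorm_coord.
rewrite sumr_const card_ord exprMn -[_ *+ n]mulr_natl ler_wpM2r ?sqr_ge0//.
by rewrite -natrX ler_nat (leq_trans (leqnSn n))// expnS expn1 leq_pmulr.
Qed.

Definition functional_norm u : R := \sum_i `|u 0 i|.

Lemma functional_norm_ge0 u : 0 <= functional_norm u.
Proof. exact: sumr_ge0. Qed.

Lemma functional_le u z : `|functional u z| <= functional_norm u * rnorm z.
Proof.
rewrite /functional /functional_norm mulr_suml (le_trans (ler_norm_sum _ _ _))//.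
by apply: ler_sum => i _; rewrite normrM ler_wpM2l// realify_coord_le.
Qed.

(** On the affine subspace [u] is constant, equal to its value at [a], and a displacement shorter
    than [rho] changes it by at most [functional_norm u * rho]. *)
Lemma functional_tube u (a : Rn) (V : {vspace Rn}) (rho : R) z : annihilates u V ->
  (eucl_dist z (real_affine_subspace a V) < rho%:E)%E ->
  `|functional u z| <= `|\sum_i u 0 i * a 0 i| + functional_norm u * rho.
Proof.
move=> hu /ereal_inf_lt[_ [h /= hV <-]]; rewrite lte_fin => zh.
have hE : functional u h = \sum_i u 0 i * a 0 i.
  apply/eqP; rewrite -subr_eq0 /functional -sumrB.
  under eq_bigr do rewrite -mulrBr.
  apply/eqP; rewrite -[RHS](hu _ hV); apply: eq_bigr => i _.
  by congr (_ * _); rewrite !mxE.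
have -> : functional u z = functional u h + functional u (z - h).
  by rewrite functionalB addrC subrK.
rewrite (le_trans (ler_normD _ _))// hE lerD2l (le_trans (functional_le _ _))//.
rewrite ler_wpM2l ?functional_norm_ge0// ltW//.
exact: le_lt_trans (rnorm_le_eucl_norm _) zh.
Qed.

End LinearAlgebra.

(** * Borel measurability and integrals of edge energies *)

Section BorelIntegrals.
Context {R : realType} {n : nat}.
Local Notation C := (Cplx R).
Local Notation Cn := 'rV[C]_n.
Local Notation T := (measurableTypeR R).
Local Notation mu := (lebesgue_Cn R n).
Local Open Scope ereal_scope.

Lemma open_measurable_Cn (A : set Cn) : open A -> measurable (A : set (borelCn R n)).
Proof. by move=> oA; exact: sub_sigma_algebra. Qed.

Lemma continuous_on_measurable (D : set Cn) (g : Cn -> R) : open D ->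
  (forall z, D z -> {for z, continuous g}) ->
  measurable_fun (D : set (borelCn R n)) (g : borelCn R n -> R).
Proof.
move=> oD cg; apply: (measurability _ (RGenOpens.measurableE R)).
move=> _ [_ [a [b ->] <-]]; apply: open_measurable_Cn.
have abo : open (`]a, b[%classic : set R) by exact: interval_open.
have openI (A : set Cn) : A `<=` A^° -> open A by rewrite openE.
apply: openI => z [Dz gz]; apply: filterI; first exact: open_nbhs_nbhs.
have : nbhs (g z) `]a, b[%classic by exact: open_nbhs_nbhs.
exact: (cg z Dz).
Qed.

Lemma continuous_rnorm_fun (g : Cn -> C) z : differentiable g z ->
  {for z, continuous (fun z => (rnorm (g z) ^+ 2)%R)}.
Proof.
move=> /differentiable_continuous cg; rewrite (_ : (fun _ => _) =
    (fun x => complex.Re (g x) * complex.Re (g x) + complex.Im (g x) * complex.Im (g x))%R).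
  have cRe : {for z, continuous (fun x => complex.Re (g x))}.
    by apply: (@continuous_comp _ _ _ g) cg _; exact: continuous_Re.
  have cIm : {for z, continuous (fun x => complex.Im (g x))}.
    by apply: (@continuous_comp _ _ _ g) cg _; exact: continuous_Im.
  by apply: continuousD; apply: continuousM.
by apply/funext => y; rewrite rnorm_sqr !expr2.
Qed.

Lemma sqr_measurable (D : set Cn) (g : Cn -> C) : open D ->
  (forall z, D z -> differentiable g z) ->
  measurable_fun (D : set (borelCn R n)) (fun z : borelCn R n => (rnorm (g z) ^+ 2)%:E).
Proof.
move=> oD dg; apply/measurable_EFinP; apply: continuous_on_measurable => // z /dg.
exact: continuous_rnorm_fun.
Qed.

Lemma complexify_shift (u : Cn) (t : (n + n).-tuple T) :
  complexify (tuple_shift (fun i => realify u 0%R i) t) = ((complexify t : Cn) + u)%R :> Cn.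
Proof.
apply/rowP => j; rewrite !mxE !tnth_mktuple realifyl realifyr.
by apply: complexP; rewrite ?ReD ?ImD.
Qed.

Lemma integral_Cn (h : borelCn R n -> \bar R) : measurable_fun setT h ->
  (forall z, 0 <= h z) ->
  \int[mu]_z h z = \int[lebesgue_tuple (n + n)]_t h (complexify t).
Proof.
move=> mh h0; rewrite (@ge0_integral_pushforward _ _ _ _ R _ measurable_complexify
  (lebesgue_tuple (n + n)) setT h)//.
Qed.

Lemma measurable_sum_lty d (S : measurableType d) (nu : {measure set S -> \bar R})
    (I : Type) (s : seq I) (phi : I -> S -> \bar R) :
  (forall i, [/\ measurable_fun setT (phi i), forall x, 0 <= phi i x &
     \int[nu]_x phi i x < +oo]) ->
  [/\ measurable_fun setT (fun x => \sum_(i <- s) phi i x),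
   forall x, 0 <= \sum_(i <- s) phi i x & \int[nu]_x \sum_(i <- s) phi i x < +oo].
Proof.
move=> hphi; split.
- by apply: emeasurable_sum => i; have [] := hphi i.
- by move=> x; apply: sume_ge0 => i _; have [] := hphi i.
rewrite ge0_integral_sum//.
- by apply: lte_sum_pinfty => i _; have [] := hphi i.
- by move=> i; have [] := hphi i.
- by move=> i x _; have [] := hphi i.
Qed.

Lemma measurable_add_lty d (S : measurableType d) (nu : {measure set S -> \bar R})
    (phi psi : S -> \bar R) :
  [/\ measurable_fun setT phi, forall x, 0 <= phi x & \int[nu]_x phi x < +oo] ->
  [/\ measurable_fun setT psi, forall x, 0 <= psi x & \int[nu]_x psi x < +oo] ->
  [/\ measurable_fun setT (fun x => phi x + psi x), forall x, 0 <= phi x + psi x &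
    \int[nu]_x (phi x + psi x) < +oo].
Proof.
move=> [m1 p1 i1] [m2 p2 i2]; split; [exact: emeasurable_funD|by move=> t; exact: adde_ge0|].
by rewrite ge0_integralD//; exact: lte_add_pinfty.
Qed.

Variables (Omega E : set Cn) (f : Cn -> C) (w : Cn).
Let D := Omega `\` E.
Hypotheses (open_diff : open D) (f_hol : forall z, D z -> differentiable f z).

Lemma energy_measurable : measurable_fun setT (energy Omega E f : borelCn R n -> \bar R).
Proof.
apply/(measurable_restrictT _ _).1; first exact: open_measurable_Cn.
exact: sqr_measurable.
Qed.

Lemma continuous_measurable_gamma (gamma : R -> C) i :
  (forall x, {for x, continuous gamma}) ->
  measurable_fun setT (fun x : T => realify (gamma x *: w) 0%R i : T).
Proof.
move=> cg; apply: continuous_measurable_fun => x.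
have [j ->|j ->] := split_ordP i.
  rewrite (_ : (fun _ => _) = (fun x => complex.Re (gamma x * w 0 j : C)%R)).
    apply: (@continuous_comp _ _ _ (fun x => gamma x * w 0 j : C)%R).
      by apply: continuousM; [exact: cg|exact: cst_continuous].
    exact: continuous_Re.
  by apply/funext => y; rewrite realifyl mxE.
rewrite (_ : (fun _ => _) = (fun x => complex.Im (gamma x * w 0 j : C)%R)).
  apply: (@continuous_comp _ _ _ (fun x => gamma x * w 0 j : C)%R).
    by apply: continuousM; [exact: cg|exact: cst_continuous].
  exact: continuous_Im.
by apply/funext => y; rewrite realifyr mxE.
Qed.

(** The last integral actually equals that of [|f|^2] over [D]: moving along the slice is a
    translation of tuples, to which [integral_tuple_segment] applies. *)
Lemma edge_energy_integral (a : R) (gamma : R -> C) :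
  (forall x, {for x, continuous gamma}) ->
  \int[mu]_(z in D) (rnorm (f z) ^+ 2)%:E < +oo ->
  [/\ measurable_fun setT
        (fun t : (n + n).-tuple T => edge_energy Omega E f w a gamma (complexify t)),
      forall t : (n + n).-tuple T, 0 <= edge_energy Omega E f w a gamma (complexify t) &
      \int[lebesgue_tuple (n + n)]_t edge_energy Omega E f w a gamma (complexify t) < +oo].
Proof.
move=> cg finf; pose H (t : (n + n).-tuple T) := energy Omega E f (complexify t).
have mH : measurable_fun setT H.
  exact: measurableT_comp energy_measurable measurable_complexify.
have H0 t : 0 <= H t by exact: energy_ge0.
have EE : (fun t : (n + n).-tuple T => edge_energy Omega E f w a gamma (complexify t)) =
    (fun t => \int[lebesgue_measure]_(x in `[a, (a + 1)%R])
       H (tuple_shift (fun i => realify (gamma x *: w) 0%R i) t)).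
  by apply/funext => t; apply: eq_integral => x _; rewrite /H complexify_shift.
have [m1 m2] := @integral_tuple_segment R (n + n) H a
  (fun x i => realify (gamma x *: w) 0%R i) mH H0 (fun i => continuous_measurable_gamma i cg).
split; [by rewrite EE|by move=> t; exact: edge_energy_ge0|].
rewrite EE m2 -(integral_Cn energy_measurable); last exact: energy_ge0.
by rewrite /energy -integral_mkcond.
Qed.

Lemma square_integrable_of_edges (g : Cn -> C) (K : R) (N : nat) : open Omega ->
  closed E -> (forall z, Omega z -> differentiable g z) -> E `<=` Omega -> (0 <= K)%R ->
  \int[mu]_(z in D) (rnorm (f z) ^+ 2)%:E < +oo ->
  (forall z, E z -> (rnorm (g z) ^+ 2)%:E <= K%:E *
    \sum_(k < (2 * N).+1) \sum_(l < (2 * N).+1)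
      (hor_energy Omega E f w (k%:Z - N%:Z) (l%:Z - N%:Z) z +
       ver_energy Omega E f w (k%:Z - N%:Z) (l%:Z - N%:Z) z)) ->
  \int[mu]_(z in E) (rnorm (g z) ^+ 2)%:E < +oo.
Proof.
move=> oO cE dg EO K0 finf gE.
have mE : measurable (E : set (borelCn R n)).
  rewrite -(setCK E); apply: measurableC; apply: open_measurable_Cn; exact: closed_openC.
have mgE : measurable_fun (E : set (borelCn R n)) (fun z : borelCn R n => (rnorm (g z) ^+ 2)%:E).
  by apply: measurable_funS (sqr_measurable oO dg) => //; exact: open_measurable_Cn.
pose S (t : (n + n).-tuple T) := \sum_(k < (2 * N).+1) \sum_(l < (2 * N).+1)
      (hor_energy Omega E f w (k%:Z - N%:Z) (l%:Z - N%:Z) (complexify t) +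
       ver_energy Omega E f w (k%:Z - N%:Z) (l%:Z - N%:Z) (complexify t)).
have [mS S0 Soo] : [/\ measurable_fun setT S, forall t, 0 <= S t &
    \int[lebesgue_tuple (n + n)]_t S t < +oo].
  apply: measurable_sum_lty => k; apply: measurable_sum_lty => l.
  apply: measurable_add_lty.
    exact: (@edge_energy_integral ((k%:Z - N%:Z)%:~R - 2^-1)%R
      (fun x => Complex x ((l%:Z - N%:Z)%:~R - 2^-1)%R)
      (fun x => @continuous_horizontal R _ x) finf).
  exact: (@edge_energy_integral ((l%:Z - N%:Z)%:~R - 2^-1)%R
    (fun y => Complex ((k%:Z - N%:Z)%:~R - 2^-1)%R y)
    (fun x => @continuous_vertical R _ x) finf).
rewrite integral_mkcond.
have mh : measurable_fun setT ((fun z : borelCn R n => (rnorm (g z) ^+ 2)%:E) \_ (E : set (borelCn R n))).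
  exact/(measurable_restrictT _ _).1.
have h0 z : 0 <= ((fun z : borelCn R n => (rnorm (g z) ^+ 2)%:E) \_ (E : set (borelCn R n))) z.
  by rewrite patchE; case: ifP => // _; rewrite lee_fin sqr_ge0.
rewrite (integral_Cn mh h0).
apply: (@le_lt_trans _ _ (\int[lebesgue_tuple (n + n)]_t (K%:E * S t))).
  apply: ge0_le_integral => //.
  - exact: measurableT_comp mh measurable_complexify.
  - exact: measurable_funeM.
  - move=> t _; rewrite patchE; case: ifPn => [/set_mem Et|_]; first exact: gE.
    by rewrite mule_ge0// lee_fin.
by rewrite ge0_integralZl// lte_mul_pinfty// lee_fin.
Qed.

End BorelIntegrals.

(** * Choice of the slice direction *)

Section Geometry.
Context {R : realType} {n : nat}.
Local Notation C := (Cplx R).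
Local Notation Cn := 'rV[C]_n.

Lemma eucl_dist_le (E : set Cn) e z (r : R) : E e -> n.+1%:R * rnorm (z - e) <= r ->
  (eucl_dist z E <= r%:E)%E.
Proof.
move=> Ee zr; apply: (@le_trans _ _ (eucl_norm (z - e))%:E).
  by apply: ereal_inf_lbound; exists e.
by rewrite lee_fin (le_trans (eucl_norm_le_rnorm _)).
Qed.

Lemma grid_direction (E : set Cn) (a : 'rV[R]_(n + n)) (V : {vspace 'rV[R]_(n + n)})
    (rho c : R) : (3 <= n + n - \dim V)%N -> 0 < rho -> 0 < c ->
  E `<=` [set z | (eucl_dist z (real_affine_subspace a V) < rho%:E)%E] ->
  exists (w nu : Cn) (m bnd : Cn -> R) (K M B : R),
  [/\ 10 * rnorm w <= c,
    forall e z (t : C), E e -> rnorm (z + t *: w - e) < c ->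
      `|complex.Re t| <= bnd z /\ `|complex.Im t| <= bnd z,
    forall z : Cn, exists B' : R, nbhs z [set x | bnd x <= B'] &
    forall e, E e -> bnd e <= B] /\
  [/\ 0 <= K, forall z (t : C), m (z + t *: w) = m z,
    forall z z', m z - m z' <= K * rnorm (z - z'),
    forall z (s : R), m (z + (Complex s 0 : C) *: nu) = m z + s &
    forall e, E e -> m e <= M].
Proof.
move=> V3 rho0 c0 EH; have [u1 [u2 [u3 [w0 [nu [[a1 a2 a3] [f1 f2 f3 fnu]]]]]]] := transverse_line V3.
pose tube (u : 'rV[R]_(n + n)) := `|\sum_i u 0 i * a 0 i| + functional_norm u * rho.
have tubeP u e : annihilates u V -> E e -> `|functional u e| <= tube u.
  by move=> hu /EH; exact: functional_tube.
pose K := functional_norm u1 + functional_norm u2.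
have K0 : 0 <= K by rewrite addr_ge0// functional_norm_ge0.
pose M := tube u1 + tube u2.
have tube0 u : 0 <= tube u by rewrite addr_ge0// mulr_ge0// ?functional_norm_ge0// ltW.
pose S (z : Cn) := `|functional u1 z| + `|functional u2 z|.
have rw0 := rnorm_ge0 w0.
(* Rescaling [w0] by [d] makes [10 * rnorm w <= c]; the summand 1 covers [rnorm w0 = 0]. *)
pose d := c / (10 * (rnorm w0 + 1)).
have d0 : 0 < d by rewrite divr_gt0// mulr_gt0// ltr_wpDl.
pose w : Cn := (Complex d 0 : C) *: w0.
have fw u (t : C) : functional u (t *: w) = d * functional u (t *: w0).
  by rewrite /w scalerA mulrC -scalerA functional_real_scale.
have bound u z e (t : C) : annihilates u V -> E e -> rnorm (z + t *: w - e) < c ->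
    d * `|functional u (t *: w0)| <= `|functional u z| + tube u + functional_norm u * c.
  move=> hu Ee zc; rewrite -(gtr0_norm d0) -normrM -fw.
  have -> : functional u (t *: w) = functional u (z + t *: w - e) - functional u z + functional u e.
    by rewrite functionalB functionalD; ring.
  have h1 : `|functional u (z + t *: w - e)| <= functional_norm u * c.
    by apply: le_trans (functional_le _ _) _; rewrite ler_wpM2l ?functional_norm_ge0// ltW.
  have h2 := tubeP u e hu Ee.
  have h3 := ler_normD (functional u (z + t *: w - e) - functional u z) (functional u e).
  have h4 := ler_normB (functional u (z + t *: w - e)) (functional u z).
  clear -h1 h2 h3 h4; lra.
have Sloc z x : rnorm (x - z) < 1 -> S x <= S z + K.
  have one u : rnorm (x - z) < 1 -> `|functional u x| <= `|functional u z| + functional_norm u.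
    move=> xz; rewrite -[x in leLHS](subrK z) functionalD addrC (le_trans (ler_normD _ _))//.
    rewrite lerD2l (le_trans (functional_le _ _))// ler_piMr ?functional_norm_ge0// ltW//.
  by move=> xz; rewrite /S /K addrACA lerD ?one.
(* Where the slice comes within [c] of [E], [d * |Re t|] and [d * |Im t|] are at most the values of
   [u1], [u2] at [z] plus the widths of tube and neighbourhood. On [E] the sum [S] is at most [M],
   whence the uniform bound. *)
exists w, nu, (functional u3), (fun z => (S z + M + K * c) / d), (functional_norm u3),
  (tube u3), ((M + M + K * c) / d); split; split.
- have rd : rnorm (Complex d 0 : C) = d.
    by rewrite rnorm_normc /Normc.normc /= expr0n addr0 sqrtr_sqr gtr0_norm.
  have dE : 10 * (d * (rnorm w0 + 1)) = c.
    rewrite /d; field; rewrite gt_eqF// ltr_wpDl//.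
  by rewrite /w rnormZ rd -dE mulrDr mulr1 ler_wpM2l// lerDl ltW.
- move=> e z t Ee zc; have b1 := bound u1 z e t a1 Ee zc; have b2 := bound u2 z e t a2 Ee zc.
  rewrite f1 in b1; rewrite f2 in b2.
  have g1 := tube0 u1; have g2 := tube0 u2.
  have p1 := mulr_ge0 (functional_norm_ge0 u1) (ltW c0).
  have p2 := mulr_ge0 (functional_norm_ge0 u2) (ltW c0).
  have q1 := normr_ge0 (functional u1 z); have q2 := normr_ge0 (functional u2 z).
  by rewrite !ler_pdivlMr// ![_ * d]mulrC /S /M /K mulrDl; split; clear -b1 b2 g1 g2 p1 p2 q1 q2; lra.
- move=> z; exists ((S z + K + M + K * c) / d); apply/nbhs_rnorm; exists 1 => // x /Sloc xz.
  by rewrite /= ler_pM2r ?invr_gt0// !lerD2r.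
- move=> e Ee; rewrite ler_pM2r ?invr_gt0// !lerD2r.
  by apply: lerD; exact: tubeP.
- exact: functional_norm_ge0.
- by move=> z t; rewrite functionalD fw f3 mulr0 addr0.
- by move=> z z'; rewrite -functionalB (le_trans (ler_norm _))// functional_le.
- by move=> z s; rewrite functionalD functional_real_scale fnu mulr1.
- by move=> e Ee; apply: le_trans (ler_norm _) _; exact: tubeP.
Qed.
End Geometry.

Theorem theorem1p4 (R : realType) (n : nat) (Omega E : set 'rV[Cplx R]_n)
    (Omega_domain : domain Omega) (E_closed : closed E)
    (E_nbhd : exists2 r : R, 0 < r &
      [set z | (eucl_dist z E <= r%:E)%E] `<=` Omega)
    (E_near_subspace :
      exists (a : 'rV[R]_(n + n)) (V : {vspace 'rV[R]_(n + n)}) (rho : R),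
        [/\ (3 <= n + n - \dim V)%N, 0 < rho &
          E `<=` [set z |
            (eucl_dist z (real_affine_subspace a V) < rho%:E)%E]])
    (compl_connected : connected (Omega `\` E)) :
  forall f : 'rV[Cplx R]_n -> Cplx R,
    holomorphic_on (Omega `\` E) f -> square_integrable_on (Omega `\` E) f ->
  exists F : 'rV[Cplx R]_n -> Cplx R,
    [/\ holomorphic_on Omega F, square_integrable_on Omega F &
        forall z, (Omega `\` E) z -> F z = f z].
Proof.
move=> f f_hol f_sqr; have [oO _] := Omega_domain.
(* The half-line argument starts at a point of [E]; for empty [E] the function [f] is its own
   extension. *)
have [E0|/set0P E_neq0] := eqVneq E set0.
  by move: f_hol f_sqr; rewrite E0 setD0 => f_hol f_sqr; exists f; split.
have [r r0 rE] := E_nbhd.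
have [a [V [rho [V3 rho0 EH]]]] := E_near_subspace.
(* The factor [n.+1] passes from the maximum norm to the Euclidean distance, and the 2 makes [r]
   cover radius [2 * c]. *)
pose c : R := r / (2 * n.+1%:R).
have c0 : 0 < c by rewrite divr_gt0// mulr_gt0.
have cE : n.+1%:R * (2 * c) = r by rewrite /c; field; rewrite addrC natr1 pnatr_eq0.
have nbE e z : E e -> rnorm (z - e) <= 2 * c -> Omega z.
  move=> Ee zc; apply: rE; apply: (@eucl_dist_le R n E e) => //.
  by rewrite -cE ler_wpM2l.
have EO : E `<=` Omega.
  by move=> e Ee; apply: (nbE e) => //; rewrite subrr rnorm0 mulr_ge0// ltW.
have [w [nu [m [bnd [K [M [B [[w_small slice loc bndB] [K0 mw mK mnu mM]]]]]]]]] :=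
  grid_direction V3 rho0 c0 EH.
have oD := open_diff oO E_closed.
pose F := extension E f w c bnd.
have F_hol : holomorphic_on Omega F.
  exact: (extension_differentiable c0 oO E_closed nbE f_hol w_small slice loc).
have Ff z : (Omega `\` E) z -> F z = f z.
  move=> Dz; rewrite /F /extension.
  rewrite (correction_eq0 c0 oO E_closed nbE f_hol w_small slice loc K0 mw mK mnu mM compl_connected E_neq0 Dz).
  exact: addr0.
have f_sqr' : (\int[lebesgue_Cn R n]_(z in Omega `\` E) (rnorm (f z) ^+ 2)%:E < +oo)%E := f_sqr.
exists F; split => //.
(* [bnd] is bounded on all of [E], so one finite grid serves every point of [E] and the bound can be
   integrated. *)
have [N BN] : exists N : nat, B < N%:R.
  by exists (Num.truncn B).+1; exact: truncnS_gt.
have K2 : 0 <= square_const N :> R.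
  by rewrite /square_const mulr_ge0 ?sqr_ge0// mulr_ge0 ?sqr_ge0.
have FE : (\int[lebesgue_Cn R n]_(z in E) (rnorm (F z) ^+ 2)%:E < +oo)%E.
  apply: (@square_integrable_of_edges R n Omega E f w oD f_hol F (square_const N) N) => //.
  move=> z Ez; apply: (extension_sqr_bound c0 nbE f_hol w_small slice Ez).
  exact: le_lt_trans (bndB z Ez) BN.
have UO : (Omega `\` E) `|` E = Omega := setDKU EO.
have mE : measurable (E : set (borelCn R n)).
  rewrite -(setCK E); apply: measurableC; apply: open_measurable_Cn; exact: closed_openC.
have mD : measurable (Omega `\` E : set (borelCn R n)) by exact: open_measurable_Cn.
suff : (\int[lebesgue_Cn R n]_(z in (Omega `\` E) `|` E) (rnorm (F z) ^+ 2)%:E < +oo)%E.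
  by rewrite UO.
rewrite (ge0_integral_setU _ mD mE); last 3 first.
- by rewrite UO; exact: sqr_measurable.
- by move=> z _; rewrite lee_fin sqr_ge0.
- by rewrite disj_set2E setDKI.
rewrite lte_add_pinfty//.
by under eq_integral => z Dz do rewrite (Ff z (set_mem Dz)).
Qed.
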